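(* Let $A\in\mathscr{M}(\Omega,\varkappa,\mathfrak{m})$ and let $u\in H^2(\Omega;\mathbb{C})$ satisfy $\mathcal{L}_A^eu=0$ in $\Omega$ and $u=0$ in $\omega$, for some nonempty open subset $\omega$ of $\Omega$. Then $u=0$ in $\Omega$.
   Context: $\Omega\subset\mathbb{R}^n$, $n\ge 2$, is a bounded Lipschitz domain (a domain is connected and open). For $\mathfrak{m}>0$, $\varkappa\ge1$, $\mathscr{M}(\Omega,\varkappa,\mathfrak{m})$ is the set of symmetric real matrices $A=(a_{k\ell})$, $a_{k\ell}\in C^{2,1}(\overline\Omega)$, with $\varkappa^{-1}|\xi|^2\le (A(x)\xi|\xi)\le\varkappa|\xi|^2$ for $x\in\Omega$, $\xi\in\mathbb{R}^n$, and $\|A\|_{C^{2,1}(\overline\Omega;\mathbb{R}^{n\times n})}\le\mathfrak{m}$. $\Delta_Au=\mathrm{div}(A\nabla u)$. $\mathcal{L}_A^e=\Delta_A+\sum_{\ell=1}^np_\ell\partial_\ell+q$, where $p_1,\dots,p_n,q\in L^\infty(\Omega;\mathbb{C})$ have $L^\infty(\Omega)$-norms at most $\mathfrak{m}$. *)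

(* Defs.v *)
From HB Require Import structures.
From mathcomp Require Import all_boot all_order all_algebra.
From mathcomp Require Import all_classical all_reals all_analysis.
From mathcomp Require Import complex.

Set Implicit Arguments.
Unset Strict Implicit.
Unset Printing Implicit Defensive.

Import Order.TTheory GRing.Theory Num.Theory.
Import numFieldNormedType.Exports.

Local Open Scope classical_set_scope.
Local Open Scope ring_scope.

(** * Lebesgue measure on R^n

R^n is ['rV[R]_n], whose library topology is that of the sup norm. It is given
the sigma-algebra generated by the coordinates, i.e. the Borel one. *)

Definition measure_rV_display : measure_display. Proof. exact. Qed.

Section measurable_rV.
Context {R : realType} {n : nat}.

Definition coord_rV (i : 'I_n) (x : 'rV[R]_n) : measurableTypeR R := x 0 i.

Let rV_set0 : g_sigma_preimage coord_rV set0.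
Proof. exact: sigma_algebra0. Qed.

Let rV_setC A : g_sigma_preimage coord_rV A ->
  g_sigma_preimage coord_rV (~` A).
Proof. exact: sigma_algebraC. Qed.

Let rV_bigcup (F : (set 'rV[R]_n)^nat) :
  (forall i, g_sigma_preimage coord_rV (F i)) ->
  g_sigma_preimage coord_rV (\bigcup_i (F i)).
Proof. exact: sigma_algebra_bigcup. Qed.

HB.instance Definition _ := @isMeasurable.Build measure_rV_display
  'rV[R]_n (g_sigma_preimage coord_rV) rV_set0 rV_setC rV_bigcup.

Lemma measurable_coord_rV (i : 'I_n) : measurable_fun [set: 'rV[R]_n] (coord_rV i).
Proof.
move=> _ Y mY; rewrite setTI; apply: sub_sigma_algebra => /=.
rewrite -bigcup_seq/=; exists i => /=; first by rewrite mem_index_enum.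
by exists Y => //; rewrite setTI.
Qed.

Lemma measurable_fun_rV d (T : measurableType d) (f : T -> 'rV[R]_n) :
  (forall i, measurable_fun setT (coord_rV i \o f)) -> measurable_fun setT f.
Proof.
move=> mf.
have H : g_sigma_preimage (fun i => coord_rV i \o f) `<=` measurable.
  apply: smallest_sub; first exact: sigma_algebra_measurable.
  rewrite -bigcup_seq; apply: bigcup_sub => i _.
  by move=> A [B mB <-]; exact: mf.
move=> _ A mA; apply: H; rewrite g_sigma_preimage_comp.
by exists A.
Qed.

End measurable_rV.

Section cons_rV.
Context {R : realType} {n : nat}.

Definition cons_rV (p : measurableTypeR R * 'rV[R]_n) : 'rV[R]_n.+1 :=
  \row_i (if unlift ord0 i is Some j then p.2 0 j else p.1).

Definition uncons_rV (x : 'rV[R]_n.+1) : measurableTypeR R * 'rV[R]_n :=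
  (x 0 ord0, \row_j x 0 (lift ord0 j)).

Lemma cons_rVK : cancel cons_rV uncons_rV.
Proof.
move=> [a x]; rewrite /uncons_rV mxE unlift_none; congr pair.
by apply/rowP => j; rewrite !mxE liftK.
Qed.

Lemma measurable_cons_rV : measurable_fun setT cons_rV.
Proof.
apply: measurable_fun_rV => i.
have [j ->|->] := unliftP ord0 i.
  rewrite (_ : _ \o _ = coord_rV j \o snd).
    by apply: measurableT_comp => //; exact: measurable_coord_rV.
  by apply/funext => p; rewrite /coord_rV/= mxE liftK.
rewrite (_ : _ \o _ = fst)//.
by apply/funext => p; rewrite /coord_rV/= mxE unlift_none.
Qed.

Lemma measurable_uncons_rV : measurable_fun setT uncons_rV.
Proof.
apply/measurable_fun_pairP; split; first exact: (measurable_coord_rV ord0).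
apply: measurable_fun_rV => i.
rewrite (_ : _ \o _ = coord_rV (lift ord0 i)); first exact: measurable_coord_rV.
by apply/funext => x; rewrite /coord_rV/= mxE.
Qed.

End cons_rV.

Section lebesgue_rV_succ.
Local Open Scope ereal_scope.
Context {R : realType} {n : nat}.
Variable m : {sigma_finite_measure set 'rV[R]_n -> \bar R}.

Definition lebesgue_rV_succ : set 'rV[R]_n.+1 -> \bar R :=
  pushforward (lebesgue_measure \x m) cons_rV.

Let succ0 : lebesgue_rV_succ set0 = 0.
Proof. by rewrite /lebesgue_rV_succ /pushforward preimage_set0 measure0. Qed.

Let succ_ge0 A : 0 <= lebesgue_rV_succ A.
Proof. by rewrite /lebesgue_rV_succ /pushforward; apply: measure_ge0. Qed.

Let succ_sigma_additive : semi_sigma_additive lebesgue_rV_succ.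
Proof.
move=> F mF tF mUF; rewrite /lebesgue_rV_succ /pushforward preimage_bigcup.
apply: measure_semi_sigma_additive.
- by move=> k; rewrite -[X in measurable X]setTI; exact: measurable_cons_rV.
- apply/trivIsetP => /= i j _ _ ij; rewrite -preimage_setI.
  by move/trivIsetP : tF => /(_ _ _ _ _ ij) ->//; rewrite preimage_set0.
- rewrite -preimage_bigcup -[X in measurable X]setTI.
  exact: measurable_cons_rV.
Qed.

HB.instance Definition _ := isMeasure.Build _ _ _ lebesgue_rV_succ
  succ0 succ_ge0 succ_sigma_additive.

Let succ_sigma_finite : sigma_finite setT lebesgue_rV_succ.
Proof.
have /sigma_finiteP[F [TF ndF Foo]] := sigma_finiteT (@lebesgue_measure R).
have /sigma_finiteP[G [TG ndG Goo]] := sigma_finiteT m.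
exists (fun k => uncons_rV @^-1` (F k `*` G k)).
  rewrite -preimage_bigcup -[LHS](preimage_setT uncons_rV); congr (_ @^-1` _).
  rewrite -setXTT TF TG predeqE => -[x y]; split.
    move=> [/= [k _ Fkx] [l _ Gly]]; exists (maxn k l) => //; split.
    - by move: x Fkx; exact/subsetPset/ndF/leq_maxl.
    - by move: y Gly; exact/subsetPset/ndG/leq_maxr.
  by move=> [k _ []/= ? ?]; split; exists k.
move=> k; have [mFk Fkoo] := Foo k; have [mGk Gkoo] := Goo k; split.
  rewrite -[X in measurable X]setTI; apply: measurable_uncons_rV => //.
  exact: measurableX.
rewrite /lebesgue_rV_succ /pushforward -comp_preimage.
rewrite (_ : _ \o _ = id); last by apply/funext => p; exact: cons_rVK.
by rewrite preimage_id product_measure1E// lte_mul_pinfty// ge0_fin_numE.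
Qed.

HB.instance Definition _ := @Measure_isSigmaFinite.Build _ _ _
  lebesgue_rV_succ succ_sigma_finite.

End lebesgue_rV_succ.

Fixpoint lebesgue_rV (R : realType) (n : nat) :
    {sigma_finite_measure set 'rV[R]_n -> \bar R} :=
  match n with
  | 0 => \d_(0 : 'rV[R]_0)
  | k.+1 => lebesgue_rV_succ (lebesgue_rV R k)
  end.

Lemma lebesgue_rV_box (R : realType) (n : nat) (A : 'I_n -> set (measurableTypeR R)) :
  (forall i, measurable (A i)) ->
  lebesgue_rV R n [set x | forall i, A i (x 0 i)] =
  (\prod_(i < n) lebesgue_measure (A i))%E.
Proof.
elim: n A => [|n IH] A mA.
  by rewrite big_ord0 /= diracE mem_set//= => -[].
have mA' : measurable [set x : 'rV[R]_n | forall i, A (lift ord0 i) (x 0 i)].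
  rewrite (_ : mkset _ =
      \bigcap_(i in [set: 'I_n]) (coord_rV i @^-1` A (lift ord0 i))).
    apply: fin_bigcap_measurable => // i _.
    by rewrite -[X in measurable X]setTI; exact: measurable_coord_rV.
  by apply/seteqP; split => x /= H i; [move=> _|]; exact: H.
rewrite big_ord_recl/= -IH// -product_measure1E//.
rewrite /lebesgue_rV_succ /pushforward; congr product_measure1.
apply/seteqP; split => -[a x] /=.
  move=> H; split => [|i].
    by have := H ord0; rewrite mxE unlift_none.
  by have := H (lift ord0 i); rewrite mxE liftK.
by move=> [Aa Ax] i; rewrite mxE; case: unliftP => [j ->|->].
Qed.

(** * Classical derivatives, [C^k] and [C^{2,1}] *)

(* Euclidean (Frobenius) norm; the library's norm on matrices is the sup norm. *)
Definition enorm {R : rcfType} {m n : nat} (M : 'M[R]_(m, n)) : R :=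
  Num.sqrt (\sum_i \sum_j M i j ^+ 2).

Section classical_derivatives.
Context {R : realType} {n : nat}.
Implicit Types (Omega : set 'rV[R]_n) (f : 'rV[R]_n -> R) (s : seq 'I_n).

Definition partial (i : 'I_n) f : 'rV[R]_n -> R :=
  fun x => 'D_(delta_mx 0 i) f x.

(* [partials [:: i1; ...; ik] f] is the derivative of order k along
   the coordinates i1, ..., ik. *)
Definition partials s f : 'rV[R]_n -> R := foldr partial f s.

Definition Ck_on Omega (k : nat) f : Prop :=
  forall s, (size s <= k)%N ->
    (forall x, Omega x -> {for x, continuous (partials s f)}) /\
    ((size s < k)%N -> forall i x, Omega x ->
       derivable (partials s f) x (delta_mx 0 i)).

(* The derivatives are taken in the open set Omega and extend continuously
   to its closure. *)
Definition Ck_closure Omega (k : nat) f : Prop :=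
  [/\ Ck_on Omega k f,
      {within closure Omega, continuous f} &
      forall s, (size s <= k)%N ->
        exists2 g : 'rV[R]_n -> R, {within closure Omega, continuous g} &
          forall x, Omega x -> g x = partials s f x].

Definition C21_closure Omega f : Prop :=
  Ck_closure Omega 2 f /\
  forall s, size s = 2%N -> [lipschitz partials s f x | x in Omega].

Definition partials_mx s (A : 'rV[R]_n -> 'M[R]_n) (x : 'rV[R]_n) : 'M[R]_n :=
  \matrix_(k, l) partials s (fun y => A y k l) x.

(* Sum over j <= 2 of the sup norms of the derivatives of order j, plus the
   Lipschitz seminorm of those of order 2. *)
Definition C21_norm Omega (A : 'rV[R]_n -> 'M[R]_n) : \bar R :=
  (\sum_(j < 3) ereal_sup
     [set e | exists (s : j.-tuple 'I_n) (x : 'rV[R]_n),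
        Omega x /\ e = (enorm (partials_mx s A x))%:E] +
   ereal_sup
     [set e | exists (s : 2.-tuple 'I_n) (x y : 'rV[R]_n),
        [/\ Omega x, Omega y, x <> y &
         e = (enorm (partials_mx s A x - partials_mx s A y)
              / enorm (x - y))%:E]])%E.

End classical_derivatives.

(** * Bounded Lipschitz domains *)

Section domains.
Context {R : realType} {n : nat}.
Implicit Type Omega : set 'rV[R]_n.

(* Near every boundary point z, after the orthogonal change of coordinates
   y = x Q, Omega is the strict epigraph of a Lipschitz function of the
   n - 1 coordinates other than the i-th one. *)
Definition lipschitz_boundary Omega : Prop :=
  forall z, (closure Omega `\` Omega) z ->
    exists (Q : 'M[R]_n) (i : 'I_n) (g : 'rV[R]_n.-1 -> R),
      [/\ Q *m Q^T = 1%:M,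
          lipschitz g &
          \forall x \near z, Omega x <-> g (col' i (x *m Q)) < (x *m Q) 0 i].

Definition bounded_lipschitz_domain Omega : Prop :=
  [/\ open Omega, connected Omega, bounded_set Omega &
      lipschitz_boundary Omega].

End domains.

(** * The class of coefficient matrices *)

Record elliptic_class {R : realType} {n : nat} (Omega : set 'rV[R]_n)
    (kappa m : R) (A : 'rV[R]_n -> 'M[R]_n) : Prop := {
  elliptic_sym : forall x, closure Omega x -> (A x)^T = A x ;
  elliptic_C21 : forall k l, C21_closure Omega (fun x => A x k l) ;
  elliptic_bounds : forall x (xi : 'cV[R]_n), Omega x ->
    kappa^-1 * enorm xi ^+ 2 <= (xi^T *m A x *m xi) 0 0
      <= kappa * enorm xi ^+ 2 ;
  elliptic_norm : (C21_norm Omega A <= m%:E)%E }.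

(** * Complex Lebesgue and Sobolev spaces

Classes of functions modulo equality almost everywhere are represented by
Borel functions; values outside Omega are irrelevant. *)

Section sobolev.
Context {R : realType} {n : nat}.
Implicit Types (Omega : set 'rV[R]_n) (u v : 'rV[R]_n -> R[i]).

Let mu := lebesgue_rV R n.

Definition Lp_norm Omega (p : \bar R) u : \bar R :=
  Lnorm mu p ((fun x => (ComplexField.Normc.normc (u x))%:E) \_ Omega).

Definition in_Lp Omega (p : \bar R) u : Prop :=
  [/\ measurable_fun Omega (fun x => complex.Re (u x)),
      measurable_fun Omega (fun x => complex.Im (u x)) &
      (Lp_norm Omega p u < +oo)%E].

Definition cintegral Omega u : R[i] :=
  Complex (\int[mu]_(x in Omega) complex.Re (u x))
          (\int[mu]_(x in Omega) complex.Im (u x)).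

Definition test_function Omega (phi : 'rV[R]_n -> R) : Prop :=
  let K := closure [set x | phi x != 0] in
  [/\ forall k, Ck_on setT k phi, compact K & K `<=` Omega].

Definition is_weak_derivative Omega (s : seq 'I_n) u v : Prop :=
  forall phi, test_function Omega phi ->
    cintegral Omega (fun x => u x * (partials s phi x)%:C%C) =
    (-1) ^+ size s * cintegral Omega (fun x => v x * (phi x)%:C%C).

Definition sobolev_H2 Omega u : Prop :=
  in_Lp Omega 2%:E u /\
  forall s : seq 'I_n, (size s <= 2)%N ->
    exists2 v, in_Lp Omega 2%:E v & is_weak_derivative Omega s u v.

(* A representative of the weak partial derivative of u in L^2(Omega), which is
   unique almost everywhere; 0 if there is none. *)
Definition weak_partial Omega (i : 'I_n) u : 'rV[R]_n -> R[i] :=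
  xget (fun=> 0)
    [set v | in_Lp Omega 2%:E v /\ is_weak_derivative Omega [:: i] u v].

Definition Delta_A Omega (A : 'rV[R]_n -> 'M[R]_n) u : 'rV[R]_n -> R[i] :=
  fun x => \sum_k weak_partial Omega k
    (fun y => \sum_l (A y k l)%:C%C * weak_partial Omega l u y) x.

Definition L_A_e Omega (A : 'rV[R]_n -> 'M[R]_n)
    (p : 'I_n -> 'rV[R]_n -> R[i]) (q : 'rV[R]_n -> R[i]) u :
    'rV[R]_n -> R[i] :=
  fun x => Delta_A Omega A u x
           + \sum_l p l x * weak_partial Omega l u x + q x * u x.

Definition ae_zero_on (D : set 'rV[R]_n) u : Prop :=
  {ae mu, forall x, D x -> u x = 0}.

End sobolev.

(* Main.v *)
Require Import Defs.
From mathcomp Require Import all_boot all_order all_algebra.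
From mathcomp Require Import all_classical all_reals all_analysis.
From mathcomp Require Import measurable_realfun.
From mathcomp Require Import complex ring lra.

Set Implicit Arguments.
Unset Strict Implicit.
Unset Printing Implicit Defensive.

Import Order.TTheory GRing.Theory Num.Theory.
Import numFieldNormedType.Exports.
Import HBSimple HBNNSimple.

Local Open Scope classical_set_scope.
Local Open Scope ring_scope.

(** Unique continuation is a consequence of a Carleman estimate for the principal part. Fix a
point x0 and put psi x = - |x - x0|^2 and phi = exp (lam psi). If v is of class C^2 with
compact support K in Omega, away from x0, then for lam large, some c > 0 and all large tau,

  c int e^(2 tau phi) (tau |grad v|^2 + tau^3 v^2) <= int e^(2 tau phi) (div (A grad v))^2

([carleman_integral]). To see this one writes v = e^(- tau phi) w. The conjugated operator
applied to w is S + T up to a bounded multiple of tau w, with S essentially self-adjoint and T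
essentially skew. Since (S + T)^2 >= 2 S T, it suffices to integrate 2 S T: it is a divergence
plus quadratic forms in grad w and w ([carleman_identity]), which are positive once lam is large
([carleman_arith]), because grad psi does not vanish on K and A is elliptic.

The estimate is passed to functions u of class H^2 that vanish near x0, by applying it to
v = chi u_e, where u_e is a mollification of u and chi is a cut-off equal to 1 on the ball
|x - x0|^2 < a1 ([carleman_limit]). In that ball only div (A grad u) is left on the right-hand
side. Outside it the cut-off creates other terms, but phi is radially decreasing, so that there
the weight is at most its value on the sphere |x - x0|^2 = a1, which is its infimum over the ball.

By the equation, |div (A grad u)| <= C (|u| + |grad u|), and for large tau this is absorbed by
the left-hand side. Dividing by the value of the weight on the sphere and letting tau tend to
infinity gives u = 0 in the ball ([local_uniqueness]): if u vanishes near x0, it vanishes in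
every ball centred at x0 whose closure is in Omega. The set of points near which u vanishes is
therefore open and closed in Omega ([connected_propagation]), hence it is all of Omega.

The coefficients of A are real, so that the real and imaginary parts of u are treated
separately in the estimate; they are coupled only in the absorption of the lower-order terms.
The weak derivatives in the equation are arbitrary representatives. Away from null sets they
are identified with the expected expressions by the product rule [weak_product] and the lemma of
du Bois-Reymond ([dubois_reymond], [sobolev_jetP]). *)

(** * Borel sets and translations in R^n *)
Section measure_rV.
Context {R : realType} {n : nat}.
Local Notation V := 'rV[R]_n.
Local Notation mu := (lebesgue_rV R n).
Implicit Types (x y a : V) (U D : set V) (f g : V -> R).

Lemma measurable_box (A : 'I_n -> set (measurableTypeR R)) :
  (forall i, measurable (A i)) -> measurable [set x : V | forall i, A i (x 0 i)].
Proof.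
move=> mA; rewrite (_ : mkset _ = \bigcap_(i in [set: 'I_n]) (coord_rV i @^-1` A i)).
  apply: fin_bigcap_measurable => // i _.
  by rewrite -[X in measurable X]setTI; exact: measurable_coord_rV.
by apply/seteqP; split => x /= H i; [move=> _|]; exact: H.
Qed.

Definition boxes : set (set V) := [set X | exists2 A : 'I_n -> set (measurableTypeR R),
  (forall i, measurable (A i)) & X = [set x : V | forall i, A i (x 0 i)]].

(** Boxes are stable under intersection, so that a measure that is finite on bounded sets is
determined by its values on them. *)
Lemma measurable_boxes : measurable = <<s boxes >> :> set (set V).
Proof.
apply/seteqP; split; last first.
  apply: smallest_sub; first exact: sigma_algebra_measurable.
  by move=> _ [A mA ->]; exact: measurable_box.
apply: smallest_sub; first exact: smallest_sigma_algebra.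
rewrite -bigcup_seq; apply: bigcup_sub => i _ _ [B mB <-].
apply: sub_sigma_algebra.
exists (fun j => if j == i then B else setT).
  by move=> j; case: ifP.
rewrite setTI; apply/seteqP; split => x /=.
  by move=> Bx j; case: eqP => // ->.
by move=> /(_ i); rewrite eqxx.
Qed.

Lemma setI_closed_boxes : setI_closed boxes.
Proof.
move=> _ _ [A mA ->] [B mB ->]; exists (fun i => A i `&` B i).
  by move=> i; exact: measurableI.
apply/seteqP; split => x /=; first by move=> [HA HB] i; split.
by move=> H; split=> i; have [] := H i.
Qed.

Lemma measurable_shift a : measurable_fun setT (fun x : V => x + a).
Proof.
apply: measurable_fun_rV => i.
rewrite (_ : _ \o _ = (fun x => coord_rV i x + a 0 i)); last first.
  by apply/funext => x; rewrite /coord_rV/= mxE.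
by apply: measurable_funD => //; exact: measurable_coord_rV.
Qed.

Lemma lebesgue_measure_shift (c : R) (A : set (measurableTypeR R)) : measurable A ->
  lebesgue_measure ((fun x : measurableTypeR R => x + c) @^-1` A) = lebesgue_measure A.
Proof.
move=> mA.
have mf : measurable_fun [set: measurableTypeR R] (fun x : measurableTypeR R => x + c : measurableTypeR R).
  by apply: measurable_funD.
have := @lebesgue_measure_unique R (pushforward lebesgue_measure (fun x : measurableTypeR R =>
    x + c : measurableTypeR R)).
move=> H; apply/esym; apply: (H mf) => //.
move=> X /= [[p q] _ <-] /=.
rewrite /pushforward (_ : _ @^-1` _ = `]p - c, q - c]%classic); last first.
  by apply/seteqP; split => x /=; rewrite !in_itv/= ltrBlDr lerBrDr.
rewrite !lebesgue_measure_itv/= !lte_fin ltrD2r.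
by case: ifP => // _; rewrite -!EFinB; congr EFin; ring.
Qed.

(** On boxes this is the invariance of the measure of the line, coordinate by coordinate, and
boxes determine the measure. *)
Lemma lebesgue_rV_shift a (A : set V) : measurable A ->
  mu ((fun x => x + a) @^-1` A) = mu A.
Proof.
move=> mA; apply/esym.
pose g (k : nat) : set V := [set x | forall i, `[- k%:R, k%:R]%classic (x 0 i)].
have := @measure_unique _ R V boxes g measurable_boxes setI_closed_boxes _ _
  mu (pushforward mu (fun x : V => x + a)).
apply => //.
- by move=> k; exists (fun=> `[- k%:R, k%:R]%classic).
- apply/seteqP; split=> // x _.
  pose k := Num.trunc (\sum_i `|x 0 i|).
  exists k.+1 => // i /=; rewrite in_itv/= -ler_norml.
  apply: (@le_trans _ _ (\sum_i `|x 0 i|)).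
    by rewrite (bigD1 i)//= lerDl sumr_ge0.
  by rewrite ltW// /k truncnS_gt.
- exact: measurable_shift.
- move=> ? _ [B mB ->].
  have E1 : mu [set x : V | forall i, B i (x 0 i)] =
      (\prod_(i < n) lebesgue_measure (B i))%E by exact: lebesgue_rV_box.
  have E2 := @lebesgue_rV_box R n (fun i => (fun t : measurableTypeR R => t + a 0 i) @^-1` B i).
  rewrite [LHS]E1 {E1}; transitivity (mu [set x : V | forall i, ((fun t : measurableTypeR R =>
      t + a 0 i) @^-1` B i) (x 0 i)]); last first.
    rewrite /pushforward; congr (mu _).
    by apply/seteqP; split => x /= H i; have := H i; rewrite mxE.
  rewrite [RHS]E2; first by apply: eq_bigr => i _; rewrite lebesgue_measure_shift.
  move=> i; rewrite -[X in measurable X]setTI.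
  have : measurable_fun [set: measurableTypeR R] (fun x : measurableTypeR R =>
      x + a 0 i : measurableTypeR R) by apply: measurable_funD.
  by apply.
- move=> k; rewrite [X in (X < _)%E](@lebesgue_rV_box R n (fun=> `[- k%:R, k%:R]%classic))//.
  rewrite (eq_bigr (fun=> (k%:R *+ 2)%:E)); last first.
    move=> i _; rewrite lebesgue_measure_itv/= lte_fin.
    case: ltP => H; first by rewrite -EFinB opprK mulr2n.
    congr EFin; have : (0 : R) <= k%:R by []. 
    lra.
  by rewrite prodEFin ltry.
Qed.

Lemma ge0_integral_shift a (h : V -> \bar R) : measurable_fun [set: V] h ->
  (forall x, (0 <= h x)%E) -> (\int[mu]_x h ((x : V) + a)%R = \int[mu]_x h x)%E.
Proof.
move=> mh h0.
transitivity (\int[pushforward mu (fun x : V => x + a)%R]_x h x)%E.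
  by rewrite (ge0_integral_pushforward (measurable_shift a)) ?preimage_setT.
apply: eq_measure_integral; first exact: measurable_shift.
by move=> ? A mA _; exact: lebesgue_rV_shift.
Qed.

(** A Lindelof property. There are countably many cubes with rational centre and half-side
1/(k+1), and a point with some ball in P is in such a cube with P, since P passes to subsets.
With P the property of being contained in U, it shows that open sets are Borel; with P the
property that a function vanishes almost everywhere on the set, it makes the local vanishing of
the function global. *)
Lemma countable_ball_cover (P : set (set V)) : P set0 ->
  (forall A B, A `<=` B -> P B -> P A) ->
  exists F : nat -> set V, (forall m, measurable (F m) /\ P (F m)) /\
    forall x (d : R), 0 < d -> P (ball x d) -> exists m, F m x.
Proof.
move=> P0 PS.
pose B (q : 'rV[rat]_n) (k : nat) : set V :=
    [set y | forall i, `](ratr (q 0 i) - k.+1%:R^-1), (ratr (q 0 i) + k.+1%:R^-1)[%classic (y 0 i)].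
exists (fun m => if unpickle m is Some (q, k) then if `[< P (B q k) >] then B q k else set0 else set0).
split.
  move=> m; case: unpickle => [[q k]|] => //.
  case: asboolP => // H; split => //.
  by apply: (@measurable_box (fun i => `](ratr (q 0 i) - k.+1%:R^-1), (ratr (q 0 i) + k.+1%:R^-1)[%classic)).
move=> x d d0 Px.
have [k kd] : exists k, k.+1%:R^-1 < d / 2.
  have d20 : 0 < d / 2 by rewrite divr_gt0.
  exists (Num.trunc (d / 2)^-1); rewrite invf_plt ?posrE//.
  exact: truncnS_gt.
have Hq i : exists q : rat, ratr q \in `](x 0 i - k.+1%:R^-1), (x 0 i + k.+1%:R^-1)[.
  have [q qi] := @rat_in_itvoo R (x 0 i - k.+1%:R^-1) (x 0 i + k.+1%:R^-1) ltac:(by rewrite ltrD2l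
      gtrN// invr_gt0).
  by exists q.
pose q : 'rV[rat]_n := \row_i sval (cid (Hq i)).
have Bx : B q k x.
  move=> i; rewrite /= in_itv/= mxE; case: cid => r /=; rewrite !in_itv/= => /andP[? ?].
  by apply/andP; split; [rewrite ltrBlDr|rewrite -ltrBlDr].
have PB : P (B q k).
  apply: (PS _ _ _ Px) => y By.
  rewrite mx_norm_ball /ball_/=.
  rewrite [X in X < _]/Num.norm/= mx_normrE.
  apply: bigmax_lt => // -[i j] _ /=.
  rewrite ord1 !mxE. have := By j; have := Bx j; rewrite /= !in_itv/= => /andP[xa xb] /andP[ya yb].
  move: kd; set e := k.+1%:R^-1 => kd; rewrite -/e in xa xb ya yb.
  clearbody e; rewrite ltr_norml; lra.
exists (pickle (q, k)); rewrite pickleK; case: asboolP => //.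
Qed.

Lemma open_measurable_rV U : open U -> measurable U.
Proof.
move=> oU.
have [//||F [mF cF]] := countable_ball_cover (P := [set A | A `<=` U]).
  by move=> A B AB /= BU; exact: subset_trans BU.
rewrite (_ : U = \bigcup_m F m).
  by apply: bigcupT_measurable => m; have [] := mF m.
apply/seteqP; split => x.
  move=> Ux; have /nbhs_ballP[e /= e0 eU] := open_nbhs_nbhs (conj oU Ux).
  by have [m] := cF x e e0 eU; exists m.
by move=> [m _]; have [_] := mF m; apply.
Qed.

Lemma closed_measurable_rV U : closed U -> measurable U.
Proof. by move=> cU; rewrite -(setCK U); apply: measurableC; apply: open_measurable_rV; rewrite openC. Qed.

(** The points at distance at least 1/(k+1) from the complement of D: short translations do not
leave D from there, and these sets exhaust an open D. *)
Definition inner D (k : nat) : set V := ~` [set x | exists2 y, ~ D y & `|y - x| < k.+1%:R^-1].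

Lemma measurable_inner D k : measurable (inner D k).
Proof.
apply: measurableC; apply: open_measurable_rV.
rewrite (_ : mkset _ = \bigcup_(y in ~` D) ball y k.+1%:R^-1).
  by apply: bigcup_open => y _; exact: ball_open.
apply/seteqP; split => x /=; first by move=> [y Dy yx]; exists y => //; rewrite mx_norm_ball.
by move=> [y Dy]; rewrite mx_norm_ball => yx; exists y.
Qed.

Lemma innerE D : open D -> D = \bigcup_k inner D k.
Proof.
move=> oD; apply/seteqP; split => x.
  move=> Dx; have /nbhs_ballP[d /= d0 dU] := open_nbhs_nbhs (conj oD Dx).
  exists (Num.trunc d^-1) => //= -[y Dy yx]; apply: Dy; apply: dU.
  rewrite mx_norm_ball /ball_/= distrC (lt_trans yx)//.
  by rewrite invf_plt ?posrE// truncnS_gt.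
move=> [k _ Fx]; apply: contrapT => Dx; apply: Fx; exists x => //.
by rewrite subrr normr0.
Qed.

(** The open sets are a second generating class stable under intersection. It suits statements
that are proved on open sets and extended by a Dynkin argument. *)
Lemma measurable_open_gen : measurable = <<s (open : set (set V)) >> :> set (set V).
Proof.
apply/seteqP; split; last first.
  apply: smallest_sub; first exact: sigma_algebra_measurable.
  by move=> U; exact: open_measurable_rV.
apply: smallest_sub; first exact: smallest_sigma_algebra.
rewrite -bigcup_seq; apply: bigcup_sub => i _.
have H : sigma_algebra setT [set B : set R | <<s (open : set (set V)) >> (coord_rV i @^-1` B)].
  have [H1 H2 H3] := smallest_sigma_algebra setT (open : set (set V)).
  split => /=.
  - by rewrite preimage_set0.
  - by move=> A /H2; rewrite !setTD preimage_setC.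
  - by move=> F HF; rewrite preimage_bigcup; exact: H3.
move=> _ [B mB <-]; rewrite setTI.
suff : measurable `<=` [set B : set (measurableTypeR R) | <<s (open : set (set V)) >> (coord_rV i @^-1` B)].
  by apply.
rewrite [X in X `<=` _](RGenOpens.measurableE R).
apply: smallest_sub => // _ [c [d ->]].
apply: sub_sigma_algebra.
apply: open_comp; last exact: interval_open.
by move=> x _; exact: coord_continuous.
Qed.

Lemma continuous_on_measurable D f : open D ->
  (forall x, D x -> {for x, continuous f}) -> measurable_fun D f.
Proof.
move=> oD cf; apply: (measurability _ (RGenOpens.measurableE R)).
move=> _ [_ [c [d ->]] <-]; apply: open_measurable_rV.
rewrite openE => x [Dx fx]; rewrite /interior.
near=> y; split; near: y; first exact: open_nbhs_nbhs.
apply: (cf x Dx); apply: open_nbhs_nbhs; split => //; exact: interval_open.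
Unshelve. all: by end_near. Qed.

Lemma continuous_measurable_rV f : continuous f -> measurable_fun setT f.
Proof. by move=> cf; apply: continuous_on_measurable; [exact: openT|move=> x _; exact: cf]. Qed.

Lemma bounded_finite_measure D : measurable D -> bounded_set D -> (mu D < +oo)%E.
Proof.
move=> mD [M [_ bD]].
pose k := `|M| + 1.
have kM : M < k by rewrite /k ltr_pwDr// ler_norm.
have DB : D `<=` [set x | forall i, `[- k, k]%classic (x 0 i)].
  move=> x Dx i; rewrite /= in_itv/= -ler_norml.
  apply: le_trans (bD k kM x Dx).
  rewrite [leRHS]/Num.norm/= mx_normrE.
  exact: (le_bigmax _ (fun j : 'I_1 * 'I_n => `|x j.1 j.2|) (0, i)).
have mB : measurable [set x : V | forall i, `[- k, k]%classic (x 0 i)] by apply: (@measurable_box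
    (fun=> `[- k, k]%classic)).
apply: le_lt_trans (le_measure mu _ _ DB) _; rewrite ?inE//.
rewrite [X in (X < _)%E](@lebesgue_rV_box R n (fun=> `[- k, k]%classic))//.
rewrite (eq_bigr (fun=> (k *+ 2)%:E)); last first.
  move=> i _; rewrite lebesgue_measure_itv/= lte_fin.
  have k0 : 0 < k by rewrite /k ltr_pwDr.
  by rewrite gtrN// -EFinB opprK mulr2n.
by rewrite prodEFin ltry.
Qed.

Lemma measurable_add_rV : measurable_fun setT (fun p : V * V => p.1 + p.2 : V).
Proof.
apply: measurable_fun_rV => i.
rewrite (_ : _ \o _ = (fun p => coord_rV i p.1 + coord_rV i p.2)); last first.
  by apply/funext => x; rewrite /coord_rV/= !mxE.
by apply: measurable_funD; apply: (measurableT_comp (measurable_coord_rV i)).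
Qed.

End measure_rV.

(** * Continuity of translations in L^2 *)
Section translation_L2.
Context {R : realType} {n : nat}.
Local Notation V := 'rV[R]_n.
Local Notation mu := (lebesgue_rV R n).
Implicit Types (x y a z : V) (U D : set V) (f g : V -> R).

(** The squared L^2 norm, kept in the extended reals so that it needs no integrability. *)
Definition l2sq f : \bar R := (\int[mu]_x ((f x) ^+ 2)%:E)%E.

Lemma l2sq_ge0 f : (0 <= l2sq f)%E.
Proof. by apply: integral_ge0 => x _; rewrite lee_fin sqr_ge0. Qed.

Lemma measurable_sqrE D f : measurable_fun D f -> measurable_fun D (fun x => ((f x) ^+ 2)%:E).
Proof. by move=> mf; apply/measurable_EFinP; exact: measurable_funX. Qed.

Lemma l2sqN f : l2sq (fun x => - f x) = l2sq f.
Proof. by apply: eq_integral => x _; rewrite sqrrN. Qed.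

(** 2 f g <= f^2 + g^2. The constant 2 is harmless and replaces the triangle inequality. *)
Lemma l2sqD f g : measurable_fun [set: V] f -> measurable_fun [set: V] g ->
  (l2sq (fun x => f x + g x)%R <= 2%:E * l2sq f + 2%:E * l2sq g)%E.
Proof.
move=> mf mg.
rewrite -!ge0_integralZl//; last 4 first.
- exact: measurable_sqrE.
- by move=> x _; rewrite lee_fin sqr_ge0.
- exact: measurable_sqrE.
- by move=> x _; rewrite lee_fin sqr_ge0.
rewrite -ge0_integralD//; last 4 first.
- by move=> x _; rewrite -EFinM lee_fin mulr_ge0// sqr_ge0.
- by apply: measurable_funeM; exact: measurable_sqrE.
- by move=> x _; rewrite -EFinM lee_fin mulr_ge0// sqr_ge0.
- by apply: measurable_funeM; exact: measurable_sqrE.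
apply: ge0_le_integral => //.
- by move=> x _; rewrite lee_fin sqr_ge0.
- by apply: measurable_sqrE; exact: measurable_funD.
- by apply: emeasurable_funD; apply: measurable_funeM; exact: measurable_sqrE.
move=> x _; rewrite -!EFinM -EFinD lee_fin.
have := sqr_ge0 (f x - g x); rewrite !expr2; lra.
Qed.

Lemma l2sqB f g : measurable_fun [set: V] f -> measurable_fun [set: V] g ->
  (l2sq (fun x => f x - g x)%R <= 2%:E * l2sq f + 2%:E * l2sq g)%E.
Proof.
move=> mf mg; rewrite -(l2sqN g); apply: l2sqD => //.
by apply: measurableT_comp.
Qed.

Lemma measurable_fun_shift a f : measurable_fun [set: V] f ->
  measurable_fun [set: V] (fun x => f (x + a)).
Proof. by move=> mf; apply: (measurableT_comp mf); exact: measurable_shift. Qed.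

Lemma l2sq_shift a f : measurable_fun [set: V] f ->
  l2sq (fun x => f (x + a)) = l2sq f.
Proof.
move=> mf; rewrite /l2sq (ge0_integral_shift a (h := fun x => ((f x) ^+ 2)%:E))//.
  exact: measurable_sqrE.
by move=> x; rewrite lee_fin sqr_ge0.
Qed.

Definition translation_cont f := forall e : R, 0 < e -> exists2 d : R, 0 < d &
  forall z, `|z| < d -> (l2sq (fun x => f (x + z) - f x)%R <= e%:E)%E.

Lemma translation_contB f g : measurable_fun [set: V] f -> measurable_fun [set: V] g ->
  translation_cont f -> translation_cont g -> translation_cont (fun x => f x - g x).
Proof.
move=> mf mg tf tg e e0.
have e40 : 0 < e / 4 by rewrite divr_gt0.
have [d d0 Hd] := tf _ e40; have [d' d'0 Hd'] := tg _ e40.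
exists (Num.min d d'); first by rewrite lt_min d0.
move=> z; rewrite lt_min => /andP[zd zd'].
rewrite (_ : (fun x => _) = (fun x => (f (x + z) - f x) - (g (x + z) - g x))); last first.
  by apply/funext => x; ring.
apply: le_trans (l2sqB _ _) _.
- by apply: measurable_funB => //; exact: measurable_fun_shift.
- by apply: measurable_funB => //; exact: measurable_fun_shift.
apply: (@le_trans _ _ (2%:E * (e / 4)%:E + 2%:E * (e / 4)%:E)%E).
  by apply: leeD; apply: lee_pmul => //; rewrite ?l2sq_ge0 ?Hd ?Hd'.
by rewrite -!EFinM -EFinD lee_fin; lra.
Qed.

Lemma translation_contZ (c : R) f : measurable_fun [set: V] f ->
  translation_cont f -> translation_cont (fun x => c * f x).
Proof.
move=> mf tf e e0.
have c0 : 0 < c ^+ 2 + 1 by rewrite ltr_wpDl// sqr_ge0.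
have e40 : 0 < e / (c ^+ 2 + 1) by rewrite divr_gt0.
have [d d0 Hd] := tf _ e40; exists d => // z zd.
rewrite (_ : l2sq _ = (c ^+ 2)%:E * l2sq (fun x => f (x + z) - f x)%R)%E; last first.
  rewrite -ge0_integralZl//.
  - by apply: eq_integral => x _; rewrite -EFinM; congr EFin; ring.
  - by apply: measurable_sqrE; apply: measurable_funB => //; exact: measurable_fun_shift.
  - by move=> x _; rewrite lee_fin sqr_ge0.
  - by rewrite lee_fin sqr_ge0.
apply: (@le_trans _ _ ((c ^+ 2)%:E * (e / (c ^+ 2 + 1))%:E)%E).
  by apply: lee_pmul => //; rewrite ?lee_fin ?sqr_ge0 ?l2sq_ge0 ?Hd.
by rewrite -EFinM lee_fin mulrA ler_pdivrMr// mulrC ler_wpM2l// ?ltW// ltrDl.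
Qed.

Lemma translation_cont_cst (c : R) : translation_cont (fun=> c).
Proof.
move=> e e0; exists 1 => // z _; rewrite /l2sq integral0_eq ?lee_fin ?ltW// => x _.
by rewrite subrr expr0n.
Qed.

Lemma translation_cont0 : translation_cont (fun=> 0).
Proof. exact: translation_cont_cst. Qed.

Lemma translation_cont_sum (I : Type) (s : seq I) (F : I -> V -> R) :
  (forall i, measurable_fun [set: V] (F i)) -> (forall i, translation_cont (F i)) ->
  translation_cont (fun x => \sum_(i <- s) F i x).
Proof.
move=> mF tF.
have H : forall s, measurable_fun [set: V] (fun x => \sum_(i <- s) F i x).
  by move=> r; exact: measurable_sum.
elim: s => [|i s IH].
  rewrite (_ : (fun x => _) = (fun=> 0)); first exact: translation_cont0.
  by apply/funext => x; rewrite big_nil.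
rewrite (_ : (fun x => _) = (fun x => F i x - (0 - \sum_(j <- s) F j x))); last first.
  by apply/funext => x; rewrite big_cons sub0r opprK.
apply: translation_contB => //; first by apply: measurable_funB.
by apply: translation_contB => //; exact: translation_cont0.
Qed.

Lemma translation_cont_lim f : measurable_fun [set: V] f ->
  (forall e : R, 0 < e -> exists g, [/\ measurable_fun [set: V] g, translation_cont g &
     (l2sq (fun x => f x - g x)%R <= e%:E)%E]) -> translation_cont f.
Proof.
move=> mf H e e0.
have e1 : 0 < e / 8 by rewrite divr_gt0.
have e2 : 0 < e / 16 by rewrite divr_gt0.
have [g [mg tg fg]] := H _ e2.
have [d d0 Hd] := tg _ e1; exists d => // z zd.
rewrite (_ : (fun x => _) = (fun x => (g (x + z) - g x) + ((f (x + z) - g (x + z)) - (f x - g x)))); last first.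
  by apply/funext => x; ring.
have m1 : measurable_fun [set: V] (fun x => f x - g x) by exact: measurable_funB.
have m2 := measurable_fun_shift z m1.
apply: le_trans (l2sqD _ _) _.
- by apply: measurable_funB => //; exact: measurable_fun_shift.
- by apply: measurable_funB.
apply: (@le_trans _ _ (2%:E * (e / 8)%:E + 2%:E * (2%:E * (e / 16)%:E + 2%:E * (e/16)%:E))%E); last first.
  by rewrite -!(EFinM, EFinD) lee_fin; lra.
apply: leeD; apply: lee_pmul => //; rewrite ?l2sq_ge0 ?Hd//.
apply: le_trans (l2sqB _ _) _ => //.
rewrite (l2sq_shift z m1).
by apply: leeD; apply: lee_pmul => //; rewrite ?l2sq_ge0.
Qed.

Lemma l2sq_indic (A : set V) : measurable A -> l2sq (\1_A : V -> R) = mu A.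
Proof.
move=> mA; rewrite /l2sq -(setIT A) -integral_indic// setIT.
apply: eq_integral => x _; rewrite indicE; case: (x \in A); by rewrite ?expr1n// expr0n.
Qed.

(** A translation by less than 1/(k+1) keeps [inner D k] inside D, and [inner D k] fills D up to
small measure. This controls the part of D that leaves D; the part that enters has the same
measure by translation invariance. *)
Lemma translation_cont_open D : open D -> (mu D < +oo)%E -> translation_cont (\1_D : V -> R).
Proof.
move=> oD Doo e e0.
have mD : measurable D by exact: open_measurable_rV.
pose F := inner D.
have mF k : measurable (F k) by exact: measurable_inner.
have FD : D = \bigcup_k F k by exact: innerE.
have ndF : nondecreasing_seq F.
  move=> k l kl; apply/subsetPset => x Fx [y Dy yx]; apply: Fx; exists y => //.
  by rewrite (lt_le_trans yx)// lef_pV2 ?posrE// ler_nat.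
have mUF : measurable (\bigcup_k F k) by rewrite -FD.
have cF := nondecreasing_cvg_mu (mu := mu) mF mUF ndF.
rewrite -FD in cF.
have Dfin : mu D \is a fin_num by rewrite ge0_fin_numE.
have [k Hk] : exists k, (mu D - (e / 2)%:E < mu (F k))%E.
  have H : (mu D - (e / 2)%:E < mu D)%E.
    by rewrite lteBlDr// lteDl// lte_fin divr_gt0.
  by have [N _ HN] := cF _ (open_ereal_gt' H); exists N; apply: HN => /=.
exists k.+1%:R^-1; first by rewrite invr_gt0.
move=> z zk.
have mDz : measurable ((fun x : V => x + z) @^-1` D).
  by rewrite -[X in measurable X]setTI; exact: measurable_shift.
pose A1 := D `\` (fun x : V => x + z) @^-1` D.
pose A2 := (fun x : V => x + z) @^-1` D `\` D.
have mA1 : measurable A1 by apply: measurableD.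
have mA2 : measurable A2 by apply: measurableD.
have A1F : A1 `<=` D `\` F k.
  move=> x [Dx Dxz]; split => // Fx; apply: Fx; exists (x + z) => //.
  by rewrite addrC addKr.
have A1e : (mu A1 <= (e / 2)%:E)%E.
  apply: le_trans (le_measure mu _ _ A1F) _; rewrite ?inE//; first exact: measurableD.
  rewrite measureD// setIidr; last by rewrite FD => x Fx; exists k.
  by rewrite leeBlDl// -?leeBlDr ?ltW//; rewrite ge0_fin_numE// (le_lt_trans _ Doo)// le_measure//
      ?inE// FD => x Fx; exists k.
have E1 : (mu A1 = mu A2)%E.
  have I1 : mu (D `&` (fun x : V => x + z) @^-1` D) \is a fin_num.
    by rewrite ge0_fin_numE// (le_lt_trans _ Doo)// le_measure// ?inE//; exact: measurableI.
  set Dz' := D `&` (fun x : V => x + z) @^-1` D in I1 *.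
  have -> : mu A1 = (mu D - mu Dz')%E by rewrite /A1 measureD.
  have Dz : mu ((fun x : V => x + z) @^-1` D) = mu D by exact: lebesgue_rV_shift.
  have -> : mu A2 = (mu D - mu Dz')%E.
    rewrite /A2 measureD//; last by rewrite [X in (X < _)%E]Dz.
    by rewrite [X in (X - _)%E]Dz setIC.
  by [].
have mi (B : set V) : measurable B -> measurable_fun [set: V] (\1_B : V -> R).
  by move=> mB; exact: measurable_indic.
rewrite (_ : l2sq _ = l2sq (fun x => (\1_A1 x : R) - \1_A2 x)); last first.
  rewrite -l2sqN; congr l2sq; apply/funext => x; rewrite !indicE opprB.
  have -> : (x \in A1) = (x \in D) && ~~ (x + z \in D).
    by apply/idP/idP; rewrite !inE /A1 /=; [move=> [? ?]; apply/andP; split;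
        [rewrite inE|rewrite notin_setE]|move=> /andP[]; rewrite inE notin_setE].
  have -> : (x \in A2) = (x + z \in D) && ~~ (x \in D).
    by apply/idP/idP; rewrite !inE /A2 /=; [move=> [? ?]; apply/andP; split;
        [rewrite inE|rewrite notin_setE]|move=> /andP[]; rewrite inE notin_setE].
  by case: (x \in D); case: (x + z \in D); rewrite /= ?subrr ?subr0.
rewrite (_ : l2sq _ = mu A1 + mu A2)%E; last first.
  rewrite -!l2sq_indic// /l2sq -ge0_integralD//;
    do ?[by move=> x _; rewrite lee_fin sqr_ge0 | by apply: measurable_sqrE; exact: mi].
  apply: eq_integral => x _; rewrite -EFinD; congr EFin; rewrite !indicE.
  case: (boolP (x \in A1)); case: (boolP (x \in A2)); rewrite ?inE /=;
      rewrite ?(expr0n, expr1n, subr0, sub0r, sqrrN, addr0, add0r)//.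
  by rewrite /A1 /A2 => -[_ H] [H' _].
rewrite -E1; apply: le_trans (leeD A1e A1e) _.
by rewrite -EFinD lee_fin; lra.
Qed.

(** The sets A with this property form a lambda-system that contains the open sets. *)
Lemma translation_cont_indic D (A : set V) : open D -> (mu D < +oo)%E -> measurable A ->
  translation_cont (\1_(A `&` D) : V -> R).
Proof.
move=> oD Doo mA.
have mD : measurable D by exact: open_measurable_rV.
have mi (B : set V) : measurable B -> measurable_fun [set: V] (\1_B : V -> R).
  by move=> mB; exact: measurable_indic.
pose H := [set A : set V | measurable A /\ translation_cont (\1_(A `&` D) : V -> R)].
have oI : setI_closed (open : set (set V)) by move=> B C; exact: openI.
have lH : lambda_system setT H.
  split.
  - by [].
  - by split => //; rewrite setTI; exact: translation_cont_open.
  - move=> B C CB [mB tB] [mC tC]; split; first exact: measurableD.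
    rewrite (_ : \1_ _ = (fun x => \1_(B `&` D) x - \1_(C `&` D) x)); last first.
      apply/funext => x; rewrite !indicE [x \in (B `\` C) `&` D]in_setI in_setD !in_setI.
      have [xC|] := boolP (x \in C); last by rewrite /= subr0 andbT.
      have -> : x \in B by move: xC; rewrite !inE; exact: CB.
      by rewrite andbF subrr.
    by apply: translation_contB => //; apply: mi; exact: measurableI.
  - move=> F ndF HF; have mF k : measurable (F k) by have [] := HF k.
    have mUF : measurable (\bigcup_k F k) by exact: bigcupT_measurable.
    split => //.
    apply: translation_cont_lim; first by apply: mi; exact: measurableI.
    move=> e e0.
    have mFD k : measurable (F k `&` D) by exact: measurableI.
    have mUFD : measurable (\bigcup_k (F k `&` D)) by exact: bigcupT_measurable.
    have ndFD : nondecreasing_seq (fun k => F k `&` D).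
      by move=> k l kl; apply/subsetPset; apply: setSI; exact/subsetPset/ndF.
    have := nondecreasing_cvg_mu (mu := mu) mFD mUFD ndFD.
    rewrite -setI_bigcupl => cF.
    set W := \bigcup_k F k `&` D in cF *.
    have mW : measurable W by exact: measurableI.
    have Wfin : (mu W < +oo)%E.
      by rewrite (le_lt_trans _ Doo)// le_measure// ?inE//; exact: subIsetr.
    have [k Hk] : exists k, (mu W - e%:E < mu (F k `&` D))%E.
      have HH : (mu W - e%:E < mu W)%E.
        by rewrite lteBlDr// lteDl// ?ge0_fin_numE// lte_fin.
      by have [N _ HN] := cF _ (open_ereal_gt' HH); exists N; apply: HN => /=.
    exists (\1_(F k `&` D)); split; [exact: mi|by have [] := HF k|].
    have sW : F k `&` D `<=` W by apply: setSI; exact: bigcup_sup.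
    rewrite (_ : (fun x => _) = \1_(W `\` (F k `&` D))); last first.
      apply/funext => x; rewrite !indicE in_setD.
      have [xC|] := boolP (x \in F k `&` D); last by rewrite /= subr0 andbT.
      have -> : x \in W by move: xC; rewrite !inE; exact: sW.
      by rewrite andbF subrr.
    rewrite l2sq_indic; last exact: measurableD.
    rewrite measureD// setIidr//.
    by rewrite leeBlDl// -?leeBlDr ?ltW//; rewrite ge0_fin_numE// (le_lt_trans _ Wfin)// le_measure// ?inE//.
have GH : (open : set (set V)) `<=` H.
  move=> B oB; split; first exact: open_measurable_rV.
  apply: translation_cont_open; first exact: openI.
  have mB : measurable (B `&` D) by apply: measurableI => //; exact: open_measurable_rV.
  rewrite (le_lt_trans _ Doo)// le_measure// ?inE//; exact: subIsetr.
have := lambda_system_subset oI lH GH (fun _ _ => @subsetT _ _).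
rewrite -measurable_open_gen => /(_ A mA).
by case.
Qed.

Lemma translation_cont_nnsfun D (g : {nnsfun V >-> R}) : open D -> (mu D < +oo)%E ->
  translation_cont (fun x => g x * \1_D x).
Proof.
move=> oD Doo.
have mD : measurable D by exact: open_measurable_rV.
rewrite (_ : (fun x => _) = (fun x => \sum_(y <- finmap.enum_fset (fset_set (range g))) (y * \1_(g
    @^-1` [set y] `&` D) x))); last first.
  apply/funext => x; rewrite fimfunE fsbig_finite//= mulr_suml; apply: eq_bigr => i _.
  by rewrite -mulrA !indicE in_setI -natrM mulnb.
have mgD i : measurable (g @^-1` [set i] `&` D).
  by apply: measurableI => //; rewrite -[X in measurable X]setTI; exact: measurable_funPTI.
apply: translation_cont_sum => i.
  by apply: measurable_funM => //; exact: measurable_indic.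
apply: translation_contZ; first exact: measurable_indic.
exact: translation_cont_indic.
Qed.

(** The simple functions increasing to f converge to it in L^2, by dominated convergence. *)
Lemma translation_cont_ge0 D f : open D -> (mu D < +oo)%E -> measurable_fun [set: V] f ->
  (forall x, 0 <= f x) -> (forall x, ~ D x -> f x = 0) -> (l2sq f < +oo)%E ->
  translation_cont f.
Proof.
move=> oD Doo mf f0 fD foo.
have mD : measurable D by exact: open_measurable_rV.
have mEf : measurable_fun [set: V] (EFin \o f) by exact/measurable_EFinP.
have f0E x : [set: V] x -> (0 <= (EFin \o f) x)%E by rewrite lee_fin.
pose g k := nnsfun_approx measurableT mEf k.
have gf k x : g k x <= f x.
  by have := le_approx k f0E (I : setT x); rewrite -(nnsfun_approxE measurableT mEf) lee_fin.
have gcvg x : g k x @[k --> \oo] --> f x.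
  have := cvg_nnsfun_approx measurableT mEf f0E (I : setT x).
  by move/fine_cvg.
have mg k : measurable_fun [set: V] (fun x => g k x * \1_D x).
  by apply: measurable_funM => //; exact: measurable_indic.
have gE k x : f x - g k x * \1_D x = f x - g k x.
  rewrite indicE; case: (boolP (x \in D)) => [_|]; first by rewrite mulr1.
  rewrite notin_setE => /fD fx0; rewrite mulr0 fx0.
  by congr (_ - _); apply/eqP; rewrite eq_le; apply/andP; split; [|rewrite -fx0].
apply: translation_cont_lim => // e e0.
pose G k := l2sq (fun x => f x - g k x * \1_D x).
have H1 : {ae mu, forall x, [set: V] x ->
    (((f x - g k x * \1_D x) ^+ 2)%:E @[k --> \oo] --> (cst 0%E : V -> \bar R) x)}.
  apply: aeW => x _.
    rewrite (_ : (fun k => _) = EFin \o (fun k => (f x - g k x) ^+ 2)); last first.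
      by apply/funext => k /=; rewrite gE.
    apply: cvg_EFin; first exact: nearW.
    have : (f x - g k x) ^+ 2 @[k --> \oo] --> (f x - f x) ^+ 2.
      rewrite expr2; under eq_fun do rewrite expr2.
      by apply: cvgM; apply: cvgB => //; exact: cvg_cst.
    by rewrite subrr expr0n.
have H2 : mu.-integrable [set: V] (fun x => ((f x) ^+ 2)%:E).
  apply/integrableP; split; first exact: measurable_sqrE.
    by under eq_integral do rewrite gee0_abs ?lee_fin ?sqr_ge0//.
have H3 : {ae mu, forall x k, [set: V] x -> (`|((f x - g k x * \1_D x) ^+ 2)%:E| <= ((f x) ^+ 2)%:E)%E}.
  apply: aeW => x k _; rewrite gee0_abs ?lee_fin ?sqr_ge0// gE.
    by rewrite ler_sqr ?nnegrE ?subr_ge0// gerBl.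
have H : G @ \oo --> 0%E.
  have [_ _] := dominated_convergence measurableT (fun k =>
      measurable_sqrE (measurable_funB mf (mg k))) (measurable_cst 0%E) H1 H2 H3.
  by rewrite integral0.
have [k Hk] : exists k, (G k < e%:E)%E.
  have He : (0 < e%:E)%E by rewrite lte_fin.
  by have [N _ HN] := H _ (open_ereal_lt' He); exists N; apply: HN => /=.
exists (fun x => g k x * \1_D x); split => //; first exact: translation_cont_nnsfun.
exact: ltW.
Qed.

Lemma translation_cont_L2 D f : open D -> (mu D < +oo)%E -> measurable_fun [set: V] f ->
  (forall x, ~ D x -> f x = 0) -> (l2sq f < +oo)%E -> translation_cont f.
Proof.
move=> oD Doo mf fD foo.
rewrite (_ : f = (fun x => f^\+ x - f^\- x)); last first.
  by apply/funext => x; rewrite -[in LHS](funrposBneg f).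
have mp : measurable_fun [set: V] f^\+ by exact: measurable_funrpos.
have mn : measurable_fun [set: V] f^\- by exact: measurable_funrneg.
have le (h : V -> R) : measurable_fun [set: V] h -> (forall x, `|h x| <= `|f x|) -> (l2sq h < +oo)%E.
  move=> mh hf; apply: le_lt_trans foo; apply: ge0_le_integral => //.
  - by move=> x _; rewrite lee_fin sqr_ge0.
  - exact: measurable_sqrE.
  - exact: measurable_sqrE.
  - move=> x _; rewrite lee_fin -(real_normK (num_real (h x))) -(real_normK (num_real (f x))).
    by rewrite ler_sqr ?nnegrE.
apply: translation_contB => //; apply: (@translation_cont_ge0 D) => //.
- by move=> x /fD fx; rewrite /funrpos fx maxxx.
- apply: le => // x; rewrite /funrpos ger0_norm ?le_max ?lexx ?orbT//.
  by rewrite ge_max ler_norm normr_ge0.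
- by move=> x /fD fx; rewrite /funrneg fx oppr0 maxxx.
- apply: le => // x; rewrite /funrneg ger0_norm ?le_max ?lexx ?orbT//.
  by rewrite ge_max normr_ge0 -normrN ler_norm.
Qed.

End translation_L2.

(** * Calculus of functions of class C^k *)
Section calculus.
Context {R : realType} {n : nat}.
Local Notation V := 'rV[R]_n.
Implicit Types (x y v : V) (D : set V) (f g : V -> R) (i j : 'I_n) (k : nat).
Local Notation "''e_' i" := (delta_mx 0 i : V) (at level 8, i at level 2).

(** Directional derivatives are derivatives along lines; the chain rule and the mean value
theorem of one variable apply through this. *)
Lemma is_derive_line f x v (t d : R) :
  is_derive (x + t *: v) v f d <-> is_derive t 1 (fun s : R => f (x + s *: v)) d.
Proof.
have E : (fun h : R => h^-1 *: ((f \o shift (x + t *: v)) (h *: v) - f (x + t *: v))) =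
  (fun h : R => h^-1 *: (((fun s : R => f (x + s *: v)) \o shift t) (h *: (1 : R)) - (fun s : R =>
      f (x + s *: v)) t)).
  apply/funext => h /=; congr (_ *: (f _ - _)).
  by rewrite [h *: 1]mulr1 scalerDl addrCA.
have Ed : derivable f (x + t *: v) v = derivable (fun s : R => f (x + s *: v)) t 1.
  by rewrite /derivable E.
have Ev : 'D_v f (x + t *: v) = 'D_1 (fun s : R => f (x + s *: v)) t.
  by rewrite /derive E.
split=> -[dF vF].
  by apply: DeriveDef; [rewrite -Ed|rewrite -Ev].
by apply: DeriveDef; [rewrite Ed|rewrite Ev].
Qed.

Lemma derivable_line f x v (t : R) : derivable f (x + t *: v) v ->
  is_derive t 1 (fun s : R => f (x + s *: v)) ('D_v f (x + t *: v)).
Proof. by move=> df; apply/is_derive_line; exact/derivableP. Qed.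

Lemma is_derive_chain (H : R -> R) f x v (d d' : R) : is_derive (f x) 1 H d' ->
  is_derive x v f d -> is_derive x v (fun y => H (f y)) (d' * d).
Proof.
move=> dH df.
have x0 : x = x + 0 *: v by rewrite scale0r addr0.
rewrite x0; apply/is_derive_line.
have df0 : is_derive (0 : R) 1 (fun s : R => f (x + s *: v)) d by apply/is_derive_line; rewrite -x0.
apply: is_derive1_comp => //=.
by rewrite -x0.
Qed.

Lemma MVT_line f x v (h : R) : (forall y, derivable f y v) ->
  exists2 c : R, `|c| <= `|h| & f (x + h *: v) - f x = h * 'D_v f (x + c *: v).
Proof.
move=> df.
have D1 (t : R) : is_derive t 1 (fun s : R => f (x + s *: v)) ('D_v f (x + t *: v)).
  exact: derivable_line.
have C1 a b : {within `[a, b], continuous (fun s : R => f (x + s *: v))}.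
  apply: derivable_within_continuous => t _; exact: ex_derive.
have [h0|h0] := leP 0 h.
  have [c] := MVT_segment h0 (fun t _ => D1 t) (C1 0 h).
  rewrite in_itv/= => /andP[c0 ch]; rewrite scale0r addr0 subr0 mulrC => ->.
  by exists c => //; rewrite !ger0_norm.
have [c] := MVT_segment (ltW h0) (fun t _ => D1 t) (C1 h 0).
rewrite in_itv/= => /andP[c0 ch]; rewrite scale0r addr0 sub0r => E.
exists c; first by rewrite !ler0_norm ?(ltW h0)// lerN2.
by rewrite -opprB E; ring.
Qed.

Lemma is_pderivM f g x v df dg : is_derive x v f df -> is_derive x v g dg ->
  is_derive x v (fun y => f y * g y) (f x * dg + g x * df).
Proof. by move=> ? ?; exact: is_deriveM. Qed.

Lemma is_pderivD f g x v df dg : is_derive x v f df -> is_derive x v g dg ->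
  is_derive x v (fun y => f y + g y) (df + dg).
Proof. by move=> ? ?; exact: is_deriveD. Qed.

Lemma is_pderiv_sum (I : Type) (s : seq I) (F : I -> V -> R) (dF : I -> R) x v :
  (forall a, is_derive x v (F a) (dF a)) ->
  is_derive x v (fun y => \sum_(a <- s) F a y) (\sum_(a <- s) dF a).
Proof.
move=> H; elim: s => [|a s IH].
  rewrite big_nil (_ : (fun y => _) = cst 0); first exact: is_derive_cst.
  by apply/funext => y; rewrite big_nil.
rewrite big_cons (_ : (fun y => _) = (fun y => F a y + \sum_(b <- s) F b y)).
  exact: is_pderivD.
by apply/funext => y; rewrite big_cons.
Qed.

Lemma derivableMf f g x v : derivable f x v -> derivable g x v ->
  derivable (fun y => f y * g y) x v.
Proof. by move=> ? ?; exact: derivableM. Qed.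

Lemma derivableDf f g x v : derivable f x v -> derivable g x v ->
  derivable (fun y => f y + g y) x v.
Proof. by move=> ? ?; exact: derivableD. Qed.

Lemma partialM i f g x : derivable f x 'e_i -> derivable g x 'e_i ->
  partial i (fun y => f y * g y) x = f x * partial i g x + partial i f x * g x.
Proof.
move=> /derivableP df /derivableP dg; have := is_pderivM df dg.
by move=> [_ H]; rewrite /partial H [g x * _]mulrC.
Qed.

Lemma partialD i f g x : derivable f x 'e_i -> derivable g x 'e_i ->
  partial i (fun y => f y + g y) x = partial i f x + partial i g x.
Proof.
by move=> /derivableP df /derivableP dg; have [_ H] := is_pderivD df dg; rewrite /partial H.
Qed.

Lemma partial_chain (H : R -> R) i f x (d : R) : is_derive (f x) 1 H d ->
  derivable f x 'e_i ->
  derivable (fun y => H (f y)) x 'e_i /\ partial i (fun y => H (f y)) x = d * partial i f x.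
Proof.
move=> dH /derivableP df; have K := is_derive_chain dH df.
by split; [exact: ex_derive|rewrite /partial; have [_ ->] := K].
Qed.

Lemma is_derive_coord j x v : is_derive x v (fun y : V => y 0 j) (v 0 j).
Proof.
have E : (fun h : R => h^-1 *: (((fun y : V => y 0 j) \o shift x) (h *: v) - x 0 j)) @ 0^' --> (v 0 j : R).
  apply: (@cvg_trans _ ((fun=> v 0 j) @ 0^')); last exact: cvg_cst.
  apply: near_eq_cvg; near=> h => /=.
  rewrite !mxE addrK [_ *: _]mulrA mulVf ?mul1r//.
  by near: h; exact: nbhs_dnbhs_neq.
split; first by apply/cvg_ex; exists (v 0 j).
by apply/cvg_lim.
Unshelve. all: by end_near. Qed.

Lemma partial_coord i j x : derivable (fun y : V => y 0 j) x 'e_i /\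
  partial i (fun y : V => y 0 j) x = (i == j)%:R.
Proof.
have H := is_derive_coord j x 'e_i.
split; first exact: ex_derive.
by rewrite /partial; have [_ ->] := H; rewrite mxE eqxx eq_sym.
Qed.

Lemma partial_cst i (c : R) x : partial i (fun=> c) x = 0.
Proof. exact: derive_cst. Qed.

Lemma near_partial i f g x : (\forall y \near x, f y = g y) ->
  (derivable f x 'e_i -> derivable g x 'e_i) /\ partial i f x = partial i g x.
Proof.
move=> fg.
split; first exact: near_eq_derivable.
exact: near_eq_derive.
Qed.

Lemma near_open D f g x : open D -> D x -> (forall y, D y -> f y = g y) ->
  \forall y \near x, f y = g y.
Proof.
by move=> oD Dx fg; near=> y; apply: fg; near: y; exact: open_nbhs_nbhs.
Unshelve. all: by end_near. Qed.

Lemma contD f g x : {for x, continuous f} -> {for x, continuous g} ->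
  {for x, continuous (fun y => f y + g y)}.
Proof. by move=> cf cg; exact: (cvgD cf cg). Qed.

Lemma contM f g x : {for x, continuous f} -> {for x, continuous g} ->
  {for x, continuous (fun y => f y * g y)}.
Proof. by move=> cf cg; exact: (cvgM cf cg). Qed.

Lemma cont_ext f g x : (\forall y \near x, f y = g y) ->
  {for x, continuous f} -> {for x, continuous g}.
Proof.
move=> fg cf; rewrite /prop_for /continuous_at -(nbhs_singleton fg).
by apply: cvg_trans cf; exact: (@near_eq_cvg _ _ (nbhs x) _ f g fg).
Qed.

Lemma cont_shift g y : continuous g -> continuous (fun x : V => g (x - y)).
Proof.
move=> cg x; apply: (@continuous_comp _ _ _ (fun x => x - y) g); last exact: cg.
by apply: continuousB => //; exact: cst_continuous.
Qed.

(** The inductive form of the definition by multi-indices. The closure properties below are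
proved by induction on k through it. *)
Lemma Ck_onS D k f : Ck_on D k.+1 f <->
  [/\ forall x, D x -> {for x, continuous f},
      forall i x, D x -> derivable f x 'e_i &
      forall i, Ck_on D k (partial i f)].
Proof.
have prc s i : partials (rcons s i) f = partials s (partial i f).
  by rewrite /partials foldr_rcons.
split.
  move=> H; have [H1 H2] := H [::] isT; split => //; first exact: H2.
  move=> i s sk; have := H (rcons s i); rewrite size_rcons prc ltnS => /(_ sk)[H3 H4].
  by split.
move=> [cf df H] s; case: (lastP s) => [_|s' i].
  by split => // _ i x Dx; exact: df.
by rewrite size_rcons prc ltnS => sk; have [] := H i s' sk.
Qed.

Lemma Ck_on0 D f : (forall x, D x -> {for x, continuous f}) -> Ck_on D 0 f.
Proof. by move=> cf [|//]. Qed.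

Lemma Ck_onW D k l f : (k <= l)%N -> Ck_on D l f -> Ck_on D k f.
Proof.
move=> kl H s sk; have [H1 H2] := H s (leq_trans sk kl).
by split => // sk'; apply: H2; exact: leq_trans kl.
Qed.

Lemma Ck_on_cont D k f : Ck_on D k f -> forall x, D x -> {for x, continuous f}.
Proof. by move=> /(_ [::] isT)[]. Qed.

Lemma Ck_on_derivable D k f i x : Ck_on D k.+1 f -> D x -> derivable f x 'e_i.
Proof. by move=> /Ck_onS[_ H _]; exact: H. Qed.

Lemma Ck_on_partial D k f i : Ck_on D k.+1 f -> Ck_on D k (partial i f).
Proof. by move=> /Ck_onS[_ _]; exact. Qed.

Lemma Ck_on_sub D D' k f : D' `<=` D -> Ck_on D k f -> Ck_on D' k f.
Proof.
move=> sD H s sk; have [H1 H2] := H s sk; split; first by move=> x /sD; exact: H1.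
by move=> sk' i x /sD; exact: H2.
Qed.

Lemma Ck_on_ext D k f g : open D -> (forall x, D x -> f x = g x) ->
  Ck_on D k f -> Ck_on D k g.
Proof.
move=> oD; elim: k f g => [|k IH] f g fg H.
  by apply: Ck_on0 => x Dx; exact: cont_ext (near_open oD Dx fg) (Ck_on_cont H Dx).
have [cf df pf] := (Ck_onS D k f).1 H.
apply/Ck_onS; split.
- by move=> x Dx; exact: cont_ext (near_open oD Dx fg) (cf x Dx).
- move=> i x Dx; have [+ _] := near_partial i (near_open oD Dx fg).
  by apply; exact: df.
- move=> i; apply: IH (pf i) => x Dx.
  by have [] := near_partial i (near_open oD Dx fg).
Qed.

Lemma Ck_on_cst D k (c : R) : Ck_on D k (fun=> c).
Proof.
elim: k c => [|k IH] c; first by apply: Ck_on0 => x _; exact: cst_continuous.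
apply/Ck_onS; split; first by move=> x _; exact: cst_continuous.
  by move=> i x _; exact: derivable_cst.
by move=> i; rewrite (_ : partial i _ = fun=> 0)//; apply/funext => x; exact: partial_cst.
Qed.

Lemma Ck_on_coord D k j : Ck_on D k (fun y : V => y 0 j).
Proof.
have c x : {for x, continuous (fun y : V => y 0 j)} by exact: coord_continuous.
case: k => [|k]; first by apply: Ck_on0 => x _.
apply/Ck_onS; split => //; first by move=> i x _; have [] := partial_coord i j x.
move=> i; rewrite (_ : partial i _ = fun=> (i == j)%:R); first exact: Ck_on_cst.
by apply/funext => x; have [] := partial_coord i j x.
Qed.

Lemma Ck_onD D k f g : open D -> Ck_on D k f -> Ck_on D k g ->
  Ck_on D k (fun x => f x + g x).
Proof.
move=> oD; elim: k f g => [|k IH] f g Hf Hg.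
  by apply: Ck_on0 => x Dx; exact: contD (Ck_on_cont Hf Dx) (Ck_on_cont Hg Dx).
apply/Ck_onS; split.
- by move=> x Dx; exact: contD (Ck_on_cont Hf Dx) (Ck_on_cont Hg Dx).
- by move=> i x Dx; apply: derivableDf; [exact: (Ck_on_derivable Hf Dx)|exact: (Ck_on_derivable Hg Dx)].
- move=> i; apply: (@Ck_on_ext _ _ (fun x => partial i f x + partial i g x)) => //.
    by move=> x Dx; rewrite partialD//; [exact: (Ck_on_derivable Hf Dx)|exact: (Ck_on_derivable Hg Dx)].
  by apply: IH; exact: Ck_on_partial.
Qed.

Lemma Ck_onM D k f g : open D -> Ck_on D k f -> Ck_on D k g ->
  Ck_on D k (fun x => f x * g x).
Proof.
move=> oD; elim: k f g => [|k IH] f g Hf Hg.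
  by apply: Ck_on0 => x Dx; exact: contM (Ck_on_cont Hf Dx) (Ck_on_cont Hg Dx).
apply/Ck_onS; split.
- by move=> x Dx; exact: contM (Ck_on_cont Hf Dx) (Ck_on_cont Hg Dx).
- by move=> i x Dx; apply: derivableMf; [exact: (Ck_on_derivable Hf Dx)|exact: (Ck_on_derivable Hg Dx)].
- move=> i; apply: (@Ck_on_ext _ _ (fun x => f x * partial i g x + partial i f x * g x)) => //.
    by move=> x Dx; rewrite partialM//; [exact: (Ck_on_derivable Hf Dx)|exact: (Ck_on_derivable Hg Dx)].
  apply: Ck_onD => //; apply: IH.
  - exact: Ck_onW Hf.
  - exact: Ck_on_partial.
  - exact: Ck_on_partial.
  - exact: Ck_onW Hg.
Qed.

Lemma Ck_on_sum D k (I : Type) (s : seq I) (F : I -> V -> R) : open D ->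
  (forall a, Ck_on D k (F a)) -> Ck_on D k (fun x => \sum_(a <- s) F a x).
Proof.
move=> oD HF; elim: s => [|a s IH].
  by rewrite (_ : (fun x => _) = fun=> 0); [exact: Ck_on_cst|apply/funext => x; rewrite big_nil].
rewrite (_ : (fun x => _) = (fun x => F a x + \sum_(b <- s) F b x)); last first.
  by apply/funext => x; rewrite big_cons.
exact: Ck_onD.
Qed.

Lemma Ck_onZ D k (c : R) f : open D -> Ck_on D k f -> Ck_on D k (fun x => c * f x).
Proof. by move=> oD; apply: Ck_onM => //; exact: Ck_on_cst. Qed.

Lemma Ck_onB D k f g : open D -> Ck_on D k f -> Ck_on D k g ->
  Ck_on D k (fun x => f x - g x).
Proof.
move=> oD Hf Hg; rewrite (_ : (fun x => _) = (fun x => f x + (-1) * g x)); last first.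
  by apply/funext => x; rewrite mulN1r.
by apply: Ck_onD => //; exact: Ck_onZ.
Qed.

(** [H m] is the m-th derivative of [H 0]. The whole family is carried along so that the
induction on k applies to the derivative as well. *)
Lemma Ck_on_chain (H : nat -> R -> R) D k m f : open D ->
  (forall m (t : R), is_derive t 1 (H m) (H m.+1 t)) -> Ck_on D k f ->
  Ck_on D k (fun x => H m (f x)).
Proof.
move=> oD dH.
have cH m' : continuous (H m').
  move=> t; apply: differentiable_continuous; apply/derivable1_diffP; exact: ex_derive.
elim: k m f => [|k IH] m f Hf.
  apply: Ck_on0 => x Dx; apply: (@continuous_comp _ _ _ f (H m)); first exact: (Ck_on_cont Hf Dx).
  exact: cH.
apply/Ck_onS; split.
- move=> x Dx; apply: (@continuous_comp _ _ _ f (H m)); first exact: (Ck_on_cont Hf Dx).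
  exact: cH.
- move=> i x Dx; have [] := partial_chain (dH m (f x)) (Ck_on_derivable (i := i) Hf Dx); by [].
- move=> i; apply: (@Ck_on_ext _ _ (fun x => H m.+1 (f x) * partial i f x)) => //.
    by move=> x Dx; have [_ ->] := partial_chain (dH m (f x)) (Ck_on_derivable (i := i) Hf Dx).
  by apply: Ck_onM => //; [apply: IH; exact: Ck_onW Hf|exact: Ck_on_partial].
Qed.

Lemma partial_shift f y i : partial i (fun x => f (x - y)) = (fun x => partial i f (x - y)).
Proof.
apply/funext => x; rewrite /partial /derive.
set u := (X in lim (X @ _)); set w := (X in _ = lim (X @ _)).
by have -> : u = w by apply/funext => h; rewrite /u /w /= -addrA.
Qed.

Lemma Ck_on_shift k f y : Ck_on setT k f -> Ck_on setT k (fun x => f (x - y)).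
Proof.
elim: k f => [|k IH] f Hf.
  by apply: Ck_on0 => x _; apply: cont_shift => z; exact: (Ck_on_cont Hf).
have [cf df pf] := (Ck_onS _ k f).1 Hf; apply/Ck_onS; split.
- by move=> x _; apply: cont_shift => z; exact: cf.
- move=> i x _; have := df i (x - y) I; rewrite /derivable.
  set u := (X in cvg (X @ _)); set w := (X in _ -> cvg (X @ _)).
  by have -> : u = w by apply/funext => h; rewrite /u /w /= -addrA.
- by move=> i; rewrite partial_shift; exact: IH.
Qed.

Lemma Ck_on_subset k f D : Ck_on setT k f -> Ck_on D k f.
Proof. exact: Ck_on_sub. Qed.

(** One coordinate is changed at a time. *)
Lemma lipschitz_partial f (M : R) : (forall i x, derivable f x 'e_i) ->
  (forall i x, `|partial i f x| <= M) ->
  forall x y, `|f y - f x| <= M * \sum_i `|y 0 i - x 0 i|.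
Proof.
move=> df bf x y.
pose z (k : nat) : V := \row_i (if (i < k)%N then y 0 i else x 0 i).
have zS (i : 'I_n) : z i.+1 = z i + (y 0 i - x 0 i) *: 'e_i.
  apply/rowP => j; rewrite !mxE eqxx /= ltnS.
  have [ji|ij|/val_inj ->] := ltngtP j i.
  - by rewrite (_ : j == i = false) ?mulr0 ?addr0//; apply/negbTE; rewrite neq_ltn ji.
  - by rewrite (_ : j == i = false) ?mulr0 ?addr0//; apply/negbTE; rewrite neq_ltn ij orbT.
  - by rewrite eqxx mulr1 addrC subrK.
have z0 : z 0 = x by apply/rowP => j; rewrite mxE.
have zn : z n = y by apply/rowP => j; rewrite mxE ltn_ord.
have -> : f y - f x = \sum_(i < n) (f (z i.+1) - f (z i)).
  by rewrite -z0 -zn -(big_mkord xpredT (fun k : nat => f (z k.+1) - f (z k))) telescope_sumr.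
rewrite mulr_sumr; apply: le_trans (ler_norm_sum _ _ _) _.
apply: ler_sum => i _; rewrite zS.
have [c _ ->] := MVT_line (z i) (y 0 i - x 0 i) (df i).
rewrite normrM mulrC ler_wpM2r//; exact: bf.
Qed.

(** The second difference quotient of f is symmetric in the two directions, and two applications
of the mean value theorem turn it into either mixed derivative, at points close to x. *)
Lemma schwarz f i j x : Ck_on setT 2 f ->
  partial i (partial j f) x = partial j (partial i f) x.
Proof.
move=> Hf.
have df a y : derivable f y 'e_a by exact: Ck_on_derivable Hf _.
have ddf a b y : derivable (partial b f) y 'e_a.
  exact: Ck_on_derivable (Ck_on_partial b Hf) _.
have cdf a b : {for x, continuous (partial a (partial b f))}.
  by apply: (Ck_on_cont (Ck_on_partial a (Ck_on_partial b Hf))).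
have key a b (h : R) : h != 0 -> exists c d : R, [/\ `|c| <= `|h|, `|d| <= `|h| &
    f (x + h *: 'e_a + h *: 'e_b) - f (x + h *: 'e_a) - f (x + h *: 'e_b) + f x =
    h * h * partial b (partial a f) (x + c *: 'e_a + d *: 'e_b)].
  move=> h0.
  pose g := fun y => f (y - (- (h *: 'e_b))) - f y.
  have dg y : derivable g y 'e_a.
    apply: derivableB => //.
    by have := df a (y - (- (h *: 'e_b))); rewrite /derivable;
      set u := (X in cvg (X @ _)); set w := (X in _ -> cvg (X @ _));
      have -> : u = w by apply/funext => t; rewrite /u /w /= -addrA.
  have [c ch E] := MVT_line x h dg.
  have Eg y : 'D_('e_a) g y = partial a f (y + h *: 'e_b) - partial a f y.
    have -> : g = (fun y => f (y - (- (h *: 'e_b)))) - f by [].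
    rewrite deriveB//; last first.
      by have := df a (y - (- (h *: 'e_b))); rewrite /derivable;
      set u := (X in cvg (X @ _)); set w := (X in _ -> cvg (X @ _));
      have -> : u = w by apply/funext => t; rewrite /u /w /= -addrA.
    by rewrite -[X in X - _]/(partial a (fun y => f (y - (- (h *: 'e_b)))) y) partial_shift opprK.
  have [d dh E2] := MVT_line (x + c *: 'e_a) h (ddf b a).
  exists c, d; split => //.
  rewrite -mulrA -[partial b _ _]/('D_('e_b) (partial a f) (x + c *: 'e_a + d *: 'e_b)) -E2 -Eg -E /g
      !opprK; ring.
apply/eqP; rewrite -subr_eq0 -normr_le0; apply/ler_addgt0Pr => e e0; rewrite add0r.
have e20 : 0 < e / 2 by rewrite divr_gt0.
have H a b : \forall y \near x, `|partial a (partial b f) x - partial a (partial b f) y| < e / 2.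
  by have /cvgrPdist_lt/(_ _ e20) := cdf a b.
have /nbhs_ballP[r1 /= r10 Hr1] := H i j.
have /nbhs_ballP[r2 /= r20 Hr2] := H j i.
pose r := Num.min r1 r2.
have r0 : 0 < r by rewrite lt_min r10.
pose h := r / 3.
have h0 : 0 < h by rewrite divr_gt0.
have hn0 : h != 0 by rewrite gt_eqF.
have e1 a : `|'e_a : V| <= 1.
  rewrite [leLHS]/Num.norm/= mx_normrE; apply: bigmax_le => // -[p q] _ /=.
  by rewrite mxE; case: (_ && _); rewrite ?normr1 ?normr0.
have B a b (c d : R) : `|c| <= `|h| -> `|d| <= `|h| -> ball x r (x + c *: 'e_a + d *: 'e_b).
  move=> ch dh; rewrite mx_norm_ball /ball_/= -addrA opprD addrA subrr sub0r normrN.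
  apply: le_lt_trans (ler_normD _ _) _; rewrite !normrZ.
  apply: (@le_lt_trans _ _ (h * 1 + h * 1)); last by rewrite /h; lra.
  by rewrite -(gtr0_norm h0); apply: lerD; apply: ler_pM.
have [c [d [c1 d1 E1]]] := key j i h hn0.
have [c' [d' [c2 d2 E2]]] := key i j h hn0.
have EE : partial i (partial j f) (x + c *: 'e_j + d *: 'e_i) = partial j (partial i f) (x + c' *: 'e_i
    + d' *: 'e_j).
  have hh : h * h != 0 by rewrite mulf_neq0.
  have E12 : f (x + h *: 'e_j + h *: 'e_i) - f (x + h *: 'e_j) - f (x + h *: 'e_i) + f x =
      f (x + h *: 'e_i + h *: 'e_j) - f (x + h *: 'e_i) - f (x + h *: 'e_j) + f x.
    by rewrite [x + h *: 'e_j + h *: 'e_i]addrAC; ring.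
  exact: (mulfI hh (etrans (esym E1) (etrans E12 E2))).
have rr1 : r <= r1 by rewrite /r ge_min lexx.
have rr2 : r <= r2 by rewrite /r ge_min lexx orbT.
have B1 := Hr1 _ (le_ball rr1 (B j i _ _ c1 d1)).
have B2 := Hr2 _ (le_ball rr2 (B i j _ _ c2 d2)).
rewrite EE in B1.
rewrite distrC in B2.
apply: le_trans (ler_distD (partial j (partial i f) (x + c' *: 'e_i + d' *: 'e_j)) _ _) _.
by rewrite [leRHS]splitr; exact: ltW (ltrD B1 B2).
Qed.

End calculus.

(** * Integration by parts and convolution *)
Section convolution.
Context {R : realType} {n : nat}.
Local Notation V := 'rV[R]_n.
Local Notation mu := (lebesgue_rV R n).
Local Notation "''e_' i" := (delta_mx 0 i : V) (at level 8, i at level 2).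
Implicit Types (x y v : V) (D K : set V) (f g : V -> R) (i j : 'I_n) (k : nat).

Definition supp_in K f := forall x, ~ K x -> f x = 0.

Definition L1 f := mu.-integrable [set: V] (EFin \o f).

Lemma L1_measurable f : L1 f -> measurable_fun [set: V] f.
Proof. by move=> /integrableP[/measurable_EFinP]. Qed.

Lemma L1D f g : L1 f -> L1 g -> L1 (fun x => f x + g x).
Proof. by move=> Lf Lg; exact: (integrableD measurableT Lf Lg). Qed.

Lemma L1B f g : L1 f -> L1 g -> L1 (fun x => f x - g x).
Proof. by move=> Lf Lg; exact: (integrableB measurableT Lf Lg). Qed.

Lemma L1Z (c : R) f : L1 f -> L1 (fun x => c * f x).
Proof. by move=> Lf; exact: (integrableZl measurableT c Lf). Qed.

Lemma L1_sum (I : Type) (s : seq I) (F : I -> V -> R) :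
  (forall a, L1 (F a)) -> L1 (fun x => \sum_(a <- s) F a x).
Proof.
move=> LF; elim: s => [|a s IH].
  rewrite (_ : (fun x => _) = fun=> 0); first exact: integrable0.
  by apply/funext => x; rewrite big_nil.
rewrite (_ : (fun x => _) = (fun x => F a x + \sum_(b <- s) F b x)); first exact: L1D.
by apply/funext => x; rewrite big_cons.
Qed.

Lemma L1_norm f : L1 f -> L1 (fun x => `|f x|).
Proof. by move=> Lf; exact: integrable_norm. Qed.

Lemma L1_le f g : measurable_fun [set: V] f -> L1 g -> (forall x, `|f x| <= g x) -> L1 f.
Proof.
move=> mf Lg fg; apply: (le_integrable measurableT _ _ Lg); first exact/measurable_EFinP.
by move=> x _ /=; rewrite lee_fin (le_trans (fg x))// ler_norm.
Qed.

Lemma L1_mulb f g (M : R) : L1 f -> measurable_fun [set: V] g -> (forall x, `|g x| <= M) ->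
  L1 (fun x => f x * g x).
Proof.
move=> Lf mg gM; apply: (L1_le (g := fun x => M * `|f x|)).
- by apply: measurable_funM => //; exact: L1_measurable.
- by apply: L1Z; exact: L1_norm.
- by move=> x; rewrite normrM mulrC ler_wpM2r.
Qed.

Lemma L1_indic K : measurable K -> (mu K < +oo)%E -> L1 (\1_K : V -> R).
Proof.
move=> mK Koo; apply/integrableP; split.
  by apply/measurable_EFinP; exact: measurable_indic.
under eq_integral do rewrite gee0_abs ?lee_fin//.
by rewrite integral_indic// setIT.
Qed.

Lemma Rint_sum (I : Type) (s : seq I) (F : I -> V -> R) : (forall a, L1 (F a)) ->
  \int[mu]_x (\sum_(a <- s) F a x) = \sum_(a <- s) \int[mu]_x F a x.
Proof.
move=> LF; elim: s => [|a s IH].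
  rewrite big_nil (_ : (fun x => _) = fun=> 0); last by apply/funext => x; rewrite big_nil.
  by rewrite Rintegral_cst// mul0r.
rewrite big_cons -IH -RintegralD//; [|exact: LF|exact: L1_sum].
by congr Rintegral; apply/funext => x; rewrite big_cons.
Qed.

Lemma Rint_shift (a : V) f : measurable_fun [set: V] f ->
  \int[mu]_x f ((x : V) + a) = \int[mu]_x f x.
Proof.
move=> mf; rewrite /Rintegral; congr fine.
have mEf : measurable_fun [set: V] (EFin \o f) by exact/measurable_EFinP.
rewrite [LHS]integralE [RHS]integralE; congr (_ - _)%E.
- rewrite -(ge0_integral_shift a (h := (EFin \o f)^\+%E))//.
    by apply: eq_integral => x _; rewrite ?funeposE ?funenegE.
  exact: measurable_funepos.
- rewrite -(ge0_integral_shift a (h := (EFin \o f)^\-%E))//.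
    by apply: eq_integral => x _; rewrite ?funeposE ?funenegE.
  exact: measurable_funeneg.
Qed.

Lemma L1_shift (a : V) f : L1 f -> L1 (fun x => f (x + a)).
Proof.
move=> Lf; have mf := L1_measurable Lf; move: Lf => /integrableP[_ foo].
apply/integrableP; split; first by apply/measurable_EFinP; exact: measurable_fun_shift.
rewrite (ge0_integral_shift a (h := fun x => `|(f x)%:E|%E))//.
by apply: measurableT_comp => //; exact/measurable_EFinP.
Qed.

Lemma compact_measurable_rV K : compact K -> measurable K.
Proof. by move=> cK; apply: closed_measurable_rV; apply: compact_closed. Qed.

Lemma compact_finite_measure K : compact K -> (mu K < +oo)%E.
Proof.
move=> cK; apply: bounded_finite_measure; first exact: compact_measurable_rV.
exact: compact_bounded.
Qed.

Lemma compact_cont_bounded K f : compact K -> (forall x, K x -> {for x, continuous f}) ->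
  exists2 M : R, 0 < M & forall x, K x -> `|f x| <= M.
Proof.
move=> cK cf.
have /compact_bounded[M [_ HM]] : compact (f @` K).
  apply: continuous_compact cK; apply: continuous_in_subspaceT => x.
  by rewrite inE => Kx; exact: cf.
exists (`|M| + 1); first by rewrite ltr_wpDl.
move=> x Kx; apply: (HM (`|M| + 1)); last by exists x.
by rewrite ltr_pwDr// ler_norm.
Qed.

Lemma family_bounded (I : finType) K (F : I -> V -> R) :
  (forall c : I, exists2 M : R, 0 < M & forall x, K x -> `|F c x| <= M) ->
  exists2 M : R, 0 < M & forall (c : I) x, K x -> `|F c x| <= M.
Proof.
move=> Hb; exists (1 + \sum_c sval (cid2 (Hb c))).
  by rewrite ltr_pwDl// sumr_ge0// => c _; case: cid2 => m /= /ltW.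
move=> c x Kx; rewrite (bigD1 c)//=; case: cid2 => m /= m0 Hm.
apply: (le_trans (Hm x Kx)); rewrite addrCA lerDl addr_ge0// sumr_ge0// => d _.
by case: cid2 => m' /= /ltW.
Qed.

Lemma compact_family_bounded (I : finType) K (F : I -> V -> R) : compact K ->
  (forall (c : I) x, K x -> {for x, continuous (F c)}) ->
  exists2 M : R, 0 < M & forall (c : I) x, K x -> `|F c x| <= M.
Proof. by move=> cK HF; apply: family_bounded => c; exact: compact_cont_bounded (HF c). Qed.

Lemma csupp_bounded K f : compact K -> continuous f -> supp_in K f ->
  exists2 M : R, 0 < M & forall x, `|f x| <= M.
Proof.
move=> cK cf sf; have [M M0 HM] := compact_cont_bounded cK (fun x _ => cf x).
exists M => // x; have [/HM//|nK] := pselect (K x).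
by rewrite sf// normr0 ltW.
Qed.

Lemma csupp_L1 K f : compact K -> continuous f -> supp_in K f -> L1 f.
Proof.
move=> cK cf sf; have [M M0 HM] := csupp_bounded cK cf sf.
have mK := compact_measurable_rV cK.
apply: (L1_le (g := fun x => M * \1_K x)).
- exact: continuous_measurable_rV.
- by apply: L1Z; apply: L1_indic => //; exact: compact_finite_measure.
- move=> x; have [Kx|nK] := pselect (K x).
    by rewrite indicE mem_set// mulr1.
  by rewrite sf// normr0 mulr_ge0// ltW.
Qed.

Lemma supp_partial K f i : closed K -> supp_in K f -> supp_in K (partial i f).
Proof.
move=> cK sf x nK.
have oK : open (~` K) by rewrite openC.
have [_ ->] := near_partial i (near_open (f := f) (g := fun=> 0) oK nK (fun y => sf y)).
exact: partial_cst.
Qed.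

Lemma Ck_on_continuous k f : Ck_on setT k f -> continuous f.
Proof. by move=> Hf x; exact: (Ck_on_cont Hf). Qed.

(** The difference quotients of f have integral zero by translation invariance, and they
converge to the derivative while remaining bounded and supported in a fixed bounded set. *)
Lemma integral_partial K f i : compact K -> Ck_on setT 1 f -> supp_in K f ->
  \int[mu]_x partial i f x = 0.
Proof.
move=> cK Hf sf.
have cf := Ck_on_continuous Hf.
have cpf := Ck_on_continuous (Ck_on_partial i Hf).
have clK : closed K by exact: compact_closed.
have spf := supp_partial i clK sf.
have [M M0 HM] := csupp_bounded cK cpf spf.
have df x : derivable f x 'e_i by exact: (Ck_on_derivable Hf).
pose h m : R := m.+1%:R^-1.
have h0 m : 0 < h m by rewrite invr_gt0.
have h1 m : h m <= 1 by rewrite invf_le1// ler1n.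
pose F m x : R := (h m)^-1 * (f (x + h m *: 'e_i) - f x).
have mf : measurable_fun [set: V] f by exact: continuous_measurable_rV.
have Lf : L1 f by exact: csupp_L1 sf.
have LF m : L1 (F m) by apply: L1Z; apply: L1B => //; exact: L1_shift.
have IF m : (\int[mu]_x (F m x)%:E = 0)%E.
  have /fineK <- : (\int[mu]_x (F m x)%:E)%E \is a fin_num by exact: integrable_fin_num (LF m).
  congr EFin; change (\int[mu]_x F m x = 0).
  rewrite /F RintegralZl//; last by apply: L1B => //; exact: L1_shift.
  by rewrite RintegralB//; [rewrite Rint_shift// subrr mulr0|exact: L1_shift].
have [B [_ HB]] := compact_bounded cK.
have e1 : `|'e_i| <= 1.
  rewrite [leLHS]/Num.norm/= mx_normrE; apply: bigmax_le => // -[p q] _ /=.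
  by rewrite mxE; case: (_ && _); rewrite ?normr1 ?normr0.
(* K' contains all points at distance at most 1 from K, hence the supports of the quotients *)
pose K' : set V := closed_ball_ (fun x => `|x|) 0 (`|B| + 2).
have cK' : closed K' by exact: closed_closed_ball_.
have mK' : measurable K' by exact: closed_measurable_rV.
have bK' : bounded_set K'.
  exists (`|B| + 2); split; first exact: num_real.
  move=> r Br x /=; rewrite /K' /closed_ball_/= sub0r normrN => xB.
  by rewrite (le_trans xB)// ltW.
have K'fin := bounded_finite_measure mK' bK'.
have KK' x y : K x -> `|y - x| <= 1 -> K' y.
  move=> Kx yx; rewrite /K' /closed_ball_/= sub0r normrN.
  rewrite -[y](subrK x) (le_trans (ler_normD _ _))//.
  have := HB (`|B| + 1); rewrite ltr_pwDr ?ler_norm// => /(_ isT) /(_ x Kx) /=.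
  by move: yx; lra.
have cvF x : F m x @[m --> \oo] --> partial i f x.
  have /derivableP[/cvg_ex[l Hl] dl] := df x.
  have El : l = partial i f x by rewrite /partial -(cvg_lim _ Hl).
  rewrite -El.
  have hc : h m @[m --> \oo] --> (0 : R)^'.
    move=> A [r /= r0 HA].
    have /cvgrPdist_lt/(_ r r0)[N _ HN] := @cvg_harmonic R; exists N => // m Nm.
    apply: HA => /=; first exact: HN.
    by rewrite gt_eqF.
  have := cvg_comp _ _ hc Hl.
  apply: cvg_trans; apply: near_eq_cvg; near=> m.
  by rewrite /F /= [h m *: _ + _]addrC.
have bF x m : `|F m x| <= M * \1_K' x.
  have [fx0|/eqP] := eqVneq (f (x + h m *: 'e_i) - f x) 0.
    by rewrite /F fx0 mulr0 normr0 mulr_ge0// ltW.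
  move=> fx0.
  have K'x : K' x.
    have [Kx|nKx] := pselect (K x); first by apply: (KK' x) => //; rewrite subrr normr0.
    have [Kxh|nKxh] := pselect (K (x + h m *: 'e_i)); last first.
      by exfalso; apply: fx0; rewrite !sf// subrr.
    apply: (KK' _ _ Kxh); rewrite opprD addrA subrr sub0r normrN normrZ gtr0_norm//.
    by rewrite -[leRHS]mulr1; apply: ler_pM => //; exact: ltW.
  rewrite indicE mem_set// mulr1 /F.
  have [c _ ->] := MVT_line x (h m) df.
  by rewrite mulrA mulVf ?gt_eqF// mul1r; exact: HM.
have mpf : measurable_fun [set: V] (EFin \o partial i f).
  by apply/measurable_EFinP; exact: continuous_measurable_rV.
have mF m : measurable_fun [set: V] (EFin \o F m).
  by apply/measurable_EFinP; apply: L1_measurable.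
have H1 : {ae mu, forall x, [set: V] x -> (EFin \o F m) x @[m --> \oo] --> (EFin \o partial i f) x}.
  apply: aeW => x _; apply: cvg_EFin; first exact: nearW.
  exact: cvF.
have H2 : mu.-integrable [set: V] (EFin \o (fun x => M * \1_K' x)).
  by apply: L1Z; exact: L1_indic.
have H3 : {ae mu, forall x m, [set: V] x -> (`|(EFin \o F m) x| <= (EFin \o (fun x => M * \1_K' x)%R) x)%E}.
  by apply: aeW => x m _; rewrite /= lee_fin.
have [_ _ H] := dominated_convergence measurableT mF mpf H1 H2 H3.
have H0 : [sequence (\int[mu]_x (EFin \o F m) x)%E]_m @ \oo --> 0%E.
  rewrite (_ : [sequence _]_m = cst 0%E); first exact: cvg_cst.
  by apply/funext => m; exact: IF.
rewrite /Rintegral (_ : (\int[mu]_x (partial i f x)%:E)%E = 0%E)//.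
exact: (cvg_unique _ H H0).
Unshelve. all: by end_near. Qed.

(** The kernel is evaluated at y - x: for fixed x this is a translate of g. For an even kernel
this is the usual convolution. *)
Definition convol f g x : R := \int[mu]_y (f y * g (y - x)).

Lemma measurable_fun_shiftB (a : V) f : measurable_fun [set: V] f ->
  measurable_fun [set: V] (fun x => f (x - a)).
Proof. exact: measurable_fun_shift. Qed.

Lemma convol_L1 K f g x : compact K -> L1 f -> continuous g -> supp_in K g ->
  L1 (fun y => f y * g (y - x)).
Proof.
move=> cK Lf cg sg; have [M M0 HM] := csupp_bounded cK cg sg.
apply: (L1_mulb (M := M)) => //.
by apply: measurable_fun_shiftB; exact: continuous_measurable_rV.
Qed.

Lemma le_Rint_norm f g (C : R) h : L1 f -> L1 h -> (forall y, `|h y| <= C * `|f y|) ->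
  `|\int[mu]_y h y| <= C * \int[mu]_y `|f y|.
Proof.
move=> Lf Lh H; apply: le_trans (le_normr_Rintegral measurableT Lh) _.
rewrite -RintegralZl//; last exact: L1_norm.
by apply: le_Rintegral => //; [exact: L1_norm|exact: L1Z (L1_norm Lf)].
Qed.

Lemma convol_cont K f g : compact K -> L1 f -> Ck_on setT 1 g -> supp_in K g ->
  continuous (convol f g).
Proof.
move=> cK Lf Hg sg.
have clK : closed K by exact: compact_closed.
have cg := Ck_on_continuous Hg.
have Hb i : exists2 M : R, 0 < M & forall x, `|partial i g x| <= M.
  apply: (csupp_bounded cK) (supp_partial i clK sg).
  exact: Ck_on_continuous (Ck_on_partial i Hg).
pose M := \sum_i sval (cid2 (Hb i)).
have HM i x : `|partial i g x| <= M.
  rewrite /M (bigD1 i)//=; case: cid2 => m /= m0 Hm.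
  apply: (le_trans (Hm x)); rewrite lerDl sumr_ge0// => j _.
  by case: cid2 => m' /= /ltW.
have dg i x : derivable g x 'e_i by exact: (Ck_on_derivable Hg).
have M0 : 0 <= M by apply: sumr_ge0 => j _; case: cid2 => m' /= /ltW.
pose I := \int[mu]_y `|f y|.
have I0 : 0 <= I by apply: Rintegral_ge0.
have lip x x' : `|convol f g x - convol f g x'| <= (M * n%:R * I) * `|x - x'|.
  rewrite /convol -RintegralB//; [|exact: convol_L1 sg|exact: convol_L1 sg].
  rewrite mulrAC; apply: (le_Rint_norm (f := f)) => //.
    by apply: L1B; exact: convol_L1 sg.
  move=> y; rewrite -mulrBr normrM mulrC ler_wpM2r//.
  apply: le_trans (lipschitz_partial dg HM _ _) _.
  rewrite -mulrA ler_wpM2l//.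
  rewrite (le_trans (ler_sum _ (G := fun=> `|x - x'|) _))//.
    move=> i _; rewrite !mxE opprD opprK addrACA subrr add0r addrC -normrN opprB.
    have -> : x' 0 i - x 0 i = (x' - x) 0 i by rewrite !mxE.
    rewrite [leRHS]/Num.norm/= mx_normrE.
    exact: (le_bigmax _ (fun j : 'I_1 * 'I_n => `|(x' - x) j.1 j.2|) (0, i)).
  by rewrite sumr_const card_ord mulr_natl.
pose C := M * n%:R * I + 1.
have C0 : 0 < C by rewrite ltr_wpDl// !mulr_ge0.
move=> x A /nbhs_ballP[e /= e0 HA]; apply/nbhs_ballP.
exists (e / C) => /=; first by rewrite divr_gt0.
move=> y; rewrite mx_norm_ball /ball_/= ltr_pdivlMr// mulrC => xy; apply: HA.
rewrite /ball/= (le_lt_trans (lip _ _))// (le_lt_trans _ xy)//.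
by rewrite ler_wpM2r// lerDl.
Qed.

Lemma is_derive_lip (F : V -> R) x v (d C : R) :
  (forall h : R, h != 0 -> `|h^-1 * (F (x + h *: v) - F x) - d| <= C * `|h|) ->
  is_derive x v F d.
Proof.
move=> H.
have c : (fun h : R => h^-1 *: ((F \o shift x) (h *: v) - F x)) @ 0^' --> d.
  apply/cvgrPdist_lt => e e0.
  have C0 : 0 < `|C| + 1 by rewrite ltr_wpDl.
  exists (e / (`|C| + 1)) => /=; first by rewrite divr_gt0.
  move=> h /=; rewrite sub0r normrN => he h0; rewrite distrC /= [h *: v + x]addrC.
  apply: le_lt_trans (H h h0) _.
  apply: (@le_lt_trans _ _ ((`|C| + 1) * `|h|)).
    by rewrite ler_wpM2r// (le_trans (ler_norm C))// lerDl.
  by rewrite mulrC -ltr_pdivlMr.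
by apply: DeriveDef; [apply/cvg_ex; exists d|apply/cvg_lim].
Qed.

(** As g is of class C^2 with compact support, its difference quotients converge uniformly, with
a linear rate. *)
Lemma convol_derive K f g x i : compact K -> L1 f -> Ck_on setT 2 g -> supp_in K g ->
  derivable (convol f g) x 'e_i /\
  partial i (convol f g) x = convol f (fun z => - partial i g z) x.
Proof.
move=> cK Lf Hg sg.
have clK : closed K by exact: compact_closed.
have cg := Ck_on_continuous Hg.
have Hpg := Ck_on_partial i Hg.
have cpg := Ck_on_continuous Hpg.
have spg := supp_partial i clK sg.
have [M M0 HM] := csupp_bounded cK (Ck_on_continuous (Ck_on_partial i Hpg)) (supp_partial i clK spg).
have dg z : derivable g z 'e_i by exact: (Ck_on_derivable Hg).
have dpg z : derivable (partial i g) z 'e_i by exact: (Ck_on_derivable Hpg).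
have cpgN : continuous (fun z => - partial i g z) by move=> z; apply: continuousN; exact: cpg.
have spgN : supp_in K (fun z => - partial i g z) by move=> z /spg ->; rewrite oppr0.
suff H : is_derive x 'e_i (convol f g) (convol f (fun z => - partial i g z) x).
  by split; [exact: ex_derive|rewrite /partial; have [_ ->] := H].
apply: (@is_derive_lip _ _ _ _ (M * \int[mu]_y `|f y|)) => h h0.
have L1a := convol_L1 (x + h *: 'e_i) cK Lf cg sg.
have L1b := convol_L1 x cK Lf cg sg.
have L1c := convol_L1 x cK Lf cpgN spgN.
rewrite /convol -RintegralB// -[h^-1 * _]RintegralZl//; last exact: L1B.
rewrite -RintegralB//; last by apply: L1Z; exact: L1B.
rewrite mulrAC; apply: (le_Rint_norm (f := f)) => //.
  by apply: L1B => //; apply: L1Z; exact: L1B.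
move=> y.
have -> : h^-1 * (f y * g (y - (x + h *: 'e_i)) - f y * g (y - x)) - f y * - partial i g (y - x) =
  f y * (h^-1 * (g (y - (x + h *: 'e_i)) - g (y - x)) + partial i g (y - x)) by ring.
rewrite normrM mulrC ler_wpM2r//.
have -> : y - (x + h *: 'e_i) = (y - x) + (- h) *: 'e_i by rewrite opprD addrA scaleNr.
set z := y - x.
have [c ch ->] := MVT_line z (- h) dg.
rewrite mulrA mulrN mulVf// mulN1r.
have [d _ E] := MVT_line z c dpg.
rewrite -normrN opprD opprK -[X in X + _]/(partial i g (z + c *: 'e_i)) E normrM mulrC.
apply: ler_pM => //; first exact: HM.
by move: ch; rewrite normrN.
Qed.

Lemma convol_Ck K f g k : compact K -> L1 f -> Ck_on setT k.+1 g -> supp_in K g ->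
  Ck_on setT k (convol f g).
Proof.
move=> cK Lf; elim: k g => [|k IH] g Hg sg.
  by apply: Ck_on0 => x _; apply: (convol_cont cK Lf).
have clK : closed K by exact: compact_closed.
have Hg2 : Ck_on setT 2 g by apply: Ck_onW Hg.
apply/Ck_onS; split.
- by move=> x _; apply: (convol_cont cK Lf) => //; exact: Ck_onW Hg.
- by move=> i x _; have [] := convol_derive x i cK Lf Hg2 sg.
- move=> i; rewrite (_ : partial i _ = convol f (fun z => - partial i g z)); last first.
    by apply/funext => x; have [] := convol_derive x i cK Lf Hg2 sg.
  apply: IH; last by move=> z /(supp_partial i clK sg) ->; rewrite oppr0.
  rewrite (_ : (fun z => _) = (fun z => -1 * partial i g z)); last by apply/funext => z; rewrite mulN1r.
  by apply: Ck_onZ; [exact: openT|exact: Ck_on_partial].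
Qed.

End convolution.

(** * A smooth bump *)
Section mollifier.
Context {R : realType}.

(** [flat_exp m] is the m-th derivative of exp (-1/t), extended by zero to t <= 0, and
[flat_exp_poly m] is the polynomial in 1/t that appears in it. *)
Fixpoint flat_exp_poly (m : nat) : {poly R} :=
  if m is m'.+1 then 'X^2 * (flat_exp_poly m' - (flat_exp_poly m')^`()) else 1.

Definition flat_exp (m : nat) (t : R) : R :=
  if 0 < t then (flat_exp_poly m).[t^-1] * expR (- t^-1) else 0.

Lemma poly_bound (p : {poly R}) : exists2 C : R, 0 < C &
  forall s, 1 <= s -> `|p.[s]| <= C * s ^+ size p.
Proof.
exists (1 + \sum_(i < size p) `|p`_i|); first by rewrite ltr_pwDl// sumr_ge0.
move=> s s1; have s0 : 0 <= s by rewrite (le_trans _ s1).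
rewrite horner_coef; apply: le_trans (ler_norm_sum _ _ _) _.
apply: (@le_trans _ _ (\sum_(i < size p) `|p`_i| * s ^+ size p)).
  apply: ler_sum => i _; rewrite normrM ler_wpM2l// normrX ger0_norm//.
  by apply: ler_weXn2l => //; exact: ltnW.
by rewrite -mulr_suml ler_wpM2r ?exprn_ge0// lerDr.
Qed.

(** The exponential beats the polynomial. A quadratic bound is what differentiability at 0 with
derivative 0 requires. *)
Lemma flat_exp_small m : exists2 C : R, 0 < C &
  forall t, `|t| <= 1 -> `|flat_exp m t| <= C * `|t| ^+ 2.
Proof.
have [C C0 HC] := poly_bound (flat_exp_poly m).
set N := size (flat_exp_poly m) in HC.
exists (C * (N.+2)`!%:R); first by rewrite mulr_gt0// ltr0n fact_gt0.
move=> t t1; rewrite /flat_exp; case: ifPn => [t0|_]; last first.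
  by rewrite normr0 !mulr_ge0// ?ltW// ?exprn_ge0// ltr0n fact_gt0.
rewrite gtr0_norm// in t1 *.
have s1 : 1 <= t^-1 by rewrite invf_ge1.
have s0 : 0 < t^-1 by rewrite invr_gt0.
rewrite normrM (ger0_norm (expR_ge0 _)) expRN.
set s := t^-1 in s1 s0 *.
have E : s ^+ N.+2 / (N.+2)`!%:R <= expR s.
  by rewrite (le_trans _ (expR_ge1Dxn N.+1 (ltW s0)))// lerDr.
have F0 : 0 < (N.+2)`!%:R :> R by rewrite ltr0n fact_gt0.
have -> : t = s^-1 by rewrite invrK.
rewrite ler_pdivrMr ?expR_gt0//.
apply: le_trans (HC s s1) _.
have : C * s ^+ N <= C * (N.+2)`!%:R * s^-1 ^+ 2 * (s ^+ N.+2 / (N.+2)`!%:R).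
  rewrite -subr_ge0 (_ : _ - _ = 0)// -addn2 exprD.
  by field; rewrite !gt_eqF.
move=> /le_trans; apply; apply: ler_wpM2l => //.
apply: mulr_ge0; first by apply: mulr_ge0; exact: ltW.
by rewrite exprn_ge0// invr_ge0 ltW.
Qed.

Lemma is_derive_flat_exp m (t : R) : is_derive t 1 (flat_exp m) (flat_exp m.+1 t).
Proof.
have [t0|t0|->] := ltgtP t 0.
- have H : is_derive t 1 (fun=> 0 : R) 0 by exact: is_derive_cst.
  rewrite {2}/flat_exp ltNge (ltW t0) /=.
  apply: near_eq_is_derive H.
  near=> z; rewrite /flat_exp ifF//; apply/negbTE; rewrite -leNgt ltW//; near: z.
  exact: lt_nbhsl.
- rewrite {2}/flat_exp t0.
  pose F (s : R) := (flat_exp_poly m).[s] * expR (- s).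
  have DV : is_derive t 1 (fun s : R => s^-1) (- t ^- 2).
    have H : is_derive t 1 (fun s : R => (id s)^-1) (- (id t) ^- 2 *: 1).
      by apply: is_deriveV; exact: lt0r_neq0.
    by rewrite [_ *: _]mulr1 in H.
  have DF : is_derive t^-1 1 F ((flat_exp_poly m).[t^-1] * (expR (- t^-1) * -1) + expR (- t^-1) *
      (flat_exp_poly m)^`().[t^-1]).
    have D1 : is_derive t^-1 1 (fun s : R => expR (- s)) (expR (- t^-1) * -1).
      have := @is_derive1_comp _ expR -%R t^-1 _ _ (is_derive_expR _) (is_deriveNid t^-1 1).
      by [].
    exact: (is_deriveM (is_derive_poly (flat_exp_poly m) t^-1) D1).
  have D := is_derive1_comp DF DV.
  apply: (@near_eq_is_derive _ _ _ (F \o (fun s : R => s^-1))).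
    near=> z; rewrite /flat_exp ifT//; near: z; exact: lt_nbhsr.
  apply: is_derive_eq D _.
  by rewrite [flat_exp_poly m.+1]/= hornerM hornerXn hornerD hornerN exprVn; ring.
- rewrite {2}/flat_exp ltxx.
  have [C C0 HC] := flat_exp_small m.
  have c : (fun h : R => h^-1 *: ((flat_exp m \o shift 0) (h *: 1) - flat_exp m 0)) @ 0^' --> (0 : R).
    apply/cvgrPdist_lt => e e0.
    exists (Num.min 1 (e / C)) => /=; first by rewrite lt_min ltr01 divr_gt0.
    move=> h /=; rewrite sub0r normrN lt_min => /andP[h1 he] h0.
    have hf0 : flat_exp m 0 = 0 by rewrite /flat_exp ltxx.
    rewrite hf0.
    rewrite subr0 sub0r normrN addr0 [h *: 1]mulr1 [_ *: _]/(_ * _) normrM normfV.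
    have hp : 0 < `|h| by rewrite normr_gt0.
    rewrite mulrC ltr_pdivrMr//.
    apply: le_lt_trans (HC h (ltW h1)) _.
    by rewrite expr2 mulrA ltr_pM2r// mulrC -ltr_pdivlMr.
  by apply: DeriveDef; [apply/cvg_ex; exists 0|apply/cvg_lim].
Unshelve. all: by end_near. Qed.

Lemma flat_exp0_gt0 (t : R) : 0 < t -> 0 < flat_exp 0 t.
Proof. by move=> t0; rewrite /flat_exp t0 /= hornerC mul1r expR_gt0. Qed.

Lemma flat_exp0_le0 (t : R) : t <= 0 -> flat_exp 0 t = 0.
Proof. by move=> t0; rewrite /flat_exp ltNge t0. Qed.

Lemma flat_exp0_ge0 (t : R) : 0 <= flat_exp 0 t.
Proof. by have [/flat_exp0_le0 ->//|/flat_exp0_gt0/ltW] := leP t 0. Qed.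

Lemma flat_exp0_le (s t : R) : s <= t -> flat_exp 0 s <= flat_exp 0 t.
Proof.
move=> st; have [/flat_exp0_le0 ->|s0] := leP s 0; first exact: flat_exp0_ge0.
have t0 : 0 < t by rewrite (lt_le_trans s0).
by rewrite /flat_exp s0 t0 /= !hornerC !mul1r ler_expR lerN2 lef_pV2.
Qed.

Context {n : nat}.
Local Notation V := 'rV[R]_n.
Local Notation mu := (lebesgue_rV R n).
Implicit Types (x y : V).

(** The squared Euclidean norm. Being a polynomial it is smooth, unlike the sup norm that carries
the topology. *)
Definition sqn x : R := \sum_i x 0 i * x 0 i.

Lemma Ck_on_sqn k : Ck_on setT k sqn.
Proof.
apply: Ck_on_sum; first exact: openT.
by move=> i; apply: Ck_onM; [exact: openT|exact: Ck_on_coord|exact: Ck_on_coord].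
Qed.

Lemma sqn_ge0 x : 0 <= sqn x.
Proof. by apply: sumr_ge0 => i _; rewrite -expr2 sqr_ge0. Qed.

Lemma coord_sqn x i : x 0 i ^+ 2 <= sqn x.
Proof.
rewrite /sqn (bigD1 i)//= -expr2 lerDl; apply: sumr_ge0 => j _.
by rewrite -expr2 sqr_ge0.
Qed.

Lemma norm_sqn x : `|x| ^+ 2 <= sqn x.
Proof.
suff H : `|x| <= Num.sqrt (sqn x).
  by rewrite -(sqr_sqrtr (sqn_ge0 x)) ler_sqr ?nnegrE ?sqrtr_ge0.
rewrite [leLHS]/Num.norm/= mx_normrE; apply: bigmax_le; first exact: sqrtr_ge0.
move=> -[i j] _ /=; rewrite ord1 -sqrtr_sqr; apply: ler_wsqrtr; exact: coord_sqn.
Qed.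

Lemma sqn_norm x : sqn x <= n%:R * `|x| ^+ 2.
Proof.
rewrite /sqn (le_trans (ler_sum _ (G := fun=> `|x| ^+ 2) _))//.
  move=> i _; rewrite -expr2 -real_normK ?num_real// ler_sqr ?nnegrE//.
  rewrite [leRHS]/Num.norm/= mx_normrE.
  exact: (le_bigmax _ (fun j : 'I_1 * 'I_n => `|x j.1 j.2|) (0, i)).
by rewrite sumr_const card_ord mulr_natl.
Qed.

Lemma continuous_sqn : continuous sqn.
Proof. exact: Ck_on_continuous (@Ck_on_sqn 0). Qed.

Lemma continuous_sqnB y : continuous (fun x => sqn (x - y)).
Proof. exact: cont_shift continuous_sqn. Qed.

Lemma compact_sqn_ball y (r : R) : compact [set x | sqn (x - y) <= r].
Proof.
apply: bounded_closed_compact; last first.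
  rewrite (_ : mkset _ = (fun x => sqn (x - y)) @^-1` [set t | t <= r]); last by [].
  apply: closed_comp; last exact: closed_le.
  by move=> x _; exact: continuous_sqnB.
exists (`|y| + `|r| + 1); split; first exact: num_real.
move=> M HM x /= xr; apply: (le_trans _ (ltW HM)).
rewrite -[x](subrK y) addrC; apply: (le_trans (ler_normD _ _)).
rewrite -addrA lerD2l.
have H := le_trans (norm_sqn (x - y)) xr.
rewrite -ler_sqr ?nnegrE// ?addr_ge0//.
apply: (le_trans H); have := normr_ge0 r; have := ler_norm r; rewrite expr2; nra.
Qed.

Definition bump (e : R) x : R := flat_exp 0 (e ^+ 2 - sqn x).

Lemma Ck_bump e k : Ck_on setT k (bump e).
Proof.
apply: (Ck_on_chain (H := flat_exp) 0%N); first exact: openT.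
  by move=> m t; exact: is_derive_flat_exp.
apply: Ck_onB; [exact: openT|exact: Ck_on_cst|exact: Ck_on_sqn].
Qed.

Lemma supp_bump e : supp_in [set x | sqn (x - 0) <= e ^+ 2] (bump e).
Proof. by move=> x /= /negP; rewrite subr0 -ltNge => xe; rewrite /bump flat_exp0_le0// subr_le0 ltW. Qed.

Lemma bump_L1 e : L1 (bump e).
Proof.
apply: (csupp_L1 (@compact_sqn_ball 0 (e ^+ 2)) _ (@supp_bump e)).
exact: Ck_on_continuous (@Ck_bump e 0).
Qed.

Lemma int_bump_gt0 e : 0 < e -> 0 < \int[mu]_x bump e x.
Proof.
move=> e0.
pose d := e / (2 * n.+1%:R).
have d0 : 0 < d by rewrite divr_gt0// mulr_gt0.
pose B : set V := [set x | forall i, `[- d, d]%classic (x 0 i)].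
have mB : measurable B by apply: (@measurable_box R n (fun=> `[- d, d]%classic)).
have muB : mu B = ((d *+ 2) ^+ n)%:E.
  rewrite [LHS](@lebesgue_rV_box R n (fun=> `[- d, d]%classic))//.
  rewrite (eq_bigr (fun=> (d *+ 2)%:E)); last first.
    by move=> i _; rewrite lebesgue_measure_itv/= lte_fin gtrN// -EFinB opprK mulr2n.
  by rewrite prodEFin prodr_const card_ord.
pose c := flat_exp 0 (e ^+ 2 / 2).
have c0 : 0 < c by apply: flat_exp0_gt0; rewrite divr_gt0// exprn_gt0.
have Bb x : c * \1_B x <= bump e x.
  rewrite indicE; case: (boolP (x \in B)); last by rewrite mulr0 flat_exp0_ge0.
  rewrite inE mulr1 => Bx; apply: flat_exp0_le.
  suff : sqn x <= e ^+ 2 / 2 by lra.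
  apply: (@le_trans _ _ (\sum_(i < n) d ^+ 2)).
    apply: ler_sum => i _; have := Bx i; rewrite /= in_itv/= -ler_norml => xi.
    by rewrite -expr2 -real_normK ?num_real// ler_sqr ?nnegrE// ltW.
  rewrite sumr_const card_ord -[leLHS]mulr_natl.
  have n10 : (2 * n.+1%:R : R) != 0 by rewrite mulf_neq0// pnatr_eq0.
  have <- : d * (2 * n.+1%:R) = e by rewrite divfK.
  have n0 : (0 : R) <= n%:R by [].
  have d2 : 0 < d ^+ 2 by rewrite exprn_gt0.
  have -> : n.+1%:R = n%:R + 1 :> R by rewrite natr1.
  move: (n%:R : R) n0 => N N0.
  have -> : (d * (2 * (N + 1))) ^+ 2 / 2 = (2 * (N + 1) ^+ 2) * d ^+ 2 by field.
  by rewrite ler_pM2r// expr2; nra.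
have L1B : L1 (\1_B : V -> R) by apply: L1_indic => //; rewrite muB ltry.
apply: (@lt_le_trans _ _ (\int[mu]_x (c * \1_B x))); last first.
  by apply: le_Rintegral => //; [exact: L1Z|exact: bump_L1].
have -> : \int[mu]_x (c * \1_B x) = c * (d *+ 2) ^+ n.
  rewrite RintegralZl//; congr (_ * _); rewrite /Rintegral integral_indic// setIT.
  exact: (congr1 fine muB).
rewrite mulr_gt0//.
by rewrite exprn_gt0// mulr2n addr_gt0.
Qed.

Definition mollifier (e : R) x : R := (\int[mu]_y bump e y)^-1 * bump e x.

Lemma Ck_mollifier e k : Ck_on setT k (mollifier e).
Proof. by apply: Ck_onZ; [exact: openT|exact: Ck_bump]. Qed.

Lemma supp_mollifier e : supp_in [set x | sqn (x - 0) <= e ^+ 2] (mollifier e).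
Proof. by move=> x /supp_bump bx; rewrite /mollifier bx mulr0. Qed.

Lemma mollifier_L1 e : L1 (mollifier e).
Proof. exact: L1Z (bump_L1 e). Qed.

Lemma mollifier_ge0 e x : 0 < e -> 0 <= mollifier e x.
Proof.
by move=> e0; rewrite mulr_ge0 ?flat_exp0_ge0// invr_ge0 ltW// int_bump_gt0.
Qed.

Lemma int_mollifier e : 0 < e -> \int[mu]_x mollifier e x = 1.
Proof.
move=> e0; rewrite /mollifier RintegralZl//; last exact: bump_L1.
by rewrite mulVf// gt_eqF// int_bump_gt0.
Qed.

End mollifier.

(** * Mollification and weak derivatives *)
Section mollification.
Context {R : realType} {n : nat}.
Local Notation V := 'rV[R]_n.
Local Notation mu := (lebesgue_rV R n).
Implicit Types (x y z : V) (D K : set V) (f g h : V -> R) (i j : 'I_n) (k : nat).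

Definition mollify (e : R) f := convol f (mollifier e).

(** Square-integrable on the whole space: functions on D are extended by zero. *)
Definition L2 f := measurable_fun [set: V] f /\ (l2sq f < +oo)%E.

Lemma L2_L1 D f : measurable D -> (mu D < +oo)%E -> L2 f -> supp_in D f -> L1 f.
Proof.
move=> mD Doo [mf foo] sf.
have Lf2 : L1 (fun x => (f x) ^+ 2).
  apply/integrableP; split; first exact: measurable_sqrE.
  by under eq_integral do rewrite gee0_abs ?lee_fin ?sqr_ge0//.
apply: (L1_le (g := fun x => \1_D x + (f x) ^+ 2)) => //.
  by apply: L1D => //; exact: L1_indic.
move=> x; have [Dx|/sf ->] := pselect (D x); last by rewrite normr0 addr_ge0// sqr_ge0.
rewrite indicE mem_set//= -[in leRHS]real_normK ?num_real//.
have := sqr_ge0 (`|f x| - 1); have := normr_ge0 (f x); rewrite !expr2; nra.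
Qed.

Lemma mollifier_supp e x : 0 < e -> mollifier e x != 0 -> `|x| <= e.
Proof.
move=> e0 bx; have ee := ltW e0; rewrite -ler_sqr ?nnegrE//; apply: (le_trans (norm_sqn x)).
rewrite leNgt; apply/negP => ex; move/eqP: bx; apply; apply: supp_mollifier => /=.
by rewrite subr0 leNgt ex.
Qed.

Lemma continuous_mollifier e : continuous (mollifier e : V -> R).
Proof. exact: Ck_on_continuous (@Ck_mollifier _ _ e 0). Qed.

Lemma measurable_mollifier e : measurable_fun [set: V] (mollifier e).
Proof. by apply: continuous_measurable_rV; exact: continuous_mollifier. Qed.

Lemma mollifier_bounded e : exists2 M : R, 0 < M & forall x, `|mollifier e x| <= M.
Proof.
exact: csupp_bounded (@compact_sqn_ball _ _ 0 (e ^+ 2)) (@continuous_mollifier e) (@supp_mollifier _ _ e).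
Qed.

(** Jensen's inequality in the form of a variance: with c the mean of f y - f x under the
probability density, integrate (f y - f x - c)^2 >= 0. *)
Lemma mollify_jensen e f x : 0 < e -> L1 f ->
  (((mollify e f x - f x) ^+ 2)%:E <= \int[mu]_y (((f y - f x) ^+ 2 * mollifier e (y - x))%:E))%E.
Proof.
move=> e0 Lf.
have mf := L1_measurable Lf.
pose w y := mollifier e (y - x).
have mw : measurable_fun [set: V] w by apply: measurable_fun_shiftB; exact: measurable_mollifier.
have Lw : L1 w by apply: (L1_shift (- x)); exact: mollifier_L1.
have Iw : \int[mu]_y w y = 1.
  by rewrite [LHS](Rint_shift (- x) (@measurable_mollifier e)) int_mollifier.
have w0 y : 0 <= w y by exact: mollifier_ge0.
have [M M0 HM] := mollifier_bounded e.
have Lfw : L1 (fun y => f y * w y) by apply: (L1_mulb (M := M)) => // y; exact: HM.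
pose c := mollify e f x - f x.
have Lgw : L1 (fun y => (f y - f x) * w y).
  rewrite (_ : (fun y => _) = (fun y => f y * w y - f x * w y)); last first.
    by apply/funext => y; rewrite mulrBl.
  by apply: L1B => //; exact: L1Z.
have cE : \int[mu]_y ((f y - f x) * w y) = c.
  rewrite (_ : (fun y => _) = (fun y => f y * w y - f x * w y)); last first.
    by apply/funext => y; rewrite mulrBl.
  by rewrite RintegralB//; [rewrite RintegralZl// Iw mulr1|exact: L1Z].
set J := (X in (_ <= X)%E).
have mg2 : measurable_fun [set: V] (fun y => (f y - f x) ^+ 2 * w y).
  by apply: measurable_funM => //; apply: measurable_funX; apply: measurable_funB.
have J0 : (0 <= J)%E.
  by apply: integral_ge0 => y _; rewrite lee_fin mulr_ge0 ?sqr_ge0//; exact: w0.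
have [Joo|] := ltP J +oo%E; last by rewrite leye_eq => /eqP ->; rewrite leey.
have Lg2 : L1 (fun y => (f y - f x) ^+ 2 * w y).
  apply/integrableP; split; first exact/measurable_EFinP.
  rewrite (eq_integral (fun y => ((f y - f x) ^+ 2 * w y)%:E))// => y _.
  by rewrite gee0_abs// lee_fin; apply: mulr_ge0; [exact: sqr_ge0|exact: w0].
have <- : (\int[mu]_y ((f y - f x) ^+ 2 * w y))%:E = J.
  by rewrite /Rintegral fineK// ge0_fin_numE.
rewrite lee_fin.
have -> : c ^+ 2 = \int[mu]_y (2 * c * ((f y - f x) * w y) - c ^+ 2 * w y).
  rewrite RintegralB//; [|exact: L1Z|exact: L1Z].
  have -> : \int[mu]_y (2 * c * ((f y - f x) * w y)) = 2 * c * c.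
    by rewrite -[X in _ = _ * X]cE -RintegralZl.
  by rewrite RintegralZl// Iw; ring.
apply: le_Rintegral => //; first by apply: L1B; exact: L1Z.
move=> y _.
rewrite -subr_ge0 (_ : _ - _ = (f y - f x - c) ^+ 2 * w y); last by ring.
by rewrite mulr_ge0// sqr_ge0.
Qed.

(** By Jensen and Tonelli, the squared distance from f to its mollification is at most an average,
over translations of length at most e, of the squared distance from f to its translate. *)
Lemma mollify_L2 D f : open D -> (mu D < +oo)%E -> L2 f -> supp_in D f ->
  forall eta : R, 0 < eta -> exists2 d : R, 0 < d & forall e, 0 < e -> e < d ->
    (l2sq (fun x => mollify e f x - f x)%R <= eta%:E)%E.
Proof.
move=> oD Doo L2f sf eta eta0; have [mf foo] := L2f.
have mD := open_measurable_rV oD.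
have Lf := L2_L1 mD Doo L2f sf.
have [d d0 Hd] := translation_cont_L2 oD Doo mf sf foo eta0.
exists d => // e e0 ed.
have b0 x : 0 <= mollifier e x by exact: mollifier_ge0.
pose G (p : V * V) : \bar R := (((f (p.1 + p.2) - f p.1) ^+ 2 * mollifier e p.2)%:E).
have mG : measurable_fun [set: V * V] G.
  apply/measurable_EFinP; apply: measurable_funM; last first.
    by apply: (measurableT_comp (measurable_mollifier e)).
  apply: measurable_funX; apply: measurable_funB.
    by apply: (measurableT_comp mf); exact: measurable_add_rV.
  by apply: (measurableT_comp mf).
have G0 p : (0 <= G p)%E by rewrite lee_fin mulr_ge0// sqr_ge0.
apply: (@le_trans _ _ (\int[mu]_x \int[mu]_z G (x, z))%E).
  apply: ge0_le_integral => //.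
  - by move=> x _; rewrite lee_fin sqr_ge0.
  - apply: measurable_sqrE; apply: measurable_funB => //.
    apply: continuous_measurable_rV.
    exact: convol_cont (@compact_sqn_ball _ _ 0 (e ^+ 2)) Lf (@Ck_mollifier _ _ e 1) (@supp_mollifier _ _ e).
  - by apply: measurable_fun_fubini_tonelli_F.
  - move=> x _; apply: le_trans (mollify_jensen x e0 Lf) _.
    rewrite -(ge0_integral_shift x (h := fun y => ((f y - f x) ^+ 2 * mollifier e (y - x))%:E)).
    + apply: ge0_le_integral => //.
      * by move=> y _; rewrite lee_fin mulr_ge0// sqr_ge0.
      * apply/measurable_EFinP; apply: measurable_funM.
          apply: measurable_funX; apply: measurable_funB => //.
          exact: measurable_fun_shift.
        rewrite (_ : (fun y : V => _) = mollifier e); first exact: measurable_mollifier.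
        by apply/funext => y; rewrite addrK.
      * exact: (measurable_fun_pair2 x mG).
      * by move=> y _; rewrite /G /= addrK [y + x]addrC.
    + apply/measurable_EFinP; apply: measurable_funM.
        by apply: measurable_funX; apply: measurable_funB.
      by apply: measurable_fun_shiftB; exact: measurable_mollifier.
    + by move=> y; rewrite lee_fin mulr_ge0// sqr_ge0.
rewrite fubini_tonelli//.
apply: (@le_trans _ _ (\int[mu]_z (eta%:E * (mollifier e z)%:E))%E); last first.
  rewrite ge0_integralZl//; last 3 first.
  - by apply/measurable_EFinP; exact: measurable_mollifier.
  - by move=> x _; rewrite lee_fin.
  - by rewrite lee_fin ltW.
  have -> : (\int[mu]_z (mollifier e z)%:E = (1 : R)%:E)%E.
    rewrite -(int_mollifier (n := n) e0) /Rintegral fineK//.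
    exact: integrable_fin_num (mollifier_L1 e).
  by rewrite mule1.
apply: ge0_le_integral => //.
- by move=> z _; exact: integral_ge0.
- by apply: measurable_fun_fubini_tonelli_G.
- by apply: measurable_funeM; apply/measurable_EFinP; exact: measurable_mollifier.
move=> z _; rewrite /G /=.
have mfz : measurable_fun [set: V] (fun x => f (x + z) - f x).
  by apply: measurable_funB => //; exact: measurable_fun_shift.
under eq_integral do rewrite EFinM muleC.
rewrite ge0_integralZl//; last 3 first.
- exact: measurable_sqrE.
- by move=> x _; rewrite lee_fin sqr_ge0.
- by rewrite lee_fin.
rewrite muleC.
have [->|bz] := eqVneq (mollifier e z) 0; first by rewrite !mule0.
apply: lee_wpmul2r; first by rewrite lee_fin.
by apply: Hd; rewrite (le_lt_trans (mollifier_supp e0 bz)).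
Qed.

Lemma test_mollifier D e x : 0 < e -> [set y | sqn (y - x) <= e ^+ 2] `<=` D ->
  test_function D (fun y => mollifier e (y - x)).
Proof.
move=> e0 BD.
have cB := @compact_sqn_ball R n x (e ^+ 2).
have clB : closed [set y : V | sqn (y - x) <= e ^+ 2] by exact: compact_closed.
have sB : closure [set y | mollifier e (y - x) != 0] `<=` [set y | sqn (y - x) <= e ^+ 2].
  rewrite [X in _ `<=` X](closure_id _).1//; apply: closureS.
  move=> y /= by0; rewrite leNgt; apply/negP => ye; move/eqP: by0; apply.
  by apply: supp_mollifier; rewrite /= subr0; apply/negP; rewrite -ltNge.
split.
- by move=> k; apply: Ck_on_shift; exact: Ck_mollifier.
- by apply: (subclosed_compact _ cB sB); exact: closed_closure.
- exact: subset_trans BD.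
Qed.

(** The weak derivative along i in D, for real functions extended by zero outside D. *)
Definition wderiv D i f g := forall phi, test_function D phi ->
  \int[mu]_x (f x * partial i phi x) = - \int[mu]_x (g x * phi x).

(** The mollifier centred at x is a test function in D when its support is contained in D. *)
Lemma mollify_partial D i f g e x : 0 < e -> L1 f -> L1 g -> wderiv D i f g ->
  [set y | sqn (y - x) <= e ^+ 2] `<=` D ->
  partial i (mollify e f) x = mollify e g x.
Proof.
move=> e0 Lf Lg H BD.
have [_ ->] := convol_derive x i (@compact_sqn_ball _ _ 0 (e ^+ 2)) Lf (@Ck_mollifier _ _ e 2)
    (@supp_mollifier _ _ e).
have := H _ (test_mollifier e0 BD).
rewrite /mollify /convol partial_shift => E.
rewrite -[RHS]opprK -E.
have sp : supp_in [set x | sqn (x - 0) <= e ^+ 2] (partial i (mollifier e : V -> R)).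
  by apply: supp_partial; [exact: compact_closed (@compact_sqn_ball _ _ 0 (e ^+ 2))|exact: supp_mollifier].
have cp : continuous (partial i (mollifier e : V -> R)).
  exact: Ck_on_continuous (Ck_on_partial i (@Ck_mollifier _ _ e 1)).
have Lp := convol_L1 x (@compact_sqn_ball _ _ 0 (e ^+ 2)) Lf cp sp.
rewrite -[RHS]mulN1r -RintegralZl//.
by congr Rintegral; apply/funext => y; ring.
Qed.

Lemma mollify_Ck e f k : L1 f -> Ck_on setT k (mollify e f).
Proof.
by move=> Lf; exact: convol_Ck (@compact_sqn_ball _ _ 0 (e ^+ 2)) Lf (@Ck_mollifier _ _ e k.+1)
    (@supp_mollifier _ _ e).
Qed.

Lemma inner_ball D k e x : inner D k x -> 0 < e -> e < k.+1%:R^-1 ->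
  [set y | sqn (y - x) <= e ^+ 2] `<=` D.
Proof.
move=> Dx e0 ek y /= ye; apply: contrapT => Dy; apply: Dx; exists y => //.
apply: le_lt_trans ek; have ee := ltW e0; rewrite -ler_sqr ?nnegrE//.
exact: le_trans (norm_sqn _) ye.
Qed.

(** The mollifications of f vanish on [inner D k] for small e, and they converge to f. *)
Lemma dubois_reymond D f : open D -> (mu D < +oo)%E -> L2 f -> supp_in D f ->
  (forall phi, test_function D phi -> \int[mu]_x (f x * phi x) = 0) ->
  {ae mu, forall x, f x = 0}.
Proof.
move=> oD Doo L2f sf H; have [mf foo] := L2f.
have Lf := L2_L1 (open_measurable_rV oD) Doo L2f sf.
suff K k : {ae mu, forall x, inner D k x -> f x = 0}.
  have := ae_foralln K; apply: filterS => x Hx.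
  have [|/sf//] := pselect (D x).
  by rewrite {1}(innerE oD) => -[k _ Dk]; exact: (Hx k).
have mI := measurable_inner D k.
have mf2 : measurable_fun (inner D k) (fun x => ((f x) ^+ 2)%:E).
  by apply: measurable_sqrE; exact: measurable_funTS.
have I0 : (\int[mu]_(x in inner D k) `|((f x) ^+ 2)%:E| = 0)%E.
  apply/eqP; rewrite eq_le; apply/andP; split; last exact: integral_ge0.
  apply/lee_addgt0Pr => eta eta0; rewrite add0e.
  have [d d0 Hd] := mollify_L2 oD Doo L2f sf eta0.
  pose e := (Num.min d k.+1%:R^-1) / 2.
  have m0 : 0 < Num.min d (k.+1%:R^-1 : R) by rewrite lt_min d0/= invr_gt0 ltr0n.
  have e0 : 0 < e by rewrite divr_gt0.
  have em : e < Num.min d k.+1%:R^-1 by rewrite /e; lra.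
  move: em; rewrite lt_min => /andP[ed ek].
  apply: le_trans (Hd e e0 ed).
  have cm : continuous (mollify e f) by exact: Ck_on_continuous (@mollify_Ck e f 0 Lf).
  have mm : measurable_fun [set: V] (fun x => mollify e f x - f x).
    by apply: measurable_funB => //; exact: continuous_measurable_rV.
  apply: (@le_trans _ _ (\int[mu]_(x in inner D k) ((mollify e f x - f x) ^+ 2)%:E)%E); last first.
    apply: ge0_subset_integral => //; first exact: measurable_sqrE.
    by move=> x _; rewrite lee_fin sqr_ge0.
  rewrite le_eqVlt; apply/orP; left; apply/eqP; apply: eq_integral => x; rewrite inE => Dx.
  have -> : mollify e f x = 0 by exact: H (test_mollifier e0 (inner_ball Dx e0 ek)).
  by rewrite gee0_abs ?lee_fin ?sqr_ge0// sub0r sqrrN.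
have /(ae_eq_integral_abs mu mI mf2) := I0.
apply: filterS => x /[apply] /= -[] /eqP.
by rewrite sqrf_eq0 => /eqP.
Qed.

End mollification.

(** * The divergence identity behind the Carleman estimate *)
Section carleman_identity.
Context {R : realType} {n : nat}.
Local Notation V := 'rV[R]_n.
Local Notation "''e_' i" := (delta_mx 0 i : V) (at level 8, i at level 2).
Implicit Types (x y z : V) (D K : set V) (f g h : V -> R) (i j k l : 'I_n).

Lemma is_pderivZ (c : R) f x v df : is_derive x v f df ->
  is_derive x v (fun y => c * f y) (c * df).
Proof. by move=> H; exact: is_deriveZ. Qed.

Lemma pderivP D f i x : Ck_on D 1 f -> D x -> is_derive x 'e_i f (partial i f x).
Proof. by move=> Hf Dx; apply/derivableP; exact: (Ck_on_derivable Hf Dx). Qed.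

Lemma partialE f i x d : is_derive x 'e_i f d -> partial i f x = d.
Proof. by case. Qed.

Variables (D : set V) (oD : open D).
Variables (a : 'I_n -> 'I_n -> V -> R) (X : 'I_n -> V -> R) (G B w : V -> R).
Hypothesis Ha : forall k l, Ck_on D 1 (a k l).
Hypothesis symA : forall k l x, D x -> a k l x = a l k x.
Hypothesis HX : forall k, Ck_on D 1 (X k).
Hypothesis HG : Ck_on D 1 G.
Hypothesis HB : Ck_on D 1 B.
Hypothesis Hw : Ck_on setT 2 w.
Variable tau : R.

Definition flux (u : V -> R) k y : R := \sum_l a k l y * partial l u y.
Definition drift y : R := \sum_j X j y * partial j w y.
Definition energy y : R := \sum_k flux w k y * partial k w y.

(** With S = div (a grad w) + tau^2 G w and T = -2 tau X . grad w - tau B w, this is the vector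
field whose divergence remains when 2 S T is integrated by parts. The choice of B redistributes
positivity between the terms in grad w and in w. *)
Definition carleman_field k y : R :=
  (-4 * tau) * (flux w k y * drift y) + ((2 * tau) * (X k y * energy y) +
  ((-2 * tau ^+ 3) * (G y * (X k y * (w y * w y))) +
   (-2 * tau) * (B y * (w y * flux w k y)))).

Lemma Ck_flux u k : Ck_on setT 2 u -> Ck_on D 1 (flux u k).
Proof.
move=> Hu; apply: Ck_on_sum; first exact: oD.
move=> l; apply: (Ck_onM oD (Ha k l)).
exact: Ck_on_subset (Ck_on_partial l Hu).
Qed.

Let Hw1 k : Ck_on D 1 (partial k w).
Proof. exact: Ck_on_subset (Ck_on_partial k Hw). Qed.

Let HwD : Ck_on D 1 w.
Proof. by apply: Ck_on_subset; exact: Ck_onW Hw. Qed.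

Lemma Ck_drift : Ck_on D 1 drift.
Proof.
apply: Ck_on_sum; first exact: oD.
by move=> j; exact: (Ck_onM oD (HX j) (Hw1 j)).
Qed.

Lemma Ck_energy : Ck_on D 1 energy.
Proof.
apply: Ck_on_sum; first exact: oD.
by move=> k; exact: (Ck_onM oD (Ck_flux k Hw) (Hw1 k)).
Qed.

Lemma Ck_carleman_field k : Ck_on D 1 (carleman_field k).
Proof.
have Hf := Ck_flux k Hw.
apply: (Ck_onD oD); first exact: (Ck_onZ _ oD (Ck_onM oD Hf Ck_drift)).
apply: (Ck_onD oD); first exact: (Ck_onZ _ oD (Ck_onM oD (HX k) Ck_energy)).
apply: (Ck_onD oD); first exact: (Ck_onZ _ oD (Ck_onM oD HG (Ck_onM oD (HX k) (Ck_onM oD HwD HwD)))).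
exact: (Ck_onZ _ oD (Ck_onM oD HB (Ck_onM oD HwD Hf))).
Qed.

Lemma partial_flux u k i x : Ck_on setT 2 u -> D x ->
  partial i (flux u k) x = \sum_l (a k l x * partial i (partial l u) x + partial i (a k l) x * partial l u x).
Proof.
move=> Hu Dx.
have Hu1 l : Ck_on D 1 (partial l u) by exact: Ck_on_subset (Ck_on_partial l Hu).
apply: partialE; apply: is_pderiv_sum => l; apply: is_derive_eq.
  by apply: is_pderivM; [exact: pderivP (Ha k l) Dx|exact: pderivP (Hu1 l) Dx].
by rewrite /= [X in _ + X]mulrC.
Qed.

Lemma partial_drift i x : D x ->
  partial i drift x = \sum_j (X j x * partial i (partial j w) x + partial i (X j) x * partial j w x).
Proof.
move=> Dx; apply: partialE; apply: is_pderiv_sum => l; apply: is_derive_eq.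
  by apply: is_pderivM; [exact: pderivP (HX l) Dx|exact: pderivP (Hw1 l) Dx].
by rewrite /= [X in _ + X]mulrC.
Qed.

Lemma partial_energy i x : D x ->
  partial i energy x = \sum_k \sum_l partial i (a k l) x * partial k w x * partial l w x +
     2 * \sum_k flux w k x * partial i (partial k w) x.
Proof.
move=> Dx.
have -> : partial i energy x = \sum_k (flux w k x * partial i (partial k w) x + partial i (flux w k) x
    * partial k w x).
  apply: partialE; apply: is_pderiv_sum => k; apply: is_derive_eq.
    by apply: is_pderivM; [exact: pderivP (Ck_flux k Hw) Dx|exact: pderivP (Hw1 k) Dx].
  by rewrite /= [X in _ + X]mulrC.
rewrite big_split /=.
have -> : \sum_k partial i (flux w k) x * partial k w x =
  \sum_k flux w k x * partial i (partial k w) x + \sum_k \sum_l partial i (a k l) x * partial k w x *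
      partial l w x.
  have -> : \sum_k flux w k x * partial i (partial k w) x =
      \sum_k \sum_l a k l x * partial i (partial l w) x * partial k w x.
    under eq_bigr do rewrite /flux mulr_suml.
    rewrite exchange_big /=; apply: eq_bigr => k _; apply: eq_bigr => l _.
    by rewrite symA//; ring.
  rewrite -big_split /=; apply: eq_bigr => k _.
  rewrite partial_flux// mulr_suml -big_split /=; apply: eq_bigr => l _; ring.
by rewrite mulr2n mulrDl mul1r; ring.
Qed.

Lemma partial_carleman_field k x : D x ->
  partial k (carleman_field k) x =
  (-4 * tau) * (flux w k x * partial k drift x + partial k (flux w k) x * drift x) +
  (2 * tau) * (X k x * partial k energy x + partial k (X k) x * energy x) +
  (-2 * tau ^+ 3) * (partial k G x * X k x * w x ^+ 2 + G x * partial k (X k) x * w x ^+ 2 +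
     2 * G x * w x * (X k x * partial k w x)) +
  (-2 * tau) * (w x * (partial k B x * flux w k x) + B x * (flux w k x * partial k w x) + B x * w x *
      partial k (flux w k) x).
Proof.
move=> Dx; apply: partialE.
have h1 := pderivP k (Ck_flux k Hw) Dx.
have h2 := pderivP k Ck_drift Dx.
have h3 := pderivP k Ck_energy Dx.
have h4 := pderivP k (HX k) Dx.
have h5 := pderivP k HG Dx.
have h6 := pderivP k HB Dx.
have h7 := pderivP k HwD Dx.
have H := is_pderivD (is_pderivZ (-4 * tau) (is_pderivM h1 h2))
  (is_pderivD (is_pderivZ (2 * tau) (is_pderivM h4 h3))
  (is_pderivD (is_pderivZ (-2 * tau ^+ 3) (is_pderivM h5 (is_pderivM h4 (is_pderivM h7 h7))))
     (is_pderivZ (-2 * tau) (is_pderivM h6 (is_pderivM h7 h1))))).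
apply: (is_derive_eq H).
ring.
Qed.

(** The second derivatives of w occur in flux . grad (drift) and in X . grad (energy). These
contributions cancel, by the symmetry of a and of the Hessian, and what is left is quadratic in
(w, grad w), apart from the divergence. *)
Lemma carleman_identity x : D x ->
  let dA := \sum_k partial k (flux w k) x in
  let dX := \sum_k partial k (X k) x in
  let S := dA + tau ^+ 2 * G x * w x in
  let T := -2 * tau * drift x - tau * B x * w x in
  2 * S * T = \sum_k partial k (carleman_field k) x +
   2 * tau * (2 * (\sum_k flux w k x * \sum_j partial k (X j) x * partial j w x)
       - \sum_j X j x * (\sum_k \sum_l partial j (a k l) x * partial k w x * partial l w x)
       + (B x - dX) * energy x) +
   2 * tau ^+ 3 * (\sum_j X j x * partial j G x + G x * dX - B x * G x) * w x ^+ 2 +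
   2 * tau * w x * \sum_k partial k B x * flux w k x.
Proof.
move=> Dx dA dX S T.
have E : \sum_k partial k (carleman_field k) x =
  (-4 * tau) * ((\sum_k flux w k x * \sum_j partial k (X j) x * partial j w x) +
     (\sum_k flux w k x * \sum_j X j x * partial k (partial j w) x) + dA * drift x) +
  (2 * tau) * ((\sum_j X j x * (\sum_k \sum_l partial j (a k l) x * partial k w x * partial l w x)) +
     2 * (\sum_j X j x * \sum_k flux w k x * partial j (partial k w) x) + dX * energy x) +
  (-2 * tau ^+ 3) * ((\sum_j X j x * partial j G x) * w x ^+ 2 + G x * dX * w x ^+ 2 + 2 * G x * w x *
      (\sum_j X j x * partial j w x)) +
  (-2 * tau) * (w x * (\sum_k partial k B x * flux w k x) + B x * (\sum_k flux w k x * partial k w x) +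
      B x * w x * dA).
  rewrite /dA /dX.
  rewrite !(mulr_suml, mulr_sumr) -!big_split /= !(mulr_suml, mulr_sumr) -!big_split /=.
  apply: eq_bigr => k _; rewrite partial_carleman_field// partial_drift// partial_energy//.
  rewrite big_split /=; ring.
have sw : \sum_k flux w k x * (\sum_j X j x * partial k (partial j w) x) =
   \sum_j X j x * \sum_k flux w k x * partial j (partial k w) x.
  under eq_bigr do rewrite mulr_sumr.
  rewrite exchange_big /=; apply: eq_bigr => j _; rewrite mulr_sumr; apply: eq_bigr => k _.
  by rewrite (schwarz k j)//; ring.
rewrite E sw -/(drift x) -/(energy x) /S /T; ring.
Qed.

End carleman_identity.

(** * Absorption of the error terms *)
Section carleman_arith.
Context {R : realType}.

(** The values at one point of the quantities in the estimate: p is phi, pm its lower bound,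
q = lam phi, g0 = a grad psi . grad psi, W = |grad w|^2 = s^2, en = a grad w . grad w, dv the
divergence, F the conjugated operator applied to w. The terms with a factor lam are the positive
ones: lam large makes them dominate the errors M1 and M2, which do not depend on lam. The errors
C3 and C4 depend on lam but have a lower power of tau, so that tau large absorbs them. *)
Lemma carleman_arith (tau lam p pm q theta gm M1 M2 C3 C4 S T dv yw t1 t2 g0 dY en e2 e3 W s w gam F : R) :
  1 <= tau -> 1 <= lam -> 0 < pm -> pm <= p -> p <= 1 -> q = lam * p -> 0 < theta -> 0 < gm ->
  0 <= M1 -> 0 <= C3 -> 0 <= C4 -> 0 <= s -> W = s ^+ 2 ->
  `|2 * t1 - t2 - dY * en| <= M1 * s ^+ 2 -> `|e2| <= M2 -> `|e3| <= C3 * s -> `|gam| <= C4 ->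
  theta * W <= en -> gm <= g0 -> M1 + 1 <= lam * gm * theta -> M2 + 1 <= lam * gm ^+ 2 ->
  2 * S * T = dv + 2 * tau * (q * (2 * lam * yw ^+ 2 + 2 * t1 - t2 + (lam * g0 - dY) * en)) +
     2 * tau ^+ 3 * (q ^+ 3 * (lam * g0 ^+ 2 + e2)) * w ^+ 2 + 2 * tau * w * e3 ->
  F = S + T + tau * gam * w ->
  2 * (C3 ^+ 2 / pm ^+ 3 + C4 ^+ 2) / pm ^+ 3 <= tau ->
  dv + pm ^+ 3 * (tau * W + tau ^+ 3 * w ^+ 2) <= 2 * F ^+ 2.
Proof.
move=> tau1 lam1 pm0 pmp p1 qE th0 gm0 M10 C30 C40 s0 WE H1 H2 H3 H4 Hen Hg0 Hl1 Hl2 HST FE Htau.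
have tau0 : 0 < tau by lra.
have lam0 : 0 < lam by lra.
have W0 : 0 <= W by rewrite WE sqr_ge0.
pose A1 := 2 * lam * yw ^+ 2 + 2 * t1 - t2 + (lam * g0 - dY) * en.
have hA1 : W <= A1.
  have h1 : - (M1 * W) <= 2 * t1 - t2 - dY * en.
    by rewrite WE lerNl (le_trans _ H1)// -normrN ler_norm.
  have h2 : 0 <= 2 * lam * yw ^+ 2 by rewrite mulr_ge0 ?sqr_ge0// mulr_ge0// ltW.
  have h3 : (M1 + 1) * W <= lam * g0 * en.
    apply: (@le_trans _ _ (lam * gm * theta * W)); first exact: ler_wpM2r.
    rewrite -!mulrA ler_pM2l//; apply: ler_pM => //; first exact: ltW.
    by rewrite mulr_ge0// ltW.
  have -> : A1 = 2 * lam * yw ^+ 2 + (2 * t1 - t2 - dY * en) + lam * g0 * en by rewrite /A1; ring.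
  lra.
have qpm : pm <= q.
  rewrite qE; apply: (le_trans pmp); rewrite ler_peMl//.
  exact: (le_trans (ltW pm0)).
have q0 : 0 < q by lra.
have pm1 : pm <= 1 by lra.
have pm3 : 0 < pm ^+ 3 by rewrite exprn_gt0.
have pm3le : pm ^+ 3 <= pm by rewrite -[leRHS]expr1 ler_wiXn2l// ltW.
have hQ1 : pm ^+ 3 * W <= q * A1.
  apply: (@le_trans _ _ (pm * W)); first exact: ler_wpM2r.
  by apply: ler_pM => //; exact: ltW.
have hQ2 : pm ^+ 3 <= q ^+ 3 * (lam * g0 ^+ 2 + e2).
  apply: (@le_trans _ _ (q ^+ 3 * 1)); first by rewrite mulr1 lerXn2r// nnegrE ltW.
  rewrite ler_pM2l ?exprn_gt0//.
  have h : lam * gm ^+ 2 <= lam * g0 ^+ 2.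
    by rewrite ler_pM2l// lerXn2r// nnegrE ltW// (lt_le_trans gm0).
  have : - M2 <= e2 by rewrite lerNl (le_trans _ H2)// -normrN ler_norm.
  lra.
(* Young's inequality, with a quarter of the lower bound hQ1 for the gradient term *)
have hQ3 : - (pm ^+ 3 / 4 * W + C3 ^+ 2 / pm ^+ 3 * w ^+ 2) <= w * e3.
  have h1 : - (`|w| * (C3 * s)) <= w * e3.
    rewrite lerNl -mulNr; apply: (le_trans (ler_norm _)).
    by rewrite normrM normrN ler_wpM2l.
  apply: le_trans h1; rewrite lerN2 WE.
  rewrite -subr_ge0 (_ : _ - _ = (pm ^+ 3)^-1 * (pm ^+ 3 / 2 * s - C3 * `|w|) ^+ 2).
    by rewrite mulr_ge0 ?sqr_ge0// invr_ge0 ltW.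
  rewrite -(real_normK (num_real w)); field; exact: lt0r_neq0.
set c0 := pm ^+ 3 in pm3 pm3le hQ1 hQ2 hQ3 Htau *.
set D3 := C3 ^+ 2 / c0 in hQ3 Htau.
have h2ST : dv + 2 * tau * (c0 * W) + 2 * tau ^+ 3 * c0 * w ^+ 2 - 2 * tau * (c0 / 4 * W + D3 * w ^+ 2)
    <= 2 * S * T.
  rewrite HST -/A1.
  have t0 : 0 <= 2 * tau by lra.
  have t3 : 0 <= 2 * tau ^+ 3 by rewrite mulr_ge0// exprn_ge0// ltW.
  have w2 : 0 <= w ^+ 2 by rewrite sqr_ge0.
  have u1 := ler_wpM2l t0 hQ1.
  have u2 := ler_wpM2r w2 (ler_wpM2l t3 hQ2).
  have u3 := ler_wpM2l t0 hQ3.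
  have -> : 2 * tau * w * e3 = 2 * tau * (w * e3) by ring.
  rewrite mulrN in u3; lra.
have hF : 2 * S * T <= 2 * F ^+ 2 + 2 * tau ^+ 2 * C4 ^+ 2 * w ^+ 2.
  have g2 : gam ^+ 2 <= C4 ^+ 2 by rewrite -real_normK ?num_real// ler_sqr ?nnegrE.
  have : tau ^+ 2 * w ^+ 2 * gam ^+ 2 <= tau ^+ 2 * w ^+ 2 * C4 ^+ 2.
    by rewrite ler_wpM2l// mulr_ge0// sqr_ge0.
  have e1 : 0 <= S ^+ 2 by exact: sqr_ge0.
  have e4 : 0 <= T ^+ 2 by exact: sqr_ge0.
  have e5 : 0 <= (F + tau * gam * w) ^+ 2 by exact: sqr_ge0.
  have -> : 2 * S * T = (F - tau * gam * w) ^+ 2 - S ^+ 2 - T ^+ 2 by rewrite FE; ring.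
  rewrite (_ : (F - tau * gam * w) ^+ 2 = 2 * F ^+ 2 + 2 * (tau ^+ 2 * w ^+ 2 * gam ^+ 2) - (F + tau *
      gam * w) ^+ 2); last by ring.
  lra.
have hfin : 2 * tau * D3 + 2 * tau ^+ 2 * C4 ^+ 2 <= tau ^+ 3 * c0.
  have D30 : 0 <= D3 by rewrite divr_ge0// ?sqr_ge0// ltW.
  have C42 : 0 <= C4 ^+ 2 by rewrite sqr_ge0.
  apply: (@le_trans _ _ (tau ^+ 2 * (2 * (D3 + C4 ^+ 2)))).
    have : tau * D3 <= tau ^+ 2 * D3 by rewrite ler_wpM2r// expr2 ler_peMl// ltW.
    lra.
  rewrite (_ : tau ^+ 3 * c0 = tau ^+ 2 * (tau * c0)); last by ring.
  rewrite ler_pM2l ?exprn_gt0//.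
  by rewrite -ler_pdivrMr.
have w2 : 0 <= w ^+ 2 by rewrite sqr_ge0.
have hfin2 := ler_wpM2r w2 hfin.
have tW : 0 <= tau * (c0 * W) by rewrite mulr_ge0 ?mulr_ge0// ltW.
have {}h2ST := le_trans h2ST hF.
have -> : c0 * (tau * W + tau ^+ 3 * w ^+ 2) = tau * (c0 * W) + tau ^+ 3 * c0 * w ^+ 2 by ring.
have e1 : 2 * tau * (c0 / 4 * W + D3 * w ^+ 2) = tau * (c0 * W) / 2 + 2 * tau * D3 * w ^+ 2 by field.
have e2' : 2 * tau * (c0 * W) = 2 * (tau * (c0 * W)) by ring.
have e3' : 2 * tau ^+ 3 * c0 * w ^+ 2 = 2 * (tau ^+ 3 * c0 * w ^+ 2) by ring.
rewrite e1 e2' e3' in h2ST.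
rewrite mulrDl in hfin2; lra.
Qed.

Lemma sum_bound n (F : 'I_n -> R) (C : R) : (forall i, `|F i| <= C) ->
  `|\sum_i F i| <= n%:R * C.
Proof.
move=> H; apply: le_trans (ler_norm_sum _ _ _) _.
apply: le_trans (ler_sum _ (fun i _ => H i)) _.
by rewrite sumr_const card_ord mulr_natl.
Qed.

Lemma normM_bound (x y A B : R) : `|x| <= A -> `|y| <= B -> `|x * y| <= A * B.
Proof. by move=> hx hy; rewrite normrM; apply: ler_pM. Qed.

End carleman_arith.

(** * The Carleman estimate for functions of class C^2 *)
Section carleman_estimate.
Context {R : realType} {n : nat}.
Local Notation V := 'rV[R]_n.
Local Notation mu := (lebesgue_rV R n).
Local Notation "''e_' i" := (delta_mx 0 i : V) (at level 8, i at level 2).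
Implicit Types (x y z : V) (D K : set V) (f g h : V -> R) (i j k l : 'I_n).

Lemma partial_sqnB y k x : derivable (fun x => sqn (x - y)) x 'e_k /\
  partial k (fun x => sqn (x - y)) x = 2 * (x 0 k - y 0 k).
Proof.
have H z : is_derive z 'e_k (sqn : V -> R) (2 * z 0 k).
  apply: is_derive_eq.
    apply: (@is_pderiv_sum _ _ _ _ (fun i (z : V) => z 0 i * z 0 i) (fun i =>
        z 0 i * ('e_k) 0 i + z 0 i * ('e_k) 0 i)) => i.
    exact: (is_pderivM (is_derive_coord i z 'e_k) (is_derive_coord i z 'e_k)).
  rewrite (bigD1 k)//= big1 ?addr0; last first.
    by move=> i ik; rewrite mxE (negbTE ik) !mulr0 addr0.
  by rewrite mxE !eqxx mulr1; ring.
split.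
  by apply: (@Ck_on_derivable _ _ setT 0) => //; apply: Ck_on_shift; exact: Ck_on_sqn.
by rewrite partial_shift (partialE (H _)) !mxE.
Qed.

Lemma Ck_onU D D' (m : nat) f : Ck_on D m f -> Ck_on D' m f -> Ck_on (D `|` D') m f.
Proof.
move=> H H' s sk; have [c d] := H s sk; have [c' d'] := H' s sk; split.
  by move=> x [/c|/c'].
by move=> sk' i x [|]; [exact: d|exact: d'].
Qed.

(** D and the complement of K are open and cover the space. *)
Lemma Ck_on_extend D K (m : nat) f : closed K -> K `<=` D -> supp_in K f -> Ck_on D m f ->
  Ck_on setT m f.
Proof.
move=> cK KD sf Hf.
have oK : open (~` K) by rewrite openC.
have H0 : Ck_on (~` K) m f.
  apply: (@Ck_on_ext _ _ (~` K) m (fun=> 0) f oK); last exact: Ck_on_cst.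
  by move=> x Kx; rewrite sf.
have -> : [set: V] = D `|` ~` K.
  by apply/seteqP; split => // x _; have [/KD|] := pselect (K x); [left|right].
exact: Ck_onU.
Qed.

Variables (D K : set V) (oD : open D) (cK : compact K) (KD : K `<=` D).
Variables (a : 'I_n -> 'I_n -> V -> R) (theta : R) (x0 : V) (rho : R).
Hypothesis Ha : forall k l, Ck_on D 1 (a k l).
Hypothesis symA : forall k l x, D x -> a k l x = a l k x.
Hypothesis theta0 : 0 < theta.
Hypothesis ellA : forall x (xi : 'I_n -> R), K x ->
  theta * \sum_k xi k ^+ 2 <= \sum_k \sum_l a k l x * xi l * xi k.
Hypothesis rho0 : 0 < rho.
Hypothesis Krho : forall x, K x -> rho <= sqn (x - x0).

(** With psi x = - |x - x0|^2 and phi = exp (lam psi): b = grad psi, Y = a grad psi,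
g0 = a grad psi . grad psi, q = lam phi, X = a grad phi, G = a grad phi . grad phi, and
B = 2 lam^2 phi g0. This B exceeds the leading part lam^2 phi g0 of div X, which makes the
gradient term positive, and it is less than three times this part, which keeps the term in w^2
positive. *)
Let b k x : R := -2 * (x 0 k - x0 0 k).
Let Y j x : R := \sum_l a j l x * b l x.
Let g0 x : R := \sum_j Y j x * b j x.

Definition cweight (lam : R) x : R := expR (lam * - sqn (x - x0)).

Let q lam x : R := lam * cweight lam x.
Let X lam j x : R := q lam x * Y j x.
Let G lam x : R := q lam x * (q lam x * g0 x).
Let B lam x : R := 2 * lam * (q lam x * g0 x).

Let Cb k m : Ck_on D m (b k).
Proof.
apply: (Ck_onZ _ oD); apply: (Ck_onB oD); first exact: Ck_on_coord.
exact: Ck_on_cst.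
Qed.

Let CY j : Ck_on D 1 (Y j).
Proof.
apply: Ck_on_sum; first exact: oD.
by move=> l; apply: (Ck_onM oD); [exact: Ha|exact: Cb].
Qed.

Let Cg0 : Ck_on D 1 g0.
Proof.
apply: Ck_on_sum; first exact: oD.
by move=> l; apply: (Ck_onM oD); [exact: CY|exact: Cb].
Qed.

Lemma Ck_cweight lam m : Ck_on setT m (cweight lam).
Proof.
apply: (Ck_on_chain (H := fun=> expR) 0%N); first exact: openT.
apply: (Ck_onZ _ openT).
rewrite (_ : (fun x => - _) = (fun x => -1 * sqn (x - x0))); last by apply/funext => x; rewrite mulN1r.
apply: (Ck_onZ _ openT); apply: Ck_on_shift; exact: Ck_on_sqn.
Qed.

Let Cq lam : Ck_on D 1 (q lam).
Proof. by apply: (Ck_onZ _ oD); apply: Ck_on_subset; exact: Ck_cweight. Qed.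

Let CX lam j : Ck_on D 1 (X lam j).
Proof. exact: (Ck_onM oD (Cq lam) (CY j)). Qed.

Let CG lam : Ck_on D 1 (G lam).
Proof. exact: (Ck_onM oD (Cq lam) (Ck_onM oD (Cq lam) Cg0)). Qed.

Let CB lam : Ck_on D 1 (B lam).
Proof. exact: (Ck_onZ _ oD (Ck_onM oD (Cq lam) Cg0)). Qed.

Lemma partial_cweight lam k x : derivable (cweight lam) x 'e_k /\
  partial k (cweight lam) x = lam * cweight lam x * b k x.
Proof.
have [d1 p1] := partial_sqnB x0 k x.
have H := is_derive_chain (f := fun y => lam * (-1 * sqn (y - x0)))
  (is_derive_expR (lam * (-1 * sqn (x - x0)))) (is_pderivZ lam (is_pderivZ (-1) (derivableP d1))).
have E : cweight lam = fun y => expR (lam * (-1 * sqn (y - x0))).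
  by apply/funext => y; rewrite /cweight mulN1r.
have H' : is_derive x 'e_k (cweight lam) (lam * cweight lam x * b k x).
  rewrite E; apply: (is_derive_eq H).
  by move: p1; rewrite /partial => ->; rewrite /b /cweight mulN1r; ring.
by split; [exact: ex_derive|exact: partialE].
Qed.

Let pq lam k x : is_derive x 'e_k (q lam) (lam * b k x * q lam x).
Proof.
have [d1 p1] := partial_cweight lam k x.
apply: (is_derive_eq (is_pderivZ lam (derivableP d1))).
by rewrite -[X in lam * X]/(partial k (cweight lam) x) p1 /q; ring.
Qed.

Let pX lam j k x : D x -> partial k (X lam j) x = q lam x * (lam * b k x * Y j x + partial k (Y j) x).
Proof.
move=> Dx; apply: partialE.
apply: (is_derive_eq (is_pderivM (pq lam k x) (pderivP k (CY j) Dx))); ring.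
Qed.

Let pB lam k x : D x -> partial k (B lam) x = 2 * lam * (q lam x * (lam * b k x * g0 x + partial k g0 x)).
Proof.
move=> Dx; apply: partialE.
apply: (is_derive_eq (is_pderivZ (2 * lam) (is_pderivM (pq lam k x) (pderivP k Cg0 Dx)))); ring.
Qed.

Let pG lam k x : D x -> partial k (G lam) x = q lam x ^+ 2 * (2 * lam * b k x * g0 x + partial k g0 x).
Proof.
move=> Dx; apply: partialE.
apply: (is_derive_eq (is_pderivM (pq lam k x) (is_pderivM (pq lam k x) (pderivP k Cg0 Dx)))); ring.
Qed.

Let ubound (I : finType) (F : I -> V -> R) : (forall c : I, Ck_on D 0 (F c)) ->
  exists2 M : R, 0 < M & forall (c : I) x, K x -> `|F c x| <= M.
Proof.
move=> HF; apply: (compact_family_bounded cK) => c x Kx.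
by apply: (Ck_on_cont (HF c)); exact: KD.
Qed.

Let bounds : exists2 M : R, 0 < M & forall x, K x ->
  (forall k l, `|a k l x| <= M) /\ (forall j k l, `|partial j (a k l) x| <= M) /\
  (forall k, `|b k x| <= M) /\ (forall k, `|Y k x| <= M) /\
  (forall j k, `|partial j (Y k) x| <= M) /\ `|g0 x| <= M /\
  (forall k, `|partial k g0 x| <= M) /\ sqn (x - x0) <= M.
Proof.
have [M1 p1 H1] := ubound (I := ('I_n * 'I_n)%type) (F := fun c => a c.1 c.2) (fun c =>
    Ck_onW (leq0n 1%N) (Ha _ _)).
have [M2 p2 H2] := ubound (I := ('I_n * 'I_n * 'I_n)%type) (F := fun c =>
    partial c.1.1 (a c.1.2 c.2)) (fun c => Ck_on_partial _ (Ha _ _)).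
have [M3 p3 H3] := ubound (I := 'I_n) (F := b) (fun c => @Cb c 0%N).
have [M4 p4 H4] := ubound (I := 'I_n) (F := Y) (fun c => Ck_onW (leq0n 1%N) (CY c)).
have [M5 p5 H5] := ubound (I := ('I_n * 'I_n)%type) (F := fun c => partial c.1 (Y c.2)) (fun c =>
    Ck_on_partial _ (CY _)).
have [M6 p6 H6] := ubound (I := unit) (F := fun=> g0) (fun=> Ck_onW (leq0n 1%N) Cg0).
have [M7 p7 H7] := ubound (I := 'I_n) (F := fun c => partial c g0) (fun c => Ck_on_partial _ Cg0).
have [M8 p8 H8] := ubound (I := unit) (F := fun=> fun x =>
    sqn (x - x0)) (fun=> Ck_on_subset D (Ck_on_shift x0 (@Ck_on_sqn _ _ 0))).
exists (M1 + M2 + M3 + M4 + M5 + M6 + M7 + M8); first by rewrite !addr_gt0.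
move=> x Kx.
do !split.
- by move=> k l; apply: (le_trans (H1 (k, l) x Kx)); lra.
- by move=> j k l; apply: (le_trans (H2 (j, k, l) x Kx)); lra.
- by move=> k; apply: (le_trans (H3 k x Kx)); lra.
- by move=> k; apply: (le_trans (H4 k x Kx)); lra.
- by move=> j k; apply: (le_trans (H5 (j, k) x Kx)); lra.
- by apply: (le_trans (H6 tt x Kx)); lra.
- by move=> k; apply: (le_trans (H7 k x Kx)); lra.
- by apply: (le_trans (ler_norm _)); apply: (le_trans (H8 tt x Kx)); lra.
Qed.

Lemma cweight_le1 lam x : 0 <= lam -> cweight lam x <= 1.
Proof.
move=> l0; rewrite /cweight expR_le1 mulrN oppr_le0 mulr_ge0//; exact: sqn_ge0.
Qed.

(** This is e^(tau phi) div (a grad (e^(- tau phi) w)), see [conj_opE]. *)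
Let conj_op lam tau w x : R := \sum_k partial k (flux a w k) x - 2 * tau * (\sum_j X lam j x * partial j w x)
   + tau ^+ 2 * G lam x * w x - tau * (\sum_j partial j (X lam j) x) * w x.

(** The identity for 2 S T is bounded from below by [carleman_arith]. All other quantities are
bounded by polynomials in the bounds of the coefficients over K, in n and in lam; ellipticity and the
lower bound rho of |x - x0|^2 bound g0 from below. *)
Lemma carleman_pointwise : exists lam c tau0 : R, [/\ 0 < lam, 0 < c, 1 <= tau0 &
  forall tau, tau0 <= tau -> forall w, Ck_on setT 2 w -> forall x, K x ->
   \sum_k partial k (carleman_field a (X lam) (G lam) (B lam) w tau k) x +
   c * (tau * \sum_k (partial k w x) ^+ 2 + tau ^+ 3 * w x ^+ 2) <=
   2 * conj_op lam tau w x ^+ 2].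
Proof.
have [M M0 HM] := bounds.
pose N : R := n%:R.
have N0 : 0 <= N by [].
pose gm := theta * (4 * rho).
have gm0 : 0 < gm by rewrite !mulr_gt0.
(* M1 and M2 bound the error terms that do not involve lam; lam is chosen after them *)
pose M1 : R := 4 * N ^+ 3 * M ^+ 2.
pose M2 : R := 2 * N * M ^+ 2.
have M10 : 0 <= M1 by rewrite !mulr_ge0// ?exprn_ge0// ltW.
have M20 : 0 <= M2 by rewrite !mulr_ge0// ?exprn_ge0// ltW.
pose lam : R := 1 + (M1 + 1) / (gm * theta) + (M2 + 1) / gm ^+ 2.
have l1 : 0 <= (M1 + 1) / (gm * theta) by rewrite divr_ge0 ?addr_ge0// mulr_ge0// ltW.
have l2 : 0 <= (M2 + 1) / gm ^+ 2 by rewrite divr_ge0 ?addr_ge0// exprn_ge0// ltW.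
have lam1 : 1 <= lam by rewrite /lam -addrA lerDl addr_ge0.
have lam0 : 0 < lam by apply: lt_le_trans lam1.
have Hl1 : M1 + 1 <= lam * gm * theta.
  rewrite -mulrA -ler_pdivrMr; last by rewrite mulr_gt0.
  by rewrite /lam; lra.
have Hl2 : M2 + 1 <= lam * gm ^+ 2.
  rewrite -ler_pdivrMr; last by rewrite exprn_gt0.
  by rewrite /lam; lra.
pose pm := expR (lam * - M).
have pm0 : 0 < pm by exact: expR_gt0.
(* C3 and C4 involve lam; tau is chosen after them *)
pose C3 : R := 2 * lam * (lam * (lam * M * (N ^+ 2 * M ^+ 2) + N ^+ 2 * M ^+ 2)).
pose C4 : R := lam * (lam * M + N * M).
have C30 : 0 <= C3.
  by do !(by [] || (by apply: ltW) || apply: mulr_ge0 || apply: addr_ge0 || apply: exprn_ge0).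
have C40 : 0 <= C4 by do !(by [] || (by apply: ltW) || apply: mulr_ge0 || apply: addr_ge0 || apply: exprn_ge0).
exists lam, (pm ^+ 3), (Num.max 1 (2 * (C3 ^+ 2 / pm ^+ 3 + C4 ^+ 2) / pm ^+ 3)).
split => //; [by rewrite exprn_gt0|by rewrite le_max lexx|].
move=> tau; rewrite ge_max => /andP[tau1 Htau] w Hw x Kx.
have Dx := KD Kx.
have [Ma [Mda [Mb [MY [MdY [Mg [Mdg Ms]]]]]]] := HM x Kx.
pose W := \sum_k (partial k w x) ^+ 2.
have W0 : 0 <= W by apply: sumr_ge0 => k _; exact: sqr_ge0.
pose s := Num.sqrt W.
have s0 : 0 <= s by exact: sqrtr_ge0.
have WE : W = s ^+ 2 by rewrite sqr_sqrtr.
have ws k : `|partial k w x| <= s.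
  rewrite -sqrtr_sqr; apply: ler_wsqrtr; rewrite /W (bigD1 k)//= lerDl.
  by apply: sumr_ge0 => j _; exact: sqr_ge0.
have Nb k : `|flux a w k x| <= N * (M * s) by apply: sum_bound => l; exact: normM_bound.
pose t1 := \sum_k flux a w k x * \sum_j partial k (Y j) x * partial j w x.
pose t2 := \sum_j Y j x * (\sum_k \sum_l partial j (a k l) x * partial k w x * partial l w x).
pose dY := \sum_k partial k (Y k) x.
pose en := energy a w x.
pose e2 := \sum_j Y j x * partial j g0 x + g0 x * dY.
pose bN := \sum_k b k x * flux a w k x.
pose gN := \sum_k partial k g0 x * flux a w k x.
pose e3 := 2 * lam * (q lam x * (lam * g0 x * bN + gN)).
pose yw := \sum_j Y j x * partial j w x.
have dYb : `|dY| <= N * M by apply: sum_bound => k.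
have enb : `|en| <= N * (N * (M * s) * s) by apply: sum_bound => k; exact: normM_bound.
have t1b : `|t1| <= N * (N * (M * s) * (N * (M * s))).
  apply: sum_bound => k; apply: normM_bound => //.
  by apply: sum_bound => j; exact: normM_bound.
have t2b : `|t2| <= N * (M * (N * (N * (M * s * s)))).
  apply: sum_bound => k; apply: normM_bound => //.
  apply: sum_bound => j; apply: sum_bound => l; apply: normM_bound => //; exact: normM_bound.
have dYen : `|dY * en| <= N * M * (N * (N * (M * s) * s)) by exact: normM_bound.
have H1 : `|2 * t1 - t2 - dY * en| <= M1 * s ^+ 2.
  apply: le_trans (ler_normB _ _) _.
  apply: le_trans (lerD (ler_normB _ _) (lexx _)) _.
  rewrite normrM ger0_norm//.
  have -> : M1 * s ^+ 2 = 2 * (N * (N * (M * s) * (N * (M * s)))) + N * (M * (N * (N * (M * s * s)))) +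
      N * M * (N * (N * (M * s) * s)) by rewrite /M1; ring.
  lra.
have H2 : `|e2| <= M2.
  apply: le_trans (ler_normD _ _) _.
  have -> : M2 = N * (M * M) + M * (N * M) by rewrite /M2; ring.
  apply: lerD; last exact: normM_bound.
  by apply: sum_bound => j; exact: normM_bound.
have p1 : cweight lam x <= 1 by apply: cweight_le1; exact: ltW.
have p0 : 0 < cweight lam x by exact: expR_gt0.
have ql : `|q lam x| <= lam by rewrite normrM !gtr0_norm// -[leRHS]mulr1 ler_pM2l.
have H3 : `|e3| <= C3 * s.
  have -> : C3 * s = 2 * lam * (lam * (lam * M * (N * (M * (N * (M * s)))) + N * (M * (N * (M * s)))))
      by rewrite /C3; ring.
  have ll : `|2 * lam| <= 2 * lam by rewrite ger0_norm// mulr_ge0// ltW.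
  have ll' : `|lam| <= lam by rewrite ger0_norm// ltW.
  apply: normM_bound => //; apply: normM_bound => //.
  apply: le_trans (ler_normD _ _) _; apply: lerD.
    apply: normM_bound; first exact: normM_bound.
    by apply: sum_bound => k; exact: normM_bound.
  by apply: sum_bound => k; exact: normM_bound.
pose gam := B lam x - \sum_j partial j (X lam j) x.
have dXE : \sum_j partial j (X lam j) x = q lam x * (lam * g0 x + dY).
  rewrite /dY /g0 mulr_sumr -big_split mulr_sumr; apply: eq_bigr => j _ /=.
  by rewrite pX//; ring.
have gamE : gam = q lam x * (lam * g0 x - dY) by rewrite /gam dXE /B; ring.
have H4 : `|gam| <= C4.
  rewrite gamE; apply: normM_bound => //.
  apply: le_trans (ler_normB _ _) _; apply: lerD => //.
  by apply: normM_bound => //; rewrite ger0_norm// ltW.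
have Hen : theta * W <= en.
  apply: (le_trans (ellA (fun k => partial k w x) Kx)).
  rewrite /en /energy /flux; apply: ler_sum => k _.
  by rewrite mulr_suml.
have Hg0 : gm <= g0 x.
  apply: (@le_trans _ _ (theta * \sum_k b k x ^+ 2)).
    rewrite /gm ler_pM2l// (_ : \sum_k _ = 4 * sqn (x - x0)).
      by rewrite ler_pM2l//; exact: Krho.
    by rewrite /sqn mulr_sumr; apply: eq_bigr => k _; rewrite /b !mxE; ring.
  apply: (le_trans (ellA (fun k => b k x) Kx)).
  by rewrite /g0 /Y; apply: ler_sum => k _; rewrite mulr_suml.
pose S := \sum_k partial k (flux a w k) x + tau ^+ 2 * G lam x * w x.
pose T := -2 * tau * drift (X lam) w x - tau * B lam x * w x.
pose dv := \sum_k partial k (carleman_field a (X lam) (G lam) (B lam) w tau k) x.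
have bNE : \sum_k flux a w k x * (b k x * yw) = yw * yw.
  have -> : \sum_k flux a w k x * (b k x * yw) = bN * yw.
    by rewrite /bN mulr_suml; apply: eq_bigr => k _; ring.
  congr (_ * _); rewrite /bN /yw /flux /Y.
  under eq_bigr do rewrite mulr_sumr.
  rewrite exchange_big /=; apply: eq_bigr => l _; rewrite mulr_suml; apply: eq_bigr => k _.
  by rewrite (symA k l Dx); ring.
have HST : 2 * S * T = dv + 2 * tau * (q lam x * (2 * lam * yw ^+ 2 + 2 * t1 - t2 + (lam * g0 x - dY) * en)) +
     2 * tau ^+ 3 * (q lam x ^+ 3 * (lam * g0 x ^+ 2 + e2)) * w x ^+ 2 + 2 * tau * w x * e3.
  rewrite /S /T (carleman_identity oD Ha symA (CX lam) (CG lam) (CB lam) Hw tau Dx) -/dv.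
  have -> : \sum_k flux a w k x * (\sum_j partial k (X lam j) x * partial j w x) =
      q lam x * (lam * yw ^+ 2 + t1).
    rewrite expr2 -bNE mulr_sumr /t1 -big_split mulr_sumr; apply: eq_bigr => k _ /=.
    have -> : \sum_j partial k (X lam j) x * partial j w x =
        q lam x * (lam * b k x * yw + \sum_j partial k (Y j) x * partial j w x).
      rewrite /yw [lam * b k x * _]mulr_sumr -big_split mulr_sumr.
      by apply: eq_bigr => j _ /=; rewrite pX//; ring.
    by ring.
  have -> : \sum_j X lam j x * (\sum_k \sum_l partial j (a k l) x * partial k w x * partial l w x) = q
      lam x * t2.
    by rewrite /t2 mulr_sumr; apply: eq_bigr => j _; rewrite /X; ring.
  have -> : \sum_j X lam j x * partial j (G lam) x = q lam x ^+ 3 * (2 * lam * g0 x ^+ 2 + \sum_j Y j x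
      * partial j g0 x).
    have -> : g0 x ^+ 2 = g0 x * \sum_j Y j x * b j x by rewrite expr2.
    rewrite !mulr_sumr -big_split /= mulr_sumr; apply: eq_bigr => j _ /=.
    by rewrite pG// /X; ring.
  have -> : \sum_k partial k (B lam) x * flux a w k x = e3.
    rewrite /e3 /bN /gN [lam * g0 x * _]mulr_sumr -big_split [q lam x * _]mulr_sumr [2 * lam * _]mulr_sumr.
    apply: eq_bigr => k _ /=.
    by rewrite pB//; ring.
  rewrite -/gam gamE dXE /B /G -/en /e2; ring.
apply: (carleman_arith (S := S) (T := T) (gam := gam) (q := q lam x) (p := cweight lam x) (theta :=
    theta) (gm := gm) (M1 := M1) (M2 := M2) (C3 := C3) (C4 := C4) (yw := yw) (t1 := t1) (t2 :=
    t2) (g0 := g0 x) (dY := dY) (en := en) (e2 := e2) (e3 := e3) (s := s)) HST _ _ => //.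
- by rewrite ler_expR ler_pM2l// lerN2.
- by rewrite /conj_op /S /T /gam /drift; ring.
Qed.

Let Ew lam tau y : R := expR (tau * cweight lam y).

Lemma Ck_Ew lam tau m : Ck_on setT m (Ew lam tau).
Proof.
apply: (Ck_on_chain (H := fun=> expR) 0%N); first exact: openT.
by apply: (Ck_onZ _ openT); exact: Ck_cweight.
Qed.

Let pE lam tau k x : is_derive x 'e_k (Ew lam tau) (tau * (q lam x * b k x) * Ew lam tau x).
Proof.
have [d1 p1] := partial_cweight lam k x.
have H := is_derive_chain (f := fun y => tau * cweight lam y)
  (is_derive_expR (tau * cweight lam x)) (is_pderivZ tau (derivableP d1)).
apply: (is_derive_eq H); move: p1; rewrite /partial => ->; rewrite /q /Ew; ring.
Qed.

Let fluxE lam tau v k : Ck_on setT 2 v -> flux a (fun y => Ew lam tau y * v y) k =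
  (fun y => Ew lam tau y * (flux a v k y + tau * (X lam k y * v y))).
Proof.
move=> Hv; apply/funext => y; rewrite /flux /X /Y.
rewrite [q lam y * _]mulr_sumr mulr_suml [tau * _]mulr_sumr -big_split /= [RHS]mulr_sumr.
apply: eq_bigr => l _.
have dv : derivable v y 'e_l by exact: (Ck_on_derivable Hv).
rewrite (partialE (is_pderivM (pE lam tau l y) (derivableP dv))) -/(partial l v y); ring.
Qed.

Lemma conj_opE lam tau v x : D x -> Ck_on setT 2 v ->
  conj_op lam tau (fun y => Ew lam tau y * v y) x =
  Ew lam tau x * \sum_k partial k (flux a v k) x.
Proof.
move=> Dx Hv.
have dv k : is_derive x 'e_k v (partial k v x) by apply/derivableP; exact: (Ck_on_derivable Hv).
have bX : \sum_k b k x * X lam k x = q lam x * g0 x.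
  by rewrite /X /g0 mulr_sumr; apply: eq_bigr => k _; ring.
have bf : \sum_k q lam x * b k x * flux a v k x = \sum_k X lam k x * partial k v x.
  rewrite /flux /X /Y; under eq_bigr do rewrite mulr_sumr.
  rewrite exchange_big /=; apply: eq_bigr => l _.
  rewrite mulr_sumr mulr_suml; apply: eq_bigr => k _.
  by rewrite (symA k l Dx); ring.
have fl k : partial k (flux a (fun y => Ew lam tau y * v y) k) x =
   Ew lam tau x * (partial k (flux a v k) x + tau * (X lam k x * partial k v x + partial k (X lam k) x * v x)
   + tau * (q lam x * b k x * flux a v k x) + tau ^+ 2 * q lam x * v x * (b k x * X lam k x)).
  rewrite fluxE//; apply: partialE.
  have H := is_pderivM (pE lam tau k x) (is_pderivD (pderivP k (Ck_flux oD Ha k Hv) Dx)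
     (is_pderivZ tau (is_pderivM (pderivP k (CX lam k) Dx) (dv k)))).
  by apply: (is_derive_eq H); ring.
have dr : \sum_j X lam j x * partial j (fun y => Ew lam tau y * v y) x =
   Ew lam tau x * (\sum_j X lam j x * partial j v x + tau * (q lam x * (q lam x * g0 x)) * v x).
  rewrite -bX !mulr_sumr mulr_suml -big_split !mulr_sumr; apply: eq_bigr => j _ /=.
  rewrite (partialE (is_pderivM (pE lam tau j x) (dv j))); ring.
have flS : \sum_k partial k (flux a (fun y => Ew lam tau y * v y) k) x =
   Ew lam tau x * (\sum_k partial k (flux a v k) x
   + tau * (\sum_k X lam k x * partial k v x + (\sum_k partial k (X lam k) x) * v x)
   + tau * (\sum_k X lam k x * partial k v x)
   + tau ^+ 2 * q lam x * v x * (q lam x * g0 x)).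
  transitivity (\sum_k Ew lam tau x * (partial k (flux a v k) x + tau * (X lam k x * partial k v x +
      partial k (X lam k) x * v x)
   + tau * (q lam x * b k x * flux a v k x) + tau ^+ 2 * q lam x * v x * (b k x * X lam k x))).
    by apply: eq_bigr => k _; exact: fl.
  rewrite -mulr_sumr; congr (_ * _).
  by rewrite !big_split /= -!mulr_sumr big_split /= bX -mulr_suml bf.
rewrite /conj_op [X in X - _ + _ - _]flS [X in _ - _ * X + _ - _]dr.
have -> : G lam x = q lam x * (q lam x * g0 x) by [].
move: (\sum_k partial k (flux a v k) x) (\sum_k X lam k x * partial k v x) (\sum_k partial k (X lam k) x).
move: (Ew lam tau x) (v x) (q lam x) (g0 x) => E0 v0 q0 g1 s1 s2 s3; ring.
Qed.

(** Integrate the pointwise estimate for w = e^(tau phi) v: the divergence has integral zero. The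
gradient of v is recovered from that of w at the cost of a term in tau^2 w^2, which the left-hand
side also controls. *)
Lemma carleman_integral : exists lam c tau0 : R, [/\ 0 < lam, 0 < c, 1 <= tau0 &
  forall tau, tau0 <= tau -> forall v, Ck_on setT 2 v -> supp_in K v ->
  let f1 x := c * (expR (tau * cweight lam x) ^+ 2 *
       (tau * \sum_k (partial k v x) ^+ 2 + tau ^+ 3 * v x ^+ 2)) in
  let f2 x := expR (tau * cweight lam x) ^+ 2 * (\sum_k partial k (flux a v k) x) ^+ 2 in
  [/\ L1 f1, L1 f2 & \int[mu]_x f1 x <= \int[mu]_x f2 x]].
Proof.
have [lam [c [tau0 [lam0 c0 tau01 H]]]] := carleman_pointwise.
have [M M0 HM] := bounds.
have clK : closed K by exact: compact_closed.
(* |grad phi|^2 <= lam^2 n M^2 on K, and the constant C5 makes up for the change from w to v *)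
pose C5 : R := 3 + 2 * lam ^+ 2 * (n%:R * M ^+ 2).
have C51 : 0 <= 2 * lam ^+ 2 * (n%:R * M ^+ 2).
  by rewrite mulr_ge0 ?mulr_ge0// ?sqr_ge0// ltW.
have C50 : 0 < C5 by rewrite /C5; lra.
exists lam, (c / (2 * C5)), tau0; split => //; first by rewrite divr_gt0// mulr_gt0.
move=> tau tauH v Hv sv.
have tau1 : 1 <= tau by exact: le_trans tauH.
have tau00 : 0 <= tau by lra.
pose w y := Ew lam tau y * v y.
have HE := Ck_Ew lam tau.
have Hw : Ck_on setT 2 w by exact: (Ck_onM openT (HE 2%N) Hv).
have sw : supp_in K w by move=> x /sv vx; rewrite /w vx mulr0.
have spv k : supp_in K (partial k v) by exact: supp_partial.
have spw k : supp_in K (partial k w) by exact: supp_partial.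
have sfv k : supp_in K (flux a v k).
  by move=> x Kx; rewrite /flux big1// => l _; rewrite spv// mulr0.
have sfw k : supp_in K (flux a w k).
  by move=> x Kx; rewrite /flux big1// => l _; rewrite spw// mulr0.
pose f1 x := c / (2 * C5) * (Ew lam tau x ^+ 2 * (tau * \sum_k (partial k v x) ^+ 2 + tau ^+ 3 * v x ^+ 2)).
pose f2 x := Ew lam tau x ^+ 2 * (\sum_k partial k (flux a v k) x) ^+ 2.
pose fd x := \sum_k partial k (carleman_field a (X lam) (G lam) (B lam) w tau k) x.
have pv k : Ck_on setT 0 (partial k v) by exact: (Ck_onW (leq0n 1%N) (Ck_on_partial k Hv)).
have L1f1 : L1 f1.
  apply: (csupp_L1 (K := K)) => //.
    apply: (@Ck_on_continuous _ _ 0).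
    apply: (Ck_onZ _ openT); apply: (Ck_onM openT).
      by under eq_fun do rewrite expr2; exact: (Ck_onM openT (HE 0%N) (HE 0%N)).
    apply: (Ck_onD openT).
      apply: (Ck_onZ _ openT); apply: Ck_on_sum; first exact: openT.
      by move=> k; under eq_fun do rewrite expr2; exact: (Ck_onM openT (pv k) (pv k)).
    apply: (Ck_onZ _ openT); under eq_fun do rewrite expr2.
    have v0 : Ck_on setT 0 v by exact: Ck_onW Hv.
    exact: (Ck_onM openT v0 v0).
  move=> x Kx; rewrite /f1 sv// big1 ?expr0n/= ?mulr0 ?addr0 ?mulr0//.
  by move=> k _; rewrite spv// expr0n.
have L1f2 : L1 f2.
  have sf2 : supp_in K f2.
    move=> x Kx; rewrite /f2 big1 ?expr0n ?mulr0//.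
    by move=> k _; exact: (supp_partial k clK (@sfv k)).
  apply: (csupp_L1 (K := K)) => //.
  have HE2 : Ck_on D 0%N (fun x => Ew lam tau x ^+ 2).
    under eq_fun do rewrite expr2.
    exact: (Ck_onM oD (Ck_on_subset D (HE 0%N)) (Ck_on_subset D (HE 0%N))).
  have HS : Ck_on D 0%N (fun x => \sum_k partial k (flux a v k) x).
    apply: Ck_on_sum; first exact: oD.
    by move=> k; apply: Ck_on_partial; exact: Ck_flux.
  have HS2 : Ck_on D 0%N (fun x => (\sum_k partial k (flux a v k) x) ^+ 2).
    by under eq_fun do rewrite expr2; exact: (Ck_onM oD HS HS).
  have Hf2 : Ck_on D 0%N f2 by exact: (Ck_onM oD HE2 HS2).
  have Hf2T := @Ck_on_extend D K 0%N f2 clK KD sf2 Hf2.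
  exact: (@Ck_on_continuous _ _ 0%N f2 Hf2T).
have sen : supp_in K (energy a w).
  by move=> x Kx; rewrite /energy big1// => l _; rewrite spw// mulr0.
have sfield k : supp_in K (carleman_field a (X lam) (G lam) (B lam) w tau k).
  by move=> x Kx; rewrite /carleman_field sen// sfw// sw// !(mulr0, mul0r, addr0).
have Cfield k : Ck_on setT 1 (carleman_field a (X lam) (G lam) (B lam) w tau k).
  apply: (Ck_on_extend clK KD (sfield k)).
  exact: (Ck_carleman_field oD Ha (CX lam) (CG lam) (CB lam) Hw tau k).
have L1p k : L1 (partial k (carleman_field a (X lam) (G lam) (B lam) w tau k)).
  apply: (csupp_L1 (K := K)) => //.
    exact: Ck_on_continuous (Ck_on_partial k (Cfield k)).
  exact: supp_partial.
have L1fd : L1 fd by exact: L1_sum.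
have Ifd : \int[mu]_x fd x = 0.
  rewrite /fd Rint_sum//; rewrite big1// => k _.
  exact: (integral_partial k cK (Cfield k) (sfield k)).
split => //.
have -> : \int[mu]_x f1 x = \int[mu]_x (f1 x + 2^-1 * fd x).
  rewrite RintegralD//; last exact: L1Z.
  have -> : \int[mu]_x (2^-1 * fd x) = 2^-1 * \int[mu]_x fd x by exact: RintegralZl.
  by rewrite Ifd mulr0 addr0.
apply: le_Rintegral => //; first by apply: L1D => //; exact: L1Z.
move=> x _.
have [Kx|nKx] := pselect (K x); last first.
  have -> : f1 x = 0.
    rewrite /f1 sv// big1 ?expr0n/= ?mulr0 ?addr0 ?mulr0//.
    by move=> k _; rewrite spv// expr0n.
  have -> : fd x = 0.
    by rewrite /fd big1// => k _; exact: (supp_partial k clK (sfield k)).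
  by rewrite mulr0 addr0 mulr_ge0// sqr_ge0.
have Dx := KD Kx.
have := H tau tauH w Hw x Kx; rewrite -/(fd x) conj_opE// [X in _ <= 2 * X]exprMn -/(f2 x).
have [_ [_ [Mb _]]] := HM x Kx.
have key : Ew lam tau x ^+ 2 * (tau * \sum_k (partial k v x) ^+ 2 + tau ^+ 3 * v x ^+ 2) <=
    C5 * (tau * (\sum_k (partial k w x) ^+ 2) + tau ^+ 3 * w x ^+ 2).
  have e1 : Ew lam tau x ^+ 2 * \sum_k (partial k v x) ^+ 2 <=
      2 * (\sum_k (partial k w x) ^+ 2) + tau ^+ 2 * (2 * lam ^+ 2 * (n%:R * M ^+ 2)) * w x ^+ 2.
    have -> : tau ^+ 2 * (2 * lam ^+ 2 * (n%:R * M ^+ 2)) * w x ^+ 2 =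
       \sum_(k < n) (2 * tau ^+ 2 * w x ^+ 2 * (lam ^+ 2 * M ^+ 2)).
      by rewrite sumr_const card_ord -mulr_natl; ring.
    rewrite !mulr_sumr -big_split; apply: ler_sum => k _ /=.
    have dv : derivable v x 'e_k by exact: (Ck_on_derivable Hv).
    rewrite (partialE (is_pderivM (pE lam tau k x) (derivableP dv))) -/(partial k v x).
    set e := Ew lam tau x; set z := partial k v x.
    have ql : `|q lam x| <= lam.
      have l0 := ltW lam0.
      have q0 : 0 <= lam * cweight lam x by apply: mulr_ge0 => //; exact: expR_ge0.
      rewrite (ger0_norm q0) -[leRHS]mulr1; apply: ler_wpM2l => //.
      exact: cweight_le1.
    have qb : (q lam x * b k x) ^+ 2 <= lam ^+ 2 * M ^+ 2.
      rewrite -exprMn -real_normK ?num_real// ler_sqr ?nnegrE//; last exact: mulr_ge0 (ltW lam0) (ltW M0).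
      by rewrite normrM; exact: ler_pM (normr_ge0 _) (normr_ge0 _) ql (Mb k).
    have qb2 := ler_wpM2l (sqr_ge0 (tau * w x)) qb.
    rewrite -/w -/e in qb2 *.
    have -> : w x = e * v x by [].
    rewrite -/(w x) in qb2; have wE : w x = e * v x by []. rewrite wE in qb2.
    have := sqr_ge0 (e * z + 2 * (tau * (q lam x * b k x) * (e * v x))).
    move: qb2; set Q := q lam x * b k x; nra.
  have e2 : 0 <= \sum_k (partial k w x) ^+ 2 by apply: sumr_ge0 => k _; exact: sqr_ge0.
  have e3 := ler_wpM2l tau00 e1.
  have e4 : Ew lam tau x ^+ 2 * (tau ^+ 3 * v x ^+ 2) = tau ^+ 3 * w x ^+ 2 by rewrite /w; ring.
  have e5 : 0 <= tau ^+ 3 * w x ^+ 2 by rewrite mulr_ge0 ?sqr_ge0// exprn_ge0.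
  have e6 : 0 <= tau * \sum_k (partial k w x) ^+ 2 by rewrite mulr_ge0.
  rewrite mulrDr e4 /C5.
  have -> : Ew lam tau x ^+ 2 * (tau * \sum_k (partial k v x) ^+ 2) = tau * (Ew lam tau x ^+ 2 * \sum_k
      (partial k v x) ^+ 2) by ring.
  have e7 := mulr_ge0 C51 e6.
  have -> : (3 + 2 * lam ^+ 2 * (n%:R * M ^+ 2)) * (tau * (\sum_k (partial k w x) ^+ 2) + tau ^+ 3 * w x ^+ 2) =
     3 * (tau * \sum_k (partial k w x) ^+ 2) + 3 * (tau ^+ 3 * w x ^+ 2) +
     2 * lam ^+ 2 * (n%:R * M ^+ 2) * (tau * \sum_k (partial k w x) ^+ 2) +
     2 * lam ^+ 2 * (n%:R * M ^+ 2) * (tau ^+ 3 * w x ^+ 2) by ring.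
  have e8 : tau * (2 * (\sum_k (partial k w x) ^+ 2) + tau ^+ 2 * (2 * lam ^+ 2 * (n%:R * M ^+ 2)) * w x ^+ 2) =
    2 * (tau * \sum_k (partial k w x) ^+ 2) + 2 * lam ^+ 2 * (n%:R * M ^+ 2) * (tau ^+ 3 * w x ^+ 2) by ring.
  rewrite e8 in e3; lra.
have cC : 0 <= c / C5 by rewrite divr_ge0// ltW.
have := ler_wpM2l cC key.
rewrite [X in _ <= X -> _]mulrA (divfK (lt0r_neq0 C50)) => k1 k2.
have -> : f1 x = 2^-1 * (c / C5 * (Ew lam tau x ^+ 2 * (tau * \sum_k (partial k v x) ^+ 2 + tau ^+ 3 *
    v x ^+ 2))).
  by rewrite /f1; field; rewrite gt_eqF.
move: (c / C5 * (_ * _)) k1 => z1 k1; move: (c * _) k1 k2 => z2 k1 k2.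
move: (fd x) (f2 x) k2 => z3 z4 k2; lra.
Qed.

End carleman_estimate.

(** * Jets of order two and cut-offs *)

(** The derivatives of order at most two are indexed by one finite type: [None] stands for the
function, [Some (inl l)] for its derivative along l, and [Some (inr (l, k))] for the derivative
along k of the latter. Sums over all derivatives are then single sums. *)
Notation jet n := (option ('I_n + 'I_n * 'I_n)).

Section jets.
Context {R : realType} {n : nat}.
Local Notation V := 'rV[R]_n.
Local Notation "''e_' i" := (delta_mx 0 i : V) (at level 8, i at level 2).
Implicit Types (x y : V) (D K : set V) (f g u : V -> R) (k l : 'I_n) (z : jet n -> R) (j : jet n).

Definition classical_jet u j : V -> R := match j with
  | None => u
  | Some (inl l) => partial l u
  | Some (inr (l, k)) => partial k (partial l u)
  end.

Definition jet_sq z : R := \sum_j z j ^+ 2.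

Lemma jet_sq_ge0 z : 0 <= jet_sq z.
Proof. by apply: sumr_ge0 => j _; exact: sqr_ge0. Qed.

Lemma le_jet_sq z j : z j ^+ 2 <= jet_sq z.
Proof.
by rewrite /jet_sq (bigD1 j)//= lerDl; apply: sumr_ge0 => i _; exact: sqr_ge0.
Qed.

Lemma norm_le_jet z j : `|z j| <= Num.sqrt (jet_sq z).
Proof.
rewrite -ler_sqr ?nnegrE ?sqrtr_ge0// sqr_sqrtr ?jet_sq_ge0// real_normK ?num_real//.
exact: le_jet_sq.
Qed.

Lemma jet_sq_bound z (C : R) : 0 <= C -> (forall j, `|z j| <= C) ->
  jet_sq z <= #|{: jet n}|%:R * C ^+ 2.
Proof.
move=> C0 H; rewrite /jet_sq mulr_natl -sumr_const; apply: ler_sum => j _.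
by rewrite -real_normK ?num_real// ler_sqr ?nnegrE.
Qed.

Lemma jet_sqD z z' : jet_sq (fun j => z j + z' j) <= 2 * jet_sq z + 2 * jet_sq z'.
Proof.
rewrite /jet_sq !mulr_sumr -big_split; apply: ler_sum => j _ /=.
have := sqr_ge0 (z j - z' j); rewrite !expr2; lra.
Qed.

Variables (D : set V) (a : 'I_n -> 'I_n -> V -> R).
Hypothesis Ha : forall k l, Ck_on D 1 (a k l).

(** div (a grad .) expanded on jets, so that it applies to weak derivatives as well. *)
Definition div_form z x : R := \sum_k \sum_l
  (partial k (a k l) x * z (Some (inl l)) + a k l x * z (Some (inr (l, k)))).

Lemma div_formD z z' x : div_form (fun j => z j + z' j) x = div_form z x + div_form z' x.
Proof.
rewrite /div_form -big_split; apply: eq_bigr => k _ /=.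
by rewrite -big_split; apply: eq_bigr => l _ /=; ring.
Qed.

Lemma div_flux u x : Ck_on setT 2 u -> D x ->
  \sum_k partial k (flux a u k) x = div_form (classical_jet u ^~ x) x.
Proof.
move=> Hu Dx; apply: eq_bigr => k _; rewrite (partial_flux Ha)//.
by apply: eq_bigr => l _ /=; ring.
Qed.

Lemma div_form_bound K : compact K -> K `<=` D -> exists2 M : R, 0 < M &
  forall x z, K x -> div_form z x ^+ 2 <= M * jet_sq z.
Proof.
move=> cK KD.
have [A A0 HA] := compact_family_bounded (I := ('I_n * 'I_n)%type) (F := fun c => a c.1 c.2) cK
  (fun c x Kx => Ck_on_cont (Ha c.1 c.2) (KD x Kx)).
have [B B0 HB] := compact_family_bounded (I := ('I_n * 'I_n)%type) (F := fun c => partial c.1 (a c.1 c.2)) cK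
  (fun c x Kx => Ck_on_cont (Ck_on_partial c.1 (Ha c.1 c.2)) (KD x Kx)).
exists ((n%:R * (n%:R * (B + A))) ^+ 2 + 1); first by rewrite ltr_wpDl// sqr_ge0.
move=> x z Kx; pose t := Num.sqrt (jet_sq z).
have H : `|div_form z x| <= n%:R * (n%:R * (B * t + A * t)).
  apply: sum_bound => k; apply: sum_bound => l.
  apply: le_trans (ler_normD _ _) _; apply: lerD; apply: normM_bound.
  - exact: (HB (k, l)).
  - exact: norm_le_jet.
  - exact: (HA (k, l)).
  - exact: norm_le_jet.
have t2 : t ^+ 2 = jet_sq z by rewrite sqr_sqrtr// jet_sq_ge0.
have N0 := jet_sq_ge0 z.
rewrite mulrDl mul1r; apply: ler_wpDr => //.
rewrite -t2 -exprMn -real_normK ?num_real// ler_sqr ?nnegrE//.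
  by apply: (le_trans H); rewrite -mulrDl !mulrA.
by rewrite !mulr_ge0 ?ler0n ?sqrtr_ge0// addr_ge0// ltW.
Qed.

(** Leibniz' rule: the jet of a product is bilinear in the two jets. *)
Lemma classical_jet_mul_bound K (chi : V -> R) : compact K -> Ck_on setT 2 chi ->
  exists2 M : R, 0 < M & forall u x, Ck_on setT 2 u -> K x ->
    jet_sq (classical_jet (fun y => chi y * u y) ^~ x) <= M * jet_sq (classical_jet u ^~ x).
Proof.
move=> cK Hc.
have Cc j : continuous (classical_jet chi j).
  case: j => [[l|[l k]]|] /=.
  - exact: Ck_on_continuous (Ck_on_partial l Hc).
  - exact: Ck_on_continuous (Ck_on_partial k (Ck_on_partial l Hc)).
  - exact: Ck_on_continuous Hc.
have [C C0 HC] := compact_family_bounded (I := jet n) (F := classical_jet chi) cK (fun j x _ => Cc j x).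
exists (#|{: jet n}|%:R * (4 * C) ^+ 2 + 1); first by rewrite ltr_wpDl// mulr_ge0 ?sqr_ge0.
move=> u x Hu Kx; set t := Num.sqrt (jet_sq (classical_jet u ^~ x)).
have t0 : 0 <= t by exact: sqrtr_ge0.
have Hx j : `|classical_jet chi j x| <= C by exact: HC.
have Ht j : `|classical_jet u j x| <= t by exact: (norm_le_jet (classical_jet u ^~ x)).
have Hp i j : `|classical_jet chi i x * classical_jet u j x| <= C * t by exact: normM_bound.
have du l y : derivable u y 'e_l by exact: (Ck_on_derivable Hu).
have dc l y : derivable chi y 'e_l by exact: (Ck_on_derivable Hc).
have du2 k l y : derivable (partial l u) y 'e_k by exact: (Ck_on_derivable (Ck_on_partial l Hu)).
have dc2 k l y : derivable (partial l chi) y 'e_k by exact: (Ck_on_derivable (Ck_on_partial l Hc)).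
have p1 l : partial l (fun y => chi y * u y) = (fun y => chi y * partial l u y + partial l chi y * u y).
  by apply/funext => y; rewrite partialM.
have Ct : 0 <= C * t by rewrite mulr_ge0// ltW.
have H j : `|classical_jet (fun y => chi y * u y) j x| <= 4 * (C * t).
  case: j => [[l|[l k]]|] /=.
  - rewrite p1; apply: le_trans (ler_normD _ _) _.
    have := Hp None (Some (inl l)); have := Hp (Some (inl l)) None => /=; lra.
  - rewrite p1 partialD; [|exact: derivableMf|exact: derivableMf].
    rewrite !partialM//.
    apply: le_trans (ler_normD _ _) _.
    have A1 := ler_normD (chi x * partial k (partial l u) x) (partial k chi x * partial l u x).
    have A2 := ler_normD (partial l chi x * partial k u x) (partial k (partial l chi) x * u x).
    have := Hp None (Some (inr (l, k))); have := Hp (Some (inl k)) (Some (inl l)).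
    have := Hp (Some (inl l)) (Some (inl k)); have := Hp (Some (inr (l, k))) None => /=; lra.
  - have := Hp None None => /=; lra.
rewrite mulrDl mul1r; apply: ler_wpDr; first exact: jet_sq_ge0.
apply: (le_trans (jet_sq_bound _ H)); first by rewrite mulr_ge0.
rewrite mulrA exprMn sqr_sqrtr ?jet_sq_ge0// mulrA//.
Qed.

End jets.

Section cutoff.
Context {R : realType} {n : nat}.
Local Notation V := 'rV[R]_n.
Implicit Types (x y : V).

(** [flat_exp 0] composed with itself: the inner function vanishes exactly for
|x - x0|^2 <= r, and it reaches c for |x - x0|^2 >= s, where the outer one vanishes. *)
Lemma cutoff_exists (x0 : V) (r s : R) : r < s -> exists chi : V -> R,
  [/\ forall m, Ck_on setT m chi,
      forall x, sqn (x - x0) <= r -> chi x = 1 &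
      forall x, s <= sqn (x - x0) -> chi x = 0].
Proof.
move=> rs.
pose c : R := flat_exp 0 (s - r).
have c0 : 0 < c by apply: flat_exp0_gt0; rewrite subr_gt0.
pose h0 : R := flat_exp 0 c.
have h00 : 0 < h0 by exact: flat_exp0_gt0.
exists (fun x => h0^-1 * flat_exp 0 (c - flat_exp 0 (sqn (x - x0) - r))); split.
- move=> m; apply: (Ck_onZ _ openT).
  apply: (Ck_on_chain (H := flat_exp) 0%N); first exact: openT.
    by move=> p t; exact: is_derive_flat_exp.
  apply: (Ck_onB openT); first exact: Ck_on_cst.
  apply: (Ck_on_chain (H := flat_exp) 0%N); first exact: openT.
    by move=> p t; exact: is_derive_flat_exp.
  apply: (Ck_onB openT); last exact: Ck_on_cst.
  by apply: Ck_on_shift; exact: Ck_on_sqn.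
- move=> x xr; rewrite (flat_exp0_le0 (t := _ - r)) ?subr_le0// subr0.
  by rewrite mulVf// gt_eqF.
- move=> x xs; rewrite [X in _ * X]flat_exp0_le0 ?mulr0// subr_le0.
  by apply: flat_exp0_le; rewrite lerB.
Qed.

End cutoff.

(** * Mollified jets *)
Section limit.
Context {R : realType} {n : nat}.
Local Notation V := 'rV[R]_n.
Local Notation mu := (lebesgue_rV R n).
Implicit Types (x y : V) (D K : set V) (f g u : V -> R) (k l : 'I_n) (j : jet n).

Lemma Rint_EFin f : L1 f -> (\int[mu]_x (f x)%:E = (\int[mu]_x f x)%:E)%E.
Proof. by move=> Lf; rewrite /Rintegral fineK//; exact: integrable_fin_num Lf. Qed.

Lemma Rint_lin (b c : R) f g : L1 f -> L1 g ->
  \int[mu]_x (b * f x + c * g x) = b * \int[mu]_x f x + c * \int[mu]_x g x.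
Proof.
move=> Lf Lg; rewrite RintegralD//; [|exact: L1Z|exact: L1Z].
by rewrite !RintegralZl.
Qed.

Lemma ae_le_Rint f g : L1 f -> L1 g -> (forall x, 0 <= f x) -> (forall x, 0 <= g x) ->
  {ae mu, forall x, f x <= g x} -> \int[mu]_x f x <= \int[mu]_x g x.
Proof.
move=> Lf Lg f0 g0 fg; rewrite -lee_fin -!Rint_EFin//.
apply: ae_ge0_le_integral => //.
- by move=> x _; rewrite lee_fin.
- by apply/measurable_EFinP; exact: L1_measurable.
- by move=> x _; rewrite lee_fin.
- by apply/measurable_EFinP; exact: L1_measurable.
by apply: filterS fg => x fgx _; rewrite lee_fin.
Qed.

Lemma ae_Rint0 f : measurable_fun [set: V] f -> {ae mu, forall x, f x = 0} ->
  \int[mu]_x f x = 0.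
Proof.
move=> mf f0; rewrite /Rintegral (ae_eq_integral (cst 0%E))//.
- by rewrite integral0.
- exact/measurable_EFinP.
- by apply: filterS f0 => x fx _ /=; rewrite fx.
Qed.

Lemma L2_sqr f : L2 f -> L1 (fun x => f x ^+ 2).
Proof.
move=> [mf foo]; apply/integrableP; split.
  by apply/measurable_EFinP; exact: measurable_funX.
rewrite (eq_integral (fun x => (f x ^+ 2)%:E))// => x _ /=.
by rewrite ger0_norm ?sqr_ge0.
Qed.

(** |p + q|^2 <= (1 + eta) |p|^2 + (1 + 1/eta) |q|^2 serves as the triangle inequality, for
the squared norm. *)
Lemma sqn_margin (x0 : V) (r s : R) : 0 < r -> r < s -> exists2 d : R, 0 < d &
  forall e x y, 0 < e -> e < d -> sqn (x - x0) <= r -> sqn (y - x) <= e ^+ 2 -> sqn (y - x0) <= s.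
Proof.
move=> r0 rs.
pose eta : R := (s - r) / (2 * r).
have eta0 : 0 < eta by rewrite divr_gt0 ?subr_gt0// mulr_gt0.
pose C : R := 1 + eta^-1.
have C0 : 0 < C by rewrite addr_gt0// invr_gt0.
have C1 : 1 <= C by rewrite lerDl invr_ge0 ltW.
have d0 : 0 < (s - r) / 2 / C by rewrite !divr_gt0// subr_gt0.
exists (Num.min 1 ((s - r) / 2 / C)); first by rewrite lt_min d0 ltr01.
move=> e x y e0; rewrite lt_min => /andP[e1 ed] xr ye.
have e2 : e ^+ 2 <= (s - r) / 2 / C.
  rewrite expr2; apply: le_trans (ltW ed).
  by rewrite -[leRHS]mulr1; apply: (ler_wpM2l (ltW e0)); exact: ltW.
have H : sqn (y - x0) <= (1 + eta) * sqn (x - x0) + C * sqn (y - x).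
  rewrite /sqn !mulr_sumr -big_split; apply: ler_sum => i _ /=; rewrite !mxE.
  set p := x 0 i; set q := y 0 i; set o := x0 0 i.
  have : 0 <= eta * ((p - o) - eta^-1 * (q - p)) ^+ 2 by rewrite mulr_ge0 ?sqr_ge0// ltW.
  have -> : eta * ((p - o) - eta^-1 * (q - p)) ^+ 2 =
     eta * (p - o) ^+ 2 - 2 * (p - o) * (q - p) + eta^-1 * (q - p) ^+ 2.
    by field; rewrite gt_eqF.
  rewrite /C; move: (eta^-1) => eti; nra.
apply: (le_trans H).
have h1 : (1 + eta) * sqn (x - x0) <= (1 + eta) * r by rewrite ler_wpM2l// addr_ge0// ltW.
have h2 : C * sqn (y - x) <= C * ((s - r) / 2 / C) by rewrite ler_wpM2l ?(le_trans ye)// ltW.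
have h3 : C * ((s - r) / 2 / C) = (s - r) / 2 by rewrite mulrC divfK// gt_eqF.
have h4 : (1 + eta) * r = r + (s - r) / 2 by rewrite /eta; field; rewrite gt_eqF.
rewrite h3 in h2; rewrite h4 in h1; lra.
Qed.

Variables (D : set V) (oD : open D) (Doo : (mu D < +oo)%E).

(** A family of functions in L^2(D), extended by zero, that are the weak derivatives of order at
most two of its first member. *)
Record H2jet (J : jet n -> V -> R) : Prop := {
  H2jet_L2 : forall j, L2 (J j) ;
  H2jet_supp : forall j, supp_in D (J j) ;
  H2jet_grad : forall l, wderiv D l (J None) (J (Some (inl l))) ;
  H2jet_hess : forall l k, wderiv D k (J (Some (inl l))) (J (Some (inr (l, k)))) }.

Lemma jet_sq_L1 (J : jet n -> V -> R) : (forall j, L2 (J j)) -> L1 (fun x => jet_sq (J ^~ x)).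
Proof. by move=> HJ; apply: L1_sum => j; exact: L2_sqr. Qed.

Lemma jet_grad_le (z : jet n -> R) : \sum_l z (Some (inl l)) ^+ 2 <= jet_sq z.
Proof.
have hi : injective (fun l : 'I_n => Some (inl l) : jet n) by move=> l l' [].
have -> : \sum_l z (Some (inl l)) ^+ 2 =
    \sum_(j in [set (Some (inl l) : jet n) | l in [set: 'I_n]%SET]%SET) z j ^+ 2.
  rewrite big_imset /=; last by move=> l l' _ _ /hi.
  by apply: eq_bigl => l; rewrite finset.inE.
rewrite /jet_sq big_mkcond /=; apply: ler_sum => j _.
by case: ifP => // _; exact: sqr_ge0.
Qed.

(** The mollified entries are the classical derivatives of the mollified function. An open set of
points far enough from the complement of D is needed to differentiate twice. *)
Lemma mollify_jet (J : jet n -> V -> R) (O : set V) (e : R) j x : H2jet J -> 0 < e -> open O ->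
  (forall y, O y -> [set z | sqn (z - y) <= e ^+ 2] `<=` D) -> O x ->
  classical_jet (mollify e (J None)) j x = mollify e (J j) x.
Proof.
move=> HJ e0 oO OD Ox.
have mD := open_measurable_rV oD.
have LJ i : L1 (J i) := L2_L1 mD Doo (H2jet_L2 HJ i) (H2jet_supp HJ i).
have p1 l y : O y -> partial l (mollify e (J None)) y = mollify e (J (Some (inl l))) y.
  by move=> Oy; apply: (mollify_partial e0 (LJ _) (LJ _) (H2jet_grad HJ l)); exact: OD.
case: j => [[l|[l k]]|] //=; first exact: p1.
have [_ ->] := @near_partial _ _ k _ _ x (near_open oO Ox (p1 l)).
by apply: (mollify_partial e0 (LJ _) (LJ _) (H2jet_hess HJ l k)); exact: OD.
Qed.

Lemma mollify_jet_L2 (J : jet n -> V -> R) : H2jet J -> forall eta : R, 0 < eta ->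
  exists2 d : R, 0 < d & forall e : R, 0 < e -> e < d ->
   L1 (fun x => jet_sq (fun j => mollify e (J j) x - J j x)) /\
   \int[mu]_x jet_sq (fun j => mollify e (J j) x - J j x) <= eta.
Proof.
move=> HJ eta eta0.
have mD := open_measurable_rV oD.
have LJ i : L1 (J i) := L2_L1 mD Doo (H2jet_L2 HJ i) (H2jet_supp HJ i).
pose eta' : R := eta / (#|{: jet n}|%:R + 1).
have N1 : 0 < #|{: jet n}|%:R + 1 :> R by rewrite ltr_wpDl// ler0n.
have eta'0 : 0 < eta' by exact: divr_gt0.
have H (j : jet n) := mollify_L2 oD Doo (H2jet_L2 HJ j) (H2jet_supp HJ j) eta'0.
exists (\big[Order.min/1]_(j : jet n) sval (cid2 (H j))).
  by apply: lt_bigmin => [|j _]; [exact: ltr01|case: cid2].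
move=> e e0 ed.
have He (j : jet n) : (l2sq (fun x => (mollify e (J j) x - J j x)%R) <= eta'%:E)%E.
  have := lt_le_trans ed (bigmin_le _ j (fun j => sval (cid2 (H j)))).
  by case: cid2 => d /= d0 Hd ed'; exact: Hd.
have mm (j : jet n) : measurable_fun [set: V] (fun x => mollify e (J j) x - J j x).
  apply: measurable_funB; last by case: (H2jet_L2 HJ j).
  apply: continuous_measurable_rV; exact: (Ck_on_continuous (@mollify_Ck _ _ e _ 0%N (LJ j))).
have L2j (j : jet n) : L2 (fun x => mollify e (J j) x - J j x).
  by split; [exact: mm|apply: (le_lt_trans (He j)); rewrite ltry].
split; first exact: jet_sq_L1.
rewrite /jet_sq Rint_sum; last by move=> j; exact: L2_sqr.
apply: (@le_trans _ _ (\sum_(j : jet n) eta')).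
  apply: ler_sum => j _; rewrite -lee_fin -Rint_EFin; [exact: He|exact: L2_sqr].
rewrite sumr_const -mulr_natl /eta' mulrCA -[leRHS]mulr1 ler_pM2l// ler_pdivrMr// mul1r.
by rewrite lerDl.
Qed.

End limit.

(** * The Carleman estimate for functions of class H^2 *)
Section carleman_limit.
Context {R : realType} {n : nat}.
Local Notation V := 'rV[R]_n.
Local Notation mu := (lebesgue_rV R n).
Implicit Types (x y : V) (K : set V) (f g u F : V -> R) (k l : 'I_n) (j : jet n) (J : jet n -> V -> R).

Lemma measurable_sqn_ball (x0 : V) (r : R) : measurable [set x | sqn (x - x0) < r].
Proof.
apply: open_measurable_rV.
exact: (open_comp (f := fun x => sqn (x - x0)) (fun x _ => @continuous_sqnB R n x0 x) (@open_lt _ r)).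
Qed.

Lemma open_sqn_ball (x0 : V) (r : R) : open [set x | sqn (x - x0) < r].
Proof.
exact: (open_comp (f := fun x => sqn (x - x0)) (fun x _ => @continuous_sqnB R n x0 x) (@open_lt _ r)).
Qed.

Lemma closed_sqn_ge (x0 : V) (r : R) : closed [set x | r <= sqn (x - x0)].
Proof.
exact: (closed_comp (f := fun x => sqn (x - x0)) (fun x _ => @continuous_sqnB R n x0 x) (@closed_ge _ r)).
Qed.

Variables (D : set V) (oD : open D) (Doo : (mu D < +oo)%E).
Variables (a : 'I_n -> 'I_n -> V -> R) (theta : R).
Hypothesis Ha : forall k l, Ck_on D 1 (a k l).
Hypothesis symA : forall k l x, D x -> a k l x = a l k x.
Hypothesis theta0 : 0 < theta.
Hypothesis ellA : forall x (xi : 'I_n -> R), D x ->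
  theta * \sum_k xi k ^+ 2 <= \sum_k \sum_l a k l x * xi l * xi k.
Variables (x0 : V) (s0 a1 b1 b2 : R).
Hypotheses (s00 : 0 < s0) (a10 : 0 < a1) (a1b1 : a1 < b1) (b1b2 : b1 < b2).
Hypothesis b2D : [set x | sqn (x - x0) <= b2] `<=` D.

Let S : set V := [set x | sqn (x - x0) < a1].
Let Q : set V := [set x | sqn (x - x0) <= b1].
Let K : set V := [set x | s0 / 4 <= sqn (x - x0)] `&` Q.
Let E (lam tau : R) x : R := expR (tau * cweight x0 lam x).

Let QD : Q `<=` D.
Proof. by move=> x Qx; apply: b2D; apply: le_trans (ltW b1b2). Qed.

Let cQ : compact Q. Proof. exact: compact_sqn_ball. Qed.

Let cK : compact K.
Proof. by rewrite /K setIC; apply: compact_closedI => //; exact: closed_sqn_ge. Qed.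

Let measE lam tau : measurable_fun [set: V] (E lam tau).
Proof. exact: continuous_measurable_rV (Ck_on_continuous (@Ck_Ew _ _ x0 lam tau 0%N)). Qed.

Let E0 lam tau x : 0 < E lam tau x. Proof. exact: expR_gt0. Qed.

Let E2_le lam tau x : 0 <= lam -> 0 <= tau -> E lam tau x ^+ 2 <= expR tau ^+ 2.
Proof.
move=> l0 t0; rewrite ler_sqr ?nnegrE ?expR_ge0// ler_expR -[leRHS]mulr1.
by apply: (ler_wpM2l t0); exact: cweight_le1.
Qed.

Let E2_out lam tau x : 0 <= lam -> 0 <= tau -> ~ S x ->
  E lam tau x ^+ 2 <= expR (tau * expR (- (lam * a1))) ^+ 2.
Proof.
move=> l0 t0 /negP; rewrite -leNgt => Sx.
rewrite ler_sqr ?nnegrE ?expR_ge0// ler_expR; apply: (ler_wpM2l t0).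
by rewrite ler_expR mulrN lerN2; exact: ler_wpM2l.
Qed.

Let mS : measurable S. Proof. exact: measurable_sqn_ball. Qed.

Let inS x : S x -> \1_S x = 1 :> R. Proof. by move=> Sx; rewrite indicE mem_set. Qed.
Let ninS x : ~ S x -> \1_S x = 0 :> R. Proof. by move=> Sx; rewrite indicE memNset. Qed.

Lemma L1_cut lam tau F : 0 <= lam -> 0 <= tau -> L1 F -> L1 (fun x => \1_S x * (E lam tau x ^+ 2 * F x)).
Proof.
move=> l0 t0 LF.
have -> : (fun x => \1_S x * (E lam tau x ^+ 2 * F x)) = (fun x => F x * (\1_S x * E lam tau x ^+ 2)).
  by apply/funext => x; ring.
apply: (L1_mulb LF (M := expR tau ^+ 2)).
  by apply: measurable_funM; [exact: measurable_indic|apply: measurable_funX; exact: measE].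
move=> x; rewrite ger0_norm; last by rewrite mulr_ge0 ?sqr_ge0// indicE.
have [Sx|Sx] := pselect (S x); first by rewrite inS// mul1r; exact: E2_le.
by rewrite ninS// mul0r sqr_ge0.
Qed.

(** The Carleman estimate for v = chi u_e, in the limit e -> 0. The function F is any majorant of
the square of div (a grad u). The annulus between the spheres of squared radii a1 and b1, where
chi varies, contributes the whole jet of u, but with the weight that it has on the inner sphere.
All inequalities hold pointwise up to a multiple of the squared distance d from the jet of u to its
mollification, whose integral tends to zero. *)
Lemma carleman_limit : exists lam c tau0 : R, [/\ 0 < lam, 0 < c, 1 <= tau0 &
  forall tau, tau0 <= tau -> forall J F, H2jet D J -> L1 F -> (forall x, 0 <= F x) ->
  {ae mu, forall x, D x -> div_form a (J ^~ x) x ^+ 2 <= F x} ->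
  {ae mu, forall x, sqn (x - x0) < s0 -> J None x = 0} ->
  \int[mu]_x (\1_S x * (expR (tau * cweight x0 lam x) ^+ 2 *
     (tau * \sum_l J (Some (inl l)) x ^+ 2 + tau ^+ 3 * J None x ^+ 2))) <=
  c * \int[mu]_x (\1_S x * (expR (tau * cweight x0 lam x) ^+ 2 * F x)) +
  c * expR (tau * expR (- (lam * a1))) ^+ 2 * \int[mu]_x jet_sq (J ^~ x)].
Proof.
have rho0 : 0 < s0 / 4 by rewrite divr_gt0.
have Krho x : K x -> s0 / 4 <= sqn (x - x0) by case.
have KD : K `<=` D by move=> x [_ /QD].
have ellK x (xi : 'I_n -> R) : K x -> theta * \sum_k xi k ^+ 2 <= \sum_k \sum_l a k l x * xi l * xi k.
  by move=> /KD; exact: ellA.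
have [lam [c0 [tau0 [lam0 c00 tau01 HC]]]] := carleman_integral oD cK KD Ha symA theta0 ellK rho0 Krho.
have [chi [Cchi chi1 chi0]] := cutoff_exists x0 a1b1.
have [M M0 HM] := div_form_bound Ha cQ QD.
have [M' M'0 HM'] := classical_jet_mul_bound cQ (Cchi 2%N).
have l0 := ltW lam0.
have MM' : 0 < M * M' by rewrite mulr_gt0.
pose c := 2 / c0 * (2 + 2 * (M * M')).
have b10 : 0 < b1 by exact: lt_trans a1b1.
have bb : b1 < (b1 + b2) / 2 by move: b1b2; lra.
have bb2 : (b1 + b2) / 2 < b2 by move: b1b2; lra.
have bb0 : 0 < (b1 + b2) / 2 by exact: lt_trans bb.
have ss : s0 / 4 < s0 / 2 by move: s00; lra.
(* e < d1: the jet of u_e is the mollified jet in a neighbourhood of the support of chi *)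
have [d1 d10 Hd1] := sqn_margin x0 (r := (b1 + b2) / 2) (s := b2) bb0 bb2.
(* e < d2: u_e vanishes near x0, since u does *)
have [d2 d20 Hd2] := sqn_margin x0 (r := s0 / 4) (s := s0 / 2) rho0 ss.
exists lam, c, tau0; split => //; first by rewrite mulr_gt0 ?divr_gt0//; lra.
move=> tau tauH J F HJ LF F0 LJF J0.
have tau1 : 1 <= tau by exact: le_trans tauH.
have t0 : 0 <= tau by lra.
have mD := open_measurable_rV oD.
have LJ j : L1 (J j) := L2_L1 mD Doo (H2jet_L2 HJ j) (H2jet_supp HJ j).
have LN : L1 (fun x => jet_sq (J ^~ x)) := jet_sq_L1 (H2jet_L2 HJ).
pose N x := jet_sq (J ^~ x).
pose X x := \1_S x * (E lam tau x ^+ 2 * (tau * \sum_l J (Some (inl l)) x ^+ 2 + tau ^+ 3 * J None x ^+ 2)).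
pose Y x := \1_S x * (E lam tau x ^+ 2 * F x).
pose phi := expR (tau * expR (- (lam * a1))) ^+ 2.
pose Em : R := expR tau ^+ 2.
have LX : L1 X.
  apply: L1_cut => //; apply: L1D; apply: L1Z; last exact: L2_sqr (H2jet_L2 HJ _).
  by apply: L1_sum => l; exact: L2_sqr (H2jet_L2 HJ _).
have LY : L1 Y by exact: L1_cut.
have Em0 : 0 <= Em by exact: sqr_ge0.
have phiEm : phi <= Em.
  rewrite ler_sqr ?nnegrE ?expR_ge0// ler_expR -[leRHS]mulr1; apply: (ler_wpM2l t0).
  by rewrite expR_le1 oppr_le0 mulr_ge0// ltW.
have phi0 : 0 <= phi by exact: sqr_ge0.
pose C1 : R := 2 * Em * (tau + tau ^+ 3).
pose C2 : R := 2 * (M * M') * Em + 2 * M * Em.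
have C10 : 0 <= C1 by rewrite !mulr_ge0// addr_ge0// exprn_ge0.
have C20 : 0 <= C2 by rewrite addr_ge0// !mulr_ge0// ltW.
suff key (eta : R) : 0 < eta -> \int[mu]_x X x <=
    c * \int[mu]_x Y x + c * phi * \int[mu]_x N x + (C1 + 2 / c0 * C2) * eta.
  change (\int[mu]_x X x <= c * \int[mu]_x Y x + c * phi * \int[mu]_x N x).
  apply/ler_addgt0Pr => eta eta0.
  have C30 : 0 < C1 + 2 / c0 * C2 + 1.
    by rewrite ltr_wpDl// addr_ge0// mulr_ge0// divr_ge0// ltW.
  apply: (le_trans (key (eta / (C1 + 2 / c0 * C2 + 1)) (divr_gt0 eta0 C30))).
  rewrite lerD2l mulrCA -[leRHS]mulr1 ler_pM2l// ler_pdivrMr// mul1r lerDl//.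
move=> eta0.
have [d3 d30 Hd3] := mollify_jet_L2 oD Doo HJ eta0.
pose e := Num.min d1 (Num.min d2 d3) / 2.
have m0 : 0 < Num.min d1 (Num.min d2 d3) by rewrite !lt_min d10 d20 d30.
have e0 : 0 < e by rewrite divr_gt0.
have : e < Num.min d1 (Num.min d2 d3) by rewrite /e ltr_pdivrMr// ltr_pMr// ltr1n.
rewrite !lt_min => /and3P[ed1 ed2 ed3].
have [Ld Id] := Hd3 e e0 ed3.
pose u := mollify e (J None).
pose v y := chi y * u y.
pose m j x := mollify e (J j) x.
pose d x := jet_sq (fun j => m j x - J j x).
have Cu (p : nat) : Ck_on setT p u by exact: mollify_Ck.
have Cv : Ck_on setT 2 v by exact: (Ck_onM openT (Cchi 2%N) (Cu 2%N)).
have OD y : [set x | sqn (x - x0) < (b1 + b2) / 2] y -> [set z | sqn (z - y) <= e ^+ 2] `<=` D.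
  move=> /= Oy z zy; apply: b2D; apply: (Hd1 e y z e0 ed1 _ zy); exact: ltW.
have jm j x : Q x -> classical_jet u j x = m j x.
  move=> Qx; apply: (mollify_jet oD Doo j HJ e0 (@open_sqn_ball x0 _) OD) => /=.
  exact: le_lt_trans bb.
have u0 x : sqn (x - x0) < s0 / 4 -> u x = 0.
  move=> xs; apply: ae_Rint0.
    apply: L1_measurable; apply: (convol_L1 (K := [set z | sqn (z - 0) <= e ^+ 2])).
    - exact: compact_sqn_ball.
    - exact: LJ.
    - exact: continuous_mollifier.
    - exact: supp_mollifier.
  apply: filterS J0 => y Jy.
  have [ys|ys] := ltP (sqn (y - x0)) s0; first by rewrite Jy// mul0r.
  rewrite [X in _ * X](@supp_mollifier _ _ e) ?mulr0//= subr0 => yx.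
  have := Hd2 e x y e0 ed2 (ltW xs) yx; lra.
have sv : supp_in K v.
  move=> x nK; rewrite /v.
  have [xb|xb] := leP b1 (sqn (x - x0)); first by rewrite chi0// mul0r.
  rewrite u0 ?mulr0// ltNge; apply/negP => xs; apply: nK; split => //.
  exact: ltW.
have [Lf1 Lf2 H12] := HC tau tauH v Cv sv.
set f1 := (fun x => c0 * _) in Lf1 H12; set f2 := (fun x => _ * _) in Lf2 H12.
have vu x : S x -> \forall y \near x, v y = u y.
  move=> Sx; apply: (near_open (@open_sqn_ball x0 a1) Sx) => y Sy.
  by rewrite /v chi1 ?mul1r// ltW.
have SQ x : S x -> Q x by move=> Sx; apply: ltW; exact: lt_trans a1b1.
have d0 x : 0 <= d x by exact: jet_sq_ge0.
have f10 x : 0 <= f1 x.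
  rewrite /f1 mulr_ge0// ?(ltW c00)// mulr_ge0 ?sqr_ge0// addr_ge0//.
    by rewrite mulr_ge0// sumr_ge0// => k _; exact: sqr_ge0.
  by rewrite mulr_ge0 ?sqr_ge0// exprn_ge0.
have Y0 y : 0 <= Y y.
  apply: mulr_ge0; first by rewrite indicE ler0n.
  by apply: mulr_ge0; [exact: sqr_ge0|exact: F0].
have sqr2 (p q : R) : q ^+ 2 <= 2 * p ^+ 2 + 2 * (p - q) ^+ 2.
  have := sqr_ge0 (2 * p - q); nra.
have I1 x : X x <= 2 / c0 * f1 x + C1 * d x.
  have [Sx|nSx] := pselect (S x); last first.
    by rewrite /X ninS// mul0r addr_ge0// mulr_ge0// divr_ge0// ltW.
  have -> : 2 / c0 * f1 x = 2 * (E lam tau x ^+ 2 * (tau * \sum_k (partial k v x) ^+ 2 + tau ^+ 3 * v x ^+ 2)).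
    by rewrite /f1 -/(E lam tau x) [LHS]mulrA divfK// gt_eqF.
  rewrite /X inS// mul1r.
  have vx : v x = m None x by rewrite (nbhs_singleton (vu x Sx)).
  have pvx l : partial l v x = m (Some (inl l)) x.
    have [_ ->] := near_partial l (vu x Sx); exact: (jm (Some (inl l)) x (SQ x Sx)).
  have -> : \sum_k (partial k v x) ^+ 2 = \sum_k (m (Some (inl k)) x) ^+ 2.
    by apply: eq_bigr => k _; rewrite pvx.
  rewrite vx /C1.
  have h1 : \sum_l J (Some (inl l)) x ^+ 2 <= 2 * \sum_l m (Some (inl l)) x ^+ 2 + 2 * d x.
    have g := jet_grad_le (fun j => m j x - J j x).
    apply: (@le_trans _ _ (2 * \sum_l m (Some (inl l)) x ^+ 2 + 2 * \sum_l (m (Some (inl l)) x - J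
        (Some (inl l)) x) ^+ 2)).
      rewrite !mulr_sumr -big_split; apply: ler_sum => l _; exact: sqr2.
    by rewrite lerD2l ler_pM2l.
  have h2 : J None x ^+ 2 <= 2 * m None x ^+ 2 + 2 * d x.
    apply: (le_trans (sqr2 (m None x) _)); rewrite lerD2l ler_pM2l//.
    exact: (le_jet_sq (fun j => m j x - J j x) None).
  have h3 := E2_le x l0 t0 : E lam tau x ^+ 2 <= Em.
  have h4 : 0 <= E lam tau x ^+ 2 by exact: sqr_ge0.
  have h5 := ler_wpM2l t0 h1.
  have h6 := ler_wpM2l (exprn_ge0 3 t0) h2.
  have h7 := ler_wpM2l h4 (lerD h5 h6).
  have h8 : 0 <= 2 * (tau + tau ^+ 3) * d x by rewrite !mulr_ge0// addr_ge0// exprn_ge0.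
  have h9 := ler_wpM2r h8 h3.
  move: h7 h9; set s1 := \sum_l _; set s2 := \sum_l _; set e2 := E _ _ _ ^+ 2.
  move: (m None x ^+ 2) (J None x ^+ 2) (tau ^+ 3) (d x) => z1 z2 z3 z4; lra.
have I2 : {ae mu, forall x, f2 x <= 2 * Y x + (2 * (M * M') * phi * N x + C2 * d x)}.
  apply: filterS LJF => x LJFx.
  have Nx : 0 <= N x by exact: jet_sq_ge0.
  have r1 : 0 <= 2 * (M * M') * phi * N x by rewrite !mulr_ge0// ltW.
  have r2 : 0 <= C2 * d x by rewrite mulr_ge0.
  have [Qx|nQx] := pselect (Q x); last first.
    have sQ k : supp_in Q (flux a v k).
      move=> y nQ; rewrite /flux big1// => l _.
      rewrite (supp_partial l (compact_closed (@norm_hausdorff _ _) cQ) _ nQ) ?mulr0//.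
      by move=> z nz; apply: sv => -[_ /nz].
    rewrite /f2 big1 ?expr0n/= ?mulr0; last first.
      by move=> k _; exact: (supp_partial k (compact_closed (@norm_hausdorff _ _) cQ) (sQ k)).
    by rewrite addr_ge0 ?addr_ge0// mulr_ge0.
  have Dx := QD Qx.
  have f2E : f2 x = E lam tau x ^+ 2 * div_form a (classical_jet v ^~ x) x ^+ 2.
    by rewrite /f2 (div_flux Ha Cv Dx).
  have md : jet_sq (m ^~ x) <= 2 * N x + 2 * d x.
    apply: le_trans (jet_sqD (J ^~ x) (fun j => m j x - J j x)).
    by rewrite /jet_sq; apply: ler_sum => j _; rewrite addrC subrK.
  have E20 : 0 <= E lam tau x ^+ 2 by exact: sqr_ge0.
  have E2m : E lam tau x ^+ 2 <= Em by exact: E2_le.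
  have [Sx|nSx] := pselect (S x).
    have vm j : classical_jet v j x = m j x.
      rewrite -jm//; case: j => [[l|[l k]]|] /=.
      - by have [_ ->] := near_partial l (vu x Sx).
      - have pl y : S y -> partial l v y = partial l u y.
          by move=> Sy; have [_ ->] := near_partial l (vu y Sy).
        by have [_ ->] := near_partial k (near_open (@open_sqn_ball x0 a1) Sx pl).
      - exact: (nbhs_singleton (vu x Sx)).
    have -> : f2 x = E lam tau x ^+ 2 * (div_form a (J ^~ x) x + div_form a (fun j => m j x - J j x) x) ^+ 2.
      rewrite f2E -div_formD; congr (_ * div_form a _ x ^+ 2).
      by apply/funext => j; rewrite vm addrC subrK.
    have YE : Y x = E lam tau x ^+ 2 * F x by rewrite /Y inS// mul1r.
    have h1 := LJFx Dx.
    have h2 := HM x (fun j => m j x - J j x) Qx.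
    have h3 : (div_form a (J ^~ x) x + div_form a (fun j => m j x - J j x) x) ^+ 2 <= 2 * F x + 2 * (M * d x).
      have := sqr_ge0 (div_form a (J ^~ x) x - div_form a (fun j => m j x - J j x) x).
      move: h1 h2; rewrite -/(d x); nra.
    have h4 := ler_wpM2l E20 h3.
    have h5 : 0 <= M * d x by rewrite mulr_ge0// ltW.
    have h6 := ler_wpM2r h5 E2m.
    have h7 : 0 <= 2 * (M * M') * Em * d x by rewrite !mulr_ge0// ltW.
    apply: (le_trans h4); rewrite YE; move: h6 h7 r1; rewrite /C2.
    move: (E lam tau x ^+ 2) (F x) (2 * (M * M') * phi * N x) (M * M') => z1 z2 z3 z4; nra.
  have h1 := HM x (classical_jet v ^~ x) Qx.
  have h2 := HM' u x (Cu 2%N) Qx.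
  have h3 : jet_sq (classical_jet u ^~ x) = jet_sq (m ^~ x).
    by apply: eq_bigr => j _; rewrite jm.
  rewrite h3 in h2.
  have h4 : div_form a (classical_jet v ^~ x) x ^+ 2 <= M * M' * (2 * N x + 2 * d x).
    apply: (le_trans h1); rewrite -mulrA ler_pM2l//; apply: (le_trans h2).
    by rewrite ler_pM2l.
  have h5 := E2_out l0 t0 nSx.
  rewrite -/phi in h5.
  have h6 : f2 x <= phi * (M * M' * (2 * N x + 2 * d x)).
    by rewrite f2E; apply: ler_pM => //; exact: sqr_ge0.
  have h7 : 0 <= 2 * (M * M' * d x) by rewrite !mulr_ge0// ltW.
  have h8 := ler_wpM2r h7 phiEm.
  have h9 : 0 <= 2 * M * Em * d x by rewrite !mulr_ge0// ltW.
  have Y2 : 0 <= 2 * Y x by apply: mulr_ge0.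
  apply: (le_trans h6); rewrite /C2; move: h8 h9 Y2.
  move: (M * M') (N x) (d x) (2 * Y x) => z1 z2 z3 z4; lra.
have LR : L1 (fun x => 2 * (M * M') * phi * N x + C2 * d x) by apply: L1D; exact: L1Z.
have J2 : \int[mu]_x f2 x <= 2 * \int[mu]_x Y x + (2 * (M * M') * phi * \int[mu]_x N x + C2 * \int[mu]_x d x).
  rewrite -(Rint_lin _ _ LN Ld).
  have -> : 2 * \int[mu]_x Y x + \int[mu]_x (2 * (M * M') * phi * N x + C2 * d x) =
     2 * \int[mu]_x Y x + 1 * \int[mu]_x (2 * (M * M') * phi * N x + C2 * d x) by rewrite mul1r.
  rewrite -(Rint_lin _ _ LY LR); apply: ae_le_Rint => //.
  - by apply: L1D; exact: L1Z.
  - by move=> x; rewrite mulr_ge0 ?sqr_ge0.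
  - move=> x; rewrite mul1r; apply: addr_ge0; first by rewrite mulr_ge0.
    by rewrite addr_ge0// !mulr_ge0// ?jet_sq_ge0// ltW.
  by apply: filterS I2 => x; rewrite mul1r.
have J1 : \int[mu]_x X x <= 2 / c0 * \int[mu]_x f1 x + C1 * \int[mu]_x d x.
  rewrite -(Rint_lin _ _ Lf1 Ld); apply: le_Rintegral => //.
  by apply: L1D; exact: L1Z.
have b0 : 0 <= 2 / c0 by rewrite divr_ge0// ltW.
have IY : 0 <= \int[mu]_x Y x.
  by apply: Rintegral_ge0 => x _; exact: Y0.
have IN : 0 <= \int[mu]_x N x by apply: Rintegral_ge0 => x _; exact: jet_sq_ge0.
have h1 := ler_wpM2l b0 (le_trans H12 J2).
have h2 : 0 <= C1 + 2 / c0 * C2 by rewrite addr_ge0// mulr_ge0.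
have Id' : \int[mu]_x d x <= eta := Id.
have h3 := ler_wpM2l h2 Id'.
have h4 : 0 <= 2 / c0 * (2 * (M * M')) * \int[mu]_x Y x.
  apply: mulr_ge0 => //; apply: mulr_ge0 => //; apply: mulr_ge0; first by [].
  exact: ltW.
have h5 : 0 <= 2 / c0 * 2 * (phi * \int[mu]_x N x).
  by apply: mulr_ge0; apply: mulr_ge0.
apply: (le_trans J1).
move: h1 h3 h4 h5; rewrite /c.
move: (\int[mu]_x Y x) (\int[mu]_x N x) (\int[mu]_x d x) (\int[mu]_x f1 x) (\int[mu]_x f2 x).
move: (2 / c0) (M * M') => z1 z2 z3 z4 z5 z6 z7 h1 h3 h4 h5; lra.
Qed.

End carleman_limit.

(** * Uniqueness in balls *)
Section local_uniqueness.
Context {R : realType} {n : nat}.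
Local Notation V := 'rV[R]_n.
Local Notation mu := (lebesgue_rV R n).
Implicit Types (x y : V) (F : V -> R) (k l : 'I_n) (j : jet n) (J : jet n -> V -> R).

Lemma Rint0_ae F : L1 F -> (forall x, 0 <= F x) -> \int[mu]_x F x <= 0 ->
  {ae mu, forall x, F x = 0}.
Proof.
move=> LF F0 IF.
have mF : measurable_fun [set: V] (fun x => (F x)%:E).
  by apply/measurable_EFinP; exact: L1_measurable.
have H : (\int[mu]_x `|(F x)%:E| = 0)%E.
  under eq_integral do rewrite gee0_abs ?lee_fin//.
  rewrite Rint_EFin//; congr EFin; apply/eqP; rewrite eq_le IF /=.
  by apply: Rintegral_ge0.
have /(ae_eq_integral_abs mu measurableT mF) H' := H.
by apply: filterS H' => x /(_ I) /= [].
Qed.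

Definition jet_grad_sq (z : jet n -> R) : R := \sum_l z (Some (inl l)) ^+ 2.

Variables (D : set V) (oD : open D) (Doo : (mu D < +oo)%E).
Variables (a : 'I_n -> 'I_n -> V -> R) (theta : R).
Hypothesis Ha : forall k l, Ck_on D 1 (a k l).
Hypothesis symA : forall k l x, D x -> a k l x = a l k x.
Hypothesis theta0 : 0 < theta.
Hypothesis ellA : forall x (xi : 'I_n -> R), D x ->
  theta * \sum_k xi k ^+ 2 <= \sum_k \sum_l a k l x * xi l * xi k.
Variables (J J' : jet n -> V -> R) (M : R).
Hypotheses (HJ : H2jet D J) (HJ' : H2jet D J') (M0 : 0 <= M).
Let N0 x : R := J None x ^+ 2 + J' None x ^+ 2.
Let N1 x : R := jet_grad_sq (J ^~ x) + jet_grad_sq (J' ^~ x).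
Hypothesis HL : {ae mu, forall x, D x ->
  div_form a (J ^~ x) x ^+ 2 + div_form a (J' ^~ x) x ^+ 2 <= M * (N0 x + N1 x)}.

(** J and J' are the jets of the real and imaginary parts of u. For large tau the lower-order terms
are absorbed, and what is left reads (tau - C) int_S E |u|^2 <= c phi h, with S the ball, E the
squared weight, and phi its value on the sphere, so that E >= phi on S. Hence
s int_S |u|^2 <= c h for all s >= 0. *)
Lemma local_uniqueness (x0 : V) (s0 a1 b2 : R) : 0 < s0 -> 0 < a1 -> a1 < b2 ->
  [set x | sqn (x - x0) <= b2] `<=` D ->
  {ae mu, forall x, sqn (x - x0) < s0 -> J None x = 0 /\ J' None x = 0} ->
  {ae mu, forall x, sqn (x - x0) < a1 -> J None x = 0 /\ J' None x = 0}.
Proof.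
move=> s00 a10 a1b2 b2D JJ0.
pose b1 := (a1 + b2) / 2.
have a1b1 : a1 < b1 by rewrite /b1; lra.
have b1b2 : b1 < b2 by rewrite /b1; lra.
have [lam [c [tau0 [lam0 c0 tau01 H]]]] :=
  carleman_limit oD Doo Ha symA theta0 ellA s00 a10 a1b1 b1b2 b2D.
have l0 := ltW lam0.
have L2J j : L1 (fun x => J j x ^+ 2) by exact: L2_sqr (H2jet_L2 HJ j).
have L2J' j : L1 (fun x => J' j x ^+ 2) by exact: L2_sqr (H2jet_L2 HJ' j).
have LN0 : L1 N0 by exact: L1D.
have LN1 : L1 N1 by apply: L1D; apply: L1_sum.
have N00 x : 0 <= N0 x by rewrite addr_ge0 ?sqr_ge0.
have N10 x : 0 <= N1 x by rewrite addr_ge0// sumr_ge0// => l _; exact: sqr_ge0.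
pose F x := M * (N0 x + N1 x).
have LF : L1 F by apply: L1Z; exact: L1D.
have F0 x : 0 <= F x by rewrite mulr_ge0// addr_ge0.
have HF : {ae mu, forall x, D x -> div_form a (J ^~ x) x ^+ 2 <= F x}.
  apply: filterS HL => x Hx Dx; apply: le_trans (Hx Dx).
  by rewrite lerDl sqr_ge0.
have HF' : {ae mu, forall x, D x -> div_form a (J' ^~ x) x ^+ 2 <= F x}.
  apply: filterS HL => x Hx Dx; apply: le_trans (Hx Dx).
  by rewrite lerDr sqr_ge0.
have J0 : {ae mu, forall x, sqn (x - x0) < s0 -> J None x = 0}.
  by apply: filterS JJ0 => x Hx xs; have [] := Hx xs.
have J'0 : {ae mu, forall x, sqn (x - x0) < s0 -> J' None x = 0}.
  by apply: filterS JJ0 => x Hx xs; have [] := Hx xs.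
pose S := [set x | sqn (x - x0) < a1].
pose E tau x := expR (tau * cweight x0 lam x) ^+ 2.
pose I0 tau := \int[mu]_x (\1_S x * (E tau x * N0 x)).
pose I1 tau := \int[mu]_x (\1_S x * (E tau x * N1 x)).
pose h := \int[mu]_x jet_sq (J ^~ x) + \int[mu]_x jet_sq (J' ^~ x).
pose phi tau := expR (tau * expR (- (lam * a1))) ^+ 2.
have K1 tau : tau0 <= tau -> tau * I1 tau + tau ^+ 3 * I0 tau <=
    2 * c * M * (I0 tau + I1 tau) + c * phi tau * h.
  move=> tt.
  have t0 : 0 <= tau by apply: le_trans tt; apply: le_trans tau01.
  have h1 := H tau tt J F HJ LF F0 HF J0.
  have h2 := H tau tt J' F HJ' LF F0 HF' J'0.
  have L0 := L1_cut x0 a1 l0 t0 LN0.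
  have L1' := L1_cut x0 a1 l0 t0 LN1.
  have e1 : \int[mu]_x (\1_S x * (E tau x * F x)) = M * (I0 tau + I1 tau).
    rewrite mulrDr -Rint_lin//; congr Rintegral; apply/funext => x.
    by rewrite /F /E; ring.
  have e2 : \int[mu]_x (\1_S x * (E tau x * (tau * jet_grad_sq (J ^~ x) + tau ^+ 3 * J None x ^+ 2))) +
     \int[mu]_x (\1_S x * (E tau x * (tau * jet_grad_sq (J' ^~ x) + tau ^+ 3 * J' None x ^+ 2)))
     = tau * I1 tau + tau ^+ 3 * I0 tau.
    rewrite -Rint_lin// -RintegralD//; last 2 first.
    - apply: L1_cut => //; apply: L1D; apply: L1Z => //; exact: L1_sum.
    - apply: L1_cut => //; apply: L1D; apply: L1Z => //; exact: L1_sum.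
    by congr Rintegral; apply/funext => x; rewrite /N0 /N1 /E; ring.
  rewrite -e2; apply: (le_trans (lerD h1 h2)).
  rewrite -[\int[mu]_x (\1_ _ x * (_ * F x))]/(\int[mu]_x (\1_S x * (E tau x * F x))) e1.
  by rewrite /h /phi le_eqVlt; apply/orP; left; apply/eqP; ring.
pose I := \int[mu]_x (\1_S x * N0 x).
have mS : measurable S by exact: measurable_sqn_ball.
have LI : L1 (fun x => \1_S x * N0 x).
  have -> : (fun x => \1_S x * N0 x) = (fun x => N0 x * \1_S x) by apply/funext => x; rewrite mulrC.
  apply: (L1_mulb LN0 (M := 1)); first exact: measurable_indic.
  by move=> x; rewrite ger0_norm indicE ?ler0n// lern1 leq_b1.
have I00 : 0 <= I.
  by apply: Rintegral_ge0 => x _; apply: mulr_ge0 => //; rewrite indicE ler0n.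
have K2 tau : 0 <= tau -> phi tau * I <= I0 tau.
  move=> t0.
  have -> : phi tau * I = \int[mu]_x (phi tau * (\1_S x * N0 x)) by rewrite RintegralZl.
  apply: le_Rintegral => //; [exact: L1Z|exact: L1_cut|].
  move=> x _; have [Sx|Sx] := pselect (S x); last by rewrite indicE memNset// !mul0r mulr0.
  rewrite indicE mem_set// !mul1r; apply: ler_wpM2r => //.
  rewrite /phi /E ler_sqr ?nnegrE ?expR_ge0// ler_expR; apply: (ler_wpM2l t0).
  rewrite ler_expR mulrN lerN2; apply: (ler_wpM2l l0); exact: ltW.
have h0 : 0 <= h.
  by apply: addr_ge0; apply: Rintegral_ge0 => x _; exact: jet_sq_ge0.
have I1_ge0 tau : 0 <= I1 tau.
  apply: Rintegral_ge0 => x _; apply: mulr_ge0; first by rewrite indicE ler0n.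
  by apply: mulr_ge0 => //; exact: sqr_ge0.
have I0_ge0 tau : 0 <= I0 tau.
  apply: Rintegral_ge0 => x _; apply: mulr_ge0; first by rewrite indicE ler0n.
  by apply: mulr_ge0 => //; exact: sqr_ge0.
have cM : 0 <= 2 * c * M by apply: mulr_ge0 => //; apply: mulr_ge0 => //; exact: ltW.
have K3 s : 0 <= s -> s * I <= c * h.
  move=> s_ge0; pose tau := tau0 + 2 * c * M + s.
  have tt : tau0 <= tau by rewrite /tau; lra.
  have t1 : 1 <= tau by exact: le_trans tt.
  have t0 : 0 <= tau by exact: le_trans t1.
  have h1 := K1 tau tt.
  have h2 := K2 tau t0.
  have phi_gt0 : 0 < phi tau by rewrite exprn_gt0// expR_gt0.
  have h3 : tau * I0 tau <= tau ^+ 3 * I0 tau.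
    apply: ler_wpM2r => //.
    by rewrite -[leLHS]mulr1 exprS; apply: (ler_wpM2l t0); apply: exprn_ege1.
  have h4 : s * I0 tau <= c * phi tau * h.
    have g1 : 0 <= (tau - 2 * c * M) * I1 tau by apply: mulr_ge0 => //; rewrite /tau; lra.
    have g2 : 0 <= tau0 * I0 tau by apply: mulr_ge0 => //; lra.
    move: h1 h3 g1 g2; rewrite /tau; move: (I0 _) (I1 _) => z0 z1; lra.
  have h5 := ler_wpM2l s_ge0 h2.
  rewrite -(ler_pM2l phi_gt0).
  have -> : phi tau * (s * I) = s * (phi tau * I) by ring.
  have -> : phi tau * (c * h) = c * phi tau * h by ring.
  exact: le_trans h4.
have I_le0 : I <= 0.
  rewrite leNgt; apply/negP => Ipos.
  have := K3 ((c * h + 1) / I); rewrite divfK ?gt_eqF//.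
  have ch : 0 <= c * h + 1 by rewrite addr_ge0// mulr_ge0// ltW.
  move=> /(_ (divr_ge0 ch I00)); lra.
have := Rint0_ae LI _ I_le0.
move=> /(_ (fun x => _)) AE.
apply: filterS (AE _) => [x|x]; last by apply: mulr_ge0 => //; rewrite indicE ler0n.
move=> Hx xa; move: Hx; rewrite indicE mem_set// mul1r /N0 => /eqP.
by rewrite paddr_eq0 ?sqr_ge0// !sqrf_eq0 => /andP[/eqP ? /eqP].
Qed.

End local_uniqueness.

(** * The product rule for weak derivatives *)
Section weak_product.
Context {R : realType} {n : nat}.
Local Notation V := 'rV[R]_n.
Local Notation mu := (lebesgue_rV R n).
Implicit Types (x y : V) (D K : set V) (f g h phi : V -> R) (i l : 'I_n).

Lemma compact_margin D K : compact K -> open D -> K `<=` D ->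
  exists2 d : R, 0 < d & forall e x, 0 < e -> e < d -> K x -> [set y | sqn (y - x) <= e ^+ 2] `<=` D.
Proof.
move=> cK oD KD.
have /compact_near_coveringP cK' := cK.
pose P (e : R) x := [set y | sqn (y - x) <= e ^+ 2] `<=` D.
have H x : K x -> \forall x' \near x & e \near 0^'+, P e x'.
  move=> Kx; have /nbhs_ballP[d /= d0 dU] := open_nbhs_nbhs (conj oD (KD x Kx)).
  exists (ball x (d / 2), [set e : R | 0 < e < d / 2]).
    split => /=; first by apply: nbhsx_ballx; rewrite divr_gt0.
    near=> e; rewrite /=; apply/andP; split; near: e.
      exact: nbhs_right_gt.
    by apply: nbhs_right_lt; rewrite divr_gt0.
  move=> [x' e] /= [xx' /andP[e0 ed]] y /= ye; apply: dU.
  rewrite mx_norm_ball /ball_ /= in xx'.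
  rewrite mx_norm_ball /ball_ /=.
  have yx : `|y - x'| <= e.
    have ee := ltW e0; rewrite -ler_sqr ?nnegrE//; exact: le_trans (norm_sqn _) ye.
  rewrite -(subrK x' x) -addrA; apply: (le_lt_trans (ler_normD _ _)).
  rewrite [`|x' - y|]distrC; lra.
have [d /= d0 Hd] : \forall e \near 0^'+, K `<=` P e by exact: cK'.
exists d => // e x e0 ed Kx; apply: (Hd e _ e0 x Kx).
by rewrite /ball_ /= sub0r normrN gtr0_norm.
Unshelve. all: by end_near. Qed.

(** Convergence of the mollifications tested against h in L^2, by Young's inequality
|p q| <= s q^2 + p^2 / s with s fixed first. *)
Lemma mollify_weak D f h : open D -> (mu D < +oo)%E -> L2 f -> supp_in D f -> L2 h -> forall eta : R, 0 < eta ->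
  exists2 d : R, 0 < d & forall e, 0 < e -> e < d ->
    `|\int[mu]_x ((mollify e f x - f x) * h x)| <= eta.
Proof.
move=> oD Doo L2f sf L2h eta eta0.
have Lf := L2_L1 (open_measurable_rV oD) Doo L2f sf.
have Lh2 := L2_sqr L2h.
pose H := \int[mu]_x (h x ^+ 2).
have H0 : 0 <= H by apply: Rintegral_ge0 => x _; exact: sqr_ge0.
pose s := eta / 2 / (H + 1).
have H1 : 0 < H + 1 by lra.
have s0 : 0 < s by rewrite !divr_gt0.
have sH : s * H <= eta / 2.
  rewrite /s -mulrA -[leRHS]mulr1; apply: ler_wpM2l; first by rewrite divr_ge0// ltW.
  by rewrite ler_pdivrMl// mulr1; lra.
have [d d0 Hd] := mollify_L2 oD Doo L2f sf (mulr_gt0 s0 (divr_gt0 eta0 (ltr0n _ 2))).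
exists d => // e e0 ed.
have cm : continuous (mollify e f) by exact: Ck_on_continuous (@mollify_Ck _ _ e f 0%N Lf).
have mm : measurable_fun [set: V] (fun x => mollify e f x - f x).
  by apply: measurable_funB; [exact: continuous_measurable_rV|case: L2f].
have L2m : L2 (fun x => mollify e f x - f x).
  by split => //; apply: (le_lt_trans (Hd e e0 ed)); rewrite ltry.
have Lm2 := L2_sqr L2m.
have I2 : \int[mu]_x ((mollify e f x - f x) ^+ 2) <= s * (eta / 2).
  by have := Hd e e0 ed; rewrite /l2sq Rint_EFin// lee_fin.
have Lb : L1 (fun x => s * h x ^+ 2 + s^-1 * (mollify e f x - f x) ^+ 2).
  by apply: L1D; exact: L1Z.
have pw x : `|(mollify e f x - f x) * h x| <= s * h x ^+ 2 + s^-1 * (mollify e f x - f x) ^+ 2.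
  move: (mollify e f x - f x) (h x) => p q;
      rewrite normrM -(real_normK (num_real p)) -(real_normK (num_real q)).
  move: `|p| `|q| (normr_ge0 p) (normr_ge0 q) => {}p {}q p0 q0.
  have : 0 <= s * (q - s^-1 * p) ^+ 2 by rewrite mulr_ge0 ?sqr_ge0// ltW.
  have -> : s * (q - s^-1 * p) ^+ 2 = s * q ^+ 2 - 2 * (p * q) + s^-1 * p ^+ 2.
    by field; rewrite gt_eqF.
  have : 0 <= p * q by rewrite mulr_ge0.
  lra.
have Lp : L1 (fun x => (mollify e f x - f x) * h x).
  apply: L1_le Lb _ => //; apply: measurable_funM => //; by case: L2h.
apply: le_trans (le_normr_Rintegral _ Lp) _ => //.
apply: (@le_trans _ _ (\int[mu]_x (s * h x ^+ 2 + s^-1 * (mollify e f x - f x) ^+ 2))).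
  by apply: le_Rintegral => //; exact: L1_norm.
rewrite Rint_lin//.
have : s^-1 * \int[mu]_x (mollify e f x - f x) ^+ 2 <= eta / 2.
  by rewrite ler_pdivrMl.
by rewrite -/H; lra.
Qed.

Lemma csupp_L2 K h : compact K -> continuous h -> supp_in K h -> L2 h.
Proof.
move=> cK ch sh; split; first exact: continuous_measurable_rV.
have L : L1 (fun x => h x ^+ 2).
  apply: (csupp_L1 cK); first by move=> x; exact: (contM (ch x) (ch x)).
  by move=> x /sh ->; rewrite expr0n.
by rewrite /l2sq Rint_EFin// ltry.
Qed.

Lemma L2_mul_L1 f h : L2 f -> L2 h -> L1 (fun x => f x * h x).
Proof.
move=> Hf Hh; apply: (L1_le (g := fun x => f x ^+ 2 + h x ^+ 2)).
- by apply: measurable_funM; [case: Hf|case: Hh].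
- by apply: L1D; exact: L2_sqr.
move=> x; rewrite normrM -(real_normK (num_real (f x))) -(real_normK (num_real (h x))).
have := sqr_ge0 (`|f x| - `|h x|); have : 0 <= `|f x| * `|h x| by rewrite mulr_ge0.
rewrite !expr2; lra.
Qed.

(** b phi is not a test function, as b is only of class C^1. Instead of b, f is mollified:
b f_e phi is of class C^1 with compact support, so that its derivative has integral zero, and e
tends to zero. *)
Lemma weak_product D i (b f g phi : V -> R) : open D -> (mu D < +oo)%E ->
  Ck_on D 1 b -> L2 f -> supp_in D f -> L2 g -> supp_in D g -> wderiv D i f g ->
  test_function D phi ->
  [/\ L1 (fun x => b x * f x * partial i phi x),
      L1 (fun x => (partial i b x * f x + b x * g x) * phi x) &
      \int[mu]_x (b x * f x * partial i phi x) =
      - \int[mu]_x ((partial i b x * f x + b x * g x) * phi x)].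
Proof.
move=> oD Doo Hb L2f sf L2g sg fg [Hphi cK KD].
pose K := closure [set x | phi x != 0].
have sphi : supp_in K phi.
  by move=> x Kx; apply/eqP; apply: contrapT => /negP px; apply: Kx; exact: subset_closure.
have clK : closed K by exact: closed_closure.
have spphi : supp_in K (partial i phi) by exact: supp_partial.
have Lf := L2_L1 (open_measurable_rV oD) Doo L2f sf.
have Lg := L2_L1 (open_measurable_rV oD) Doo L2g sg.
have CD (m : nat) : Ck_on D m phi by exact: Ck_on_subset (Hphi m).
pose h1 x := b x * partial i phi x.
pose h2 x := partial i b x * phi x.
pose h3 x := b x * phi x.
have s1 : supp_in K h1 by move=> x Kx; rewrite /h1 spphi// mulr0.
have s2 : supp_in K h2 by move=> x Kx; rewrite /h2 sphi// mulr0.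
have s3 : supp_in K h3 by move=> x Kx; rewrite /h3 sphi// mulr0.
have C1 : Ck_on setT 0%N h1.
  apply: (Ck_on_extend clK KD s1).
  exact: (Ck_onM oD (Ck_onW (leq0n 1%N) Hb) (Ck_on_partial i (CD 1%N))).
have C2 : Ck_on setT 0%N h2.
  by apply: (Ck_on_extend clK KD s2); exact: (Ck_onM oD (Ck_on_partial i Hb) (CD 0%N)).
have C3 : Ck_on setT 1%N h3.
  by apply: (Ck_on_extend clK KD s3); exact: (Ck_onM oD Hb (CD 1%N)).
have L2h1 := csupp_L2 cK (Ck_on_continuous C1) s1.
have L2h2 := csupp_L2 cK (Ck_on_continuous C2) s2.
have L2h3 := csupp_L2 cK (Ck_on_continuous C3) s3.
have E1 : (fun x => b x * f x * partial i phi x) = (fun x => f x * h1 x).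
  by apply/funext => x; rewrite /h1; ring.
have E2 : (fun x => (partial i b x * f x + b x * g x) * phi x) = (fun x => f x * h2 x + g x * h3 x).
  by apply/funext => x; rewrite /h2 /h3; ring.
have L1' := L2_mul_L1 L2f L2h1.
have L2' := L2_mul_L1 L2f L2h2.
have L3' := L2_mul_L1 L2g L2h3.
rewrite E1 E2; split => //; first exact: L1D.
have Ls : L2 (fun x => h1 x + h2 x).
  apply: (csupp_L2 cK (Ck_on_continuous (Ck_onD openT C1 C2))).
  by move=> x Kx; rewrite s1// s2// addr0.
apply/eqP; rewrite -subr_eq0 opprK RintegralD//.
have -> : \int[mu]_x (f x * h1 x) + (\int[mu]_x (f x * h2 x) + \int[mu]_x (g x * h3 x)) =
  \int[mu]_x (f x * (h1 x + h2 x)) + \int[mu]_x (g x * h3 x).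
  have -> : \int[mu]_x (f x * (h1 x + h2 x)) = \int[mu]_x (f x * h1 x) + \int[mu]_x (f x * h2 x).
    by rewrite -RintegralD//; congr Rintegral; apply/funext => x; rewrite mulrDr.
  by rewrite addrA.
rewrite -normr_le0; apply/ler_addgt0Pr => eta eta0; rewrite add0r.
have eta2 : 0 < eta / 2 by rewrite divr_gt0.
have [d1 d10 Hd1] := mollify_weak oD Doo L2f sf Ls eta2.
have [d2 d20 Hd2] := mollify_weak oD Doo L2g sg L2h3 eta2.
have [d3 d30 Hd3] := compact_margin cK oD KD.
pose e := Num.min d1 (Num.min d2 d3) / 2.
have m0 : 0 < Num.min d1 (Num.min d2 d3) by rewrite !lt_min d10 d20 d30.
have e0 : 0 < e by rewrite divr_gt0.
have : e < Num.min d1 (Num.min d2 d3) by rewrite /e ltr_pdivrMr// ltr_pMr// ltr1n.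
rewrite !lt_min => /and3P[ed1 ed2 ed3].
have C4 : Ck_on setT 1%N (fun x => h3 x * mollify e f x) by exact: (Ck_onM openT C3 (@mollify_Ck _ _ e
    f 1%N Lf)).
have s4 : supp_in K (fun x => h3 x * mollify e f x) by move=> x Kx; rewrite s3// mul0r.
have I0 := integral_partial i cK C4 s4.
have P x : partial i (fun x => h3 x * mollify e f x) x = mollify e f x * (h1 x + h2 x) + mollify e g x * h3 x.
  have [Kx|nKx] := pselect (K x); last first.
    by rewrite (supp_partial i clK s4 nKx) s1// s2// s3// addr0 !mulr0 addr0.
  have Dx := KD x Kx.
  rewrite partialM; [|exact: (Ck_on_derivable C3)|exact: (Ck_on_derivable (@mollify_Ck _ _ e f 1%N Lf))].
  rewrite (mollify_partial e0 Lf Lg fg (Hd3 e x e0 ed3 Kx)).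
  have -> : partial i h3 x = b x * partial i phi x + partial i b x * phi x.
    by rewrite partialM//; [exact: (Ck_on_derivable Hb)|exact: (Ck_on_derivable (Hphi 1%N))].
  by rewrite /h1 /h2; ring.
have cmf : L1 (fun x => mollify e f x * (h1 x + h2 x)).
  apply: (csupp_L1 cK).
    apply: (Ck_on_continuous (k := 0%N)); apply: (Ck_onM openT (@mollify_Ck _ _ e f 0%N Lf)).
    exact: (Ck_onD openT C1 C2).
  by move=> x Kx; rewrite s1// s2// addr0 mulr0.
have cmg : L1 (fun x => mollify e g x * h3 x).
  apply: (csupp_L1 cK).
    apply: (Ck_on_continuous (k := 0%N)); apply: (Ck_onM openT (@mollify_Ck _ _ e g 0%N Lg)).
    exact: Ck_onW C3.
  by move=> x Kx; rewrite s3// mulr0.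
have I1 : \int[mu]_x (mollify e f x * (h1 x + h2 x)) + \int[mu]_x (mollify e g x * h3 x) = 0.
  by rewrite -RintegralD// -[RHS]I0; congr Rintegral; apply/funext => x; rewrite P.
have Lfs := L2_mul_L1 L2f Ls.
have R1 : \int[mu]_x ((mollify e f x - f x) * (h1 x + h2 x)) =
   \int[mu]_x (mollify e f x * (h1 x + h2 x)) - \int[mu]_x (f x * (h1 x + h2 x)).
  by rewrite -RintegralB//; congr Rintegral; apply/funext => x; rewrite mulrBl.
have R2 : \int[mu]_x ((mollify e g x - g x) * h3 x) =
   \int[mu]_x (mollify e g x * h3 x) - \int[mu]_x (g x * h3 x).
  by rewrite -RintegralB//; congr Rintegral; apply/funext => x; rewrite mulrBl.
have -> : \int[mu]_x (f x * (h1 x + h2 x)) + \int[mu]_x (g x * h3 x) =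
   - (\int[mu]_x ((mollify e f x - f x) * (h1 x + h2 x)) + \int[mu]_x ((mollify e g x - g x) * h3 x)).
  by rewrite R1 R2; move: I1; lra.
rewrite normrN; apply: (le_trans (ler_normD _ _)).
by have := Hd1 e e0 ed1; have := Hd2 e e0 ed2; lra.
Qed.

End weak_product.

(** * Real and imaginary parts of complex Sobolev functions *)
Section complex_sobolev.
Context {R : realType} {n : nat}.
Local Notation V := 'rV[R]_n.
Local Notation mu := (lebesgue_rV R n).
Local Notation normc := ComplexField.Normc.normc.
Implicit Types (x y : V) (f g phi : V -> R) (w u v : V -> R[i]) (i k l : 'I_n).

Definition rpart D w : V -> R := patch (fun=> 0) D (fun x => complex.Re (w x)).
Definition ipart D w : V -> R := patch (fun=> 0) D (fun x => complex.Im (w x)).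

Lemma rpartE D w x : D x -> rpart D w x = complex.Re (w x).
Proof. by move=> Dx; rewrite /rpart patchE mem_set. Qed.

Lemma ipartE D w x : D x -> ipart D w x = complex.Im (w x).
Proof. by move=> Dx; rewrite /ipart patchE mem_set. Qed.

Lemma rpart_supp D w : supp_in D (rpart D w).
Proof. by move=> x Dx; rewrite /rpart patchE memNset. Qed.

Lemma ipart_supp D w : supp_in D (ipart D w).
Proof. by move=> x Dx; rewrite /ipart patchE memNset. Qed.

Lemma normc_sq (z : R[i]) : normc z ^+ 2 = complex.Re z ^+ 2 + complex.Im z ^+ 2.
Proof. by case: z => a b /=; rewrite sqr_sqrtr// addr_ge0 ?sqr_ge0. Qed.

Lemma normc_ge0 (z : R[i]) : 0 <= normc z.
Proof. by case: z => a b; exact: sqrtr_ge0. Qed.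

Lemma ReD (z1 z2 : R[i]) : complex.Re (z1 + z2) = complex.Re z1 + complex.Re z2.
Proof. by case: z1 => a b; case: z2. Qed.

Lemma ImD (z1 z2 : R[i]) : complex.Im (z1 + z2) = complex.Im z1 + complex.Im z2.
Proof. by case: z1 => a b; case: z2. Qed.

Lemma ReZ (a : R) (z : R[i]) : complex.Re (a%:C%C * z) = a * complex.Re z.
Proof. by case: z => b c /=; rewrite mul0r subr0. Qed.

Lemma ImZ (a : R) (z : R[i]) : complex.Im (a%:C%C * z) = a * complex.Im z.
Proof. by case: z => b c /=; rewrite mul0r addr0. Qed.

Lemma Re_sum (I : Type) (s : seq I) (F : I -> R[i]) :
  complex.Re (\sum_(j <- s) F j) = \sum_(j <- s) complex.Re (F j).
Proof. exact: (big_morph _ ReD erefl). Qed.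

Lemma Im_sum (I : Type) (s : seq I) (F : I -> R[i]) :
  complex.Im (\sum_(j <- s) F j) = \sum_(j <- s) complex.Im (F j).
Proof. exact: (big_morph _ ImD erefl). Qed.

Variables (D : set V) (oD : open D) (Doo : (mu D < +oo)%E).

Let mD : measurable D. Proof. exact: open_measurable_rV. Qed.

Lemma rpart_measurable w : measurable_fun D (fun x => complex.Re (w x)) <->
  measurable_fun [set: V] (rpart D w).
Proof. exact: (measurable_restrictT _ mD). Qed.

Lemma ipart_measurable w : measurable_fun D (fun x => complex.Im (w x)) <->
  measurable_fun [set: V] (ipart D w).
Proof. exact: (measurable_restrictT _ mD). Qed.

Lemma Lp_norm2E w : (Lp_norm D 2%:E w `^ 2 =
  \int[mu]_x ((rpart D w x) ^+ 2 + (ipart D w x) ^+ 2)%:E)%E.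
Proof.
rewrite /Lp_norm poweR_Lnorm//; apply: eq_integral => x _.
have [Dx|nD] := pselect (D x); last first.
  have -> : ((fun x => (normc (w x))%:E) \_ D) x = (0 : R)%:E by rewrite patchE memNset.
  rewrite abse_EFin normr0 poweR_EFin powR0 ?pnatr_eq0//.
  by rewrite rpart_supp// ipart_supp// expr0n/= addr0.
have -> : ((fun x => (normc (w x))%:E) \_ D) x = (normc (w x))%:E by rewrite patchE mem_set.
rewrite rpartE// ipartE// -normc_sq abse_EFin poweR_EFin ger0_norm ?normc_ge0//.
by rewrite powR_mulrn// normc_ge0.
Qed.

Lemma in_Lp2P w : in_Lp D 2%:E w <-> L2 (rpart D w) /\ L2 (ipart D w).
Proof.
split.
  move=> [/rpart_measurable mr /ipart_measurable mi Loo].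
  have : (Lp_norm D 2%:E w `^ 2 < +oo)%E by exact: poweR_lty.
  rewrite Lp_norm2E => H.
  have ms : measurable_fun [set: V] (fun x => ((rpart D w x) ^+ 2 + (ipart D w x) ^+ 2)%:E).
    by apply/measurable_EFinP; apply: measurable_funD; exact: measurable_funX.
  split; split => //; apply: le_lt_trans H; apply: ge0_le_integral => //.
  - by move=> x _; rewrite lee_fin sqr_ge0.
  - exact: measurable_sqrE.
  - by move=> x _; rewrite lee_fin lerDl sqr_ge0.
  - by move=> x _; rewrite lee_fin sqr_ge0.
  - exact: measurable_sqrE.
  - by move=> x _; rewrite lee_fin lerDr sqr_ge0.
move=> [[mr r2] [mi i2]]; split; [exact/rpart_measurable|exact/ipart_measurable|].
have Lr := L2_sqr (conj mr r2 : L2 (rpart D w)).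
have Li := L2_sqr (conj mi i2 : L2 (ipart D w)).
have : (Lp_norm D 2%:E w `^ 2 < +oo)%E.
  by rewrite Lp_norm2E Rint_EFin ?ltry//; exact: L1D.
by move/lty_poweRy; apply; rewrite pnatr_eq0.
Qed.

Lemma cintegralE w phi : cintegral D (fun x => w x * (phi x)%:C%C) =
  Complex (\int[mu]_x (rpart D w x * phi x)) (\int[mu]_x (ipart D w x * phi x)).
Proof.
have Er : \int[mu]_(x in D) complex.Re (w x * (phi x)%:C%C) = \int[mu]_x (rpart D w x * phi x).
  rewrite Rintegral_mkcond; apply: eq_Rintegral => x _.
  have [Dx|Dx] := pselect (D x).
    by rewrite patchE mem_set// rpartE// mulrC ReZ mulrC.
  by rewrite patchE memNset// rpart_supp// mul0r.
have Ei : \int[mu]_(x in D) complex.Im (w x * (phi x)%:C%C) = \int[mu]_x (ipart D w x * phi x).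
  rewrite Rintegral_mkcond; apply: eq_Rintegral => x _.
  have [Dx|Dx] := pselect (D x).
    by rewrite patchE mem_set// ipartE// mulrC ImZ mulrC.
  by rewrite patchE memNset// ipart_supp// mul0r.
by rewrite /cintegral Er Ei.
Qed.

Lemma weak_derivative1P i u v : is_weak_derivative D [:: i] u v <->
  wderiv D i (rpart D u) (rpart D v) /\ wderiv D i (ipart D u) (ipart D v).
Proof.
have E (a b c d : R) : Complex a b = (-1) ^+ 1 * Complex c d <-> a = - c /\ b = - d.
  rewrite expr1 mulN1r; split; first by move=> [-> ->].
  by move=> [-> ->].
split.
  move=> H; split => phi Tphi; have := H phi Tphi; rewrite !cintegralE /= => /E[]//.
move=> [Hr Hi] phi Tphi; rewrite !cintegralE; apply/E; split; [exact: Hr|exact: Hi].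
Qed.

Lemma weak_derivative2P i j u v : is_weak_derivative D [:: i; j] u v ->
  forall phi, test_function D phi ->
  \int[mu]_x (rpart D u x * partial i (partial j phi) x) = \int[mu]_x (rpart D v x * phi x) /\
  \int[mu]_x (ipart D u x * partial i (partial j phi) x) = \int[mu]_x (ipart D v x * phi x).
Proof.
move=> H phi Tphi; have := H phi Tphi.
by rewrite !cintegralE /= sqrrN expr1n mul1r => -[].
Qed.

Lemma test_partial phi i : test_function D phi -> test_function D (partial i phi).
Proof.
move=> [H1 cK KD].
have sphi : supp_in (closure [set x | phi x != 0]) phi.
  by move=> x Kx; apply/eqP; apply: contrapT => /negP px; apply: Kx; exact: subset_closure.
have sub : closure [set x | partial i phi x != 0] `<=` closure [set x | phi x != 0].
  rewrite [X in _ `<=` X](closure_id _).1; last exact: closed_closure.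
  apply: closureS => x /= px; apply: contrapT => nx; move/eqP: px; apply.
  exact: (supp_partial i (@closed_closure _ _) sphi nx).
split.
- by move=> k; apply: Ck_on_partial; exact: H1.
- by apply: (subclosed_compact _ cK sub); exact: closed_closure.
- exact: subset_trans KD.
Qed.

Lemma wderiv_uniq i f g g' : L2 g -> supp_in D g -> L2 g' -> supp_in D g' ->
  wderiv D i f g -> wderiv D i f g' -> {ae mu, forall x, g x = g' x}.
Proof.
move=> Lg sg Lg' sg' H H'.
have Lgg : L2 (fun x => g x - g' x).
  split; first by apply: measurable_funB; [case: Lg|case: Lg'].
  apply: le_lt_trans (l2sqB _ _) _; [by case: Lg|by case: Lg'|].
  rewrite /l2sq Rint_EFin ?(L2_sqr Lg)// Rint_EFin ?(L2_sqr Lg')//.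
  by rewrite -!EFinM -EFinD ltry.
suff : {ae mu, forall x, g x - g' x = 0}.
  by apply: filterS => x /eqP; rewrite subr_eq0 => /eqP.
apply: (dubois_reymond oD Doo Lgg); first by move=> x Dx; rewrite sg// sg'// subr0.
move=> phi Tphi; have [Cphi cK KD] := Tphi.
have Lphi : L2 phi.
  apply: (csupp_L2 cK (Ck_on_continuous (Cphi 0%N))).
  by move=> x Kx; apply/eqP; apply: contrapT => /negP px; apply: Kx; exact: subset_closure.
have := H' phi Tphi; rewrite (H phi Tphi) => /oppr_inj E.
have -> : (fun x => (g x - g' x) * phi x) = (fun x => g x * phi x - g' x * phi x).
  by apply/funext => x; rewrite mulrBl.
by rewrite RintegralB ?E ?subrr//; exact: L2_mul_L1.
Qed.

Lemma L2D f g : L2 f -> L2 g -> L2 (fun x => f x + g x).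
Proof.
move=> Lf Lg; split; first by apply: measurable_funD; [case: Lf|case: Lg].
apply: le_lt_trans (l2sqD _ _) _; [by case: Lf|by case: Lg|].
by rewrite /l2sq Rint_EFin ?(L2_sqr Lf)// Rint_EFin ?(L2_sqr Lg)// -!EFinM -EFinD ltry.
Qed.

Lemma L2_sum (I : Type) (s : seq I) (F : I -> V -> R) : (forall a, L2 (F a)) ->
  L2 (fun x => \sum_(a <- s) F a x).
Proof.
move=> H; elim: s => [|c s IH].
  under eq_fun do rewrite big_nil.
  split => //; rewrite /l2sq integral0_eq// => x _; by rewrite expr0n.
by under eq_fun do rewrite big_cons; exact: L2D.
Qed.

Lemma L2_mul_bounded (b f : V -> R) (B : R) : measurable_fun D b ->
  (forall x, D x -> `|b x| <= B) -> L2 f -> supp_in D f -> L2 (fun x => b x * f x).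
Proof.
move=> mb Hb Lf sf; have [mf _] := Lf.
have E : (fun x => b x * f x) = (fun x => patch (fun=> 0) D b x * f x).
  apply/funext => x; rewrite patchE; case: ifPn => // /negP Dx.
  by rewrite sf ?mulr0// => Dx'; apply: Dx; rewrite mem_set.
have mbf : measurable_fun [set: V] (fun x => b x * f x).
  rewrite E; apply: measurable_funM => //; exact/(measurable_restrictT _ mD).
have L : L1 (fun x => (b x * f x) ^+ 2).
  apply: (L1_le (g := fun x => B ^+ 2 * f x ^+ 2)).
  - exact: measurable_funX.
  - by apply: L1Z; exact: L2_sqr.
  move=> x; rewrite ger0_norm ?sqr_ge0// exprMn.
  have [Dx|Dx] := pselect (D x); last by rewrite sf// expr0n/= !mulr0.
  apply: ler_wpM2r; first exact: sqr_ge0.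
  rewrite -real_normK ?num_real// ler_sqr ?nnegrE//; first exact: Hb.
  exact: le_trans (Hb x Dx).
by split => //; rewrite /l2sq Rint_EFin// ltry.
Qed.

(** The norm is an essential supremum, apart from a null measure, for which it is zero by
convention and everything holds almost everywhere. *)
Lemma ae_Lpoo w (M : R) : (Lp_norm D +oo%E w <= M%:E)%E ->
  {ae mu, forall x, D x -> normc (w x) <= M}.
Proof.
rewrite /Lp_norm unlock /=; case: ifPn => [mu0|].
  move=> /ess_sup_inf.ess_supP; apply: filterS => x; rewrite /= patchE => H Dx; move: H.
  by rewrite mem_set// abse_EFin lee_fin ger0_norm ?normc_ge0.
rewrite -leNgt => mu0 _.
exists [set: V]; split => //; apply/eqP; rewrite eq_le mu0/=; exact: measure_ge0.
Qed.

Lemma within_bounded (g : V -> R) (C : set V) : compact C -> {within C, continuous g} ->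
  exists2 M : R, 0 < M & forall x, C x -> `|g x| <= M.
Proof.
move=> cC cg; have := compact_bounded (continuous_compact cg cC).
move=> [M [_ HM]]; exists (`|M| + 1); first by rewrite ltr_wpDl.
move=> x Cx; apply: (HM (`|M| + 1)); last by exists x.
by rewrite (le_lt_trans (ler_norm M))// ltrDl.
Qed.

End complex_sobolev.

(** * The divergence form operator on H^2 *)
Section identification.
Context {R : realType} {n : nat}.
Local Notation V := 'rV[R]_n.
Local Notation mu := (lebesgue_rV R n).
Implicit Types (x y : V) (phi : V -> R) (w v : V -> R[i]) (i k l : 'I_n) (j : jet n).

Variables (D : set V) (oD : open D) (bD : bounded_set D).
Variables (A : V -> 'M[R]_n) (u : V -> R[i]).
Hypothesis HA : forall k l, C21_closure D (fun x => A x k l).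
Hypothesis Hu : sobolev_H2 D u.

Let a k l x : R := A x k l.

Let Doo : (mu D < +oo)%E.
Proof. exact: bounded_finite_measure (open_measurable_rV oD) bD. Qed.

Let Ha k l : Ck_on D 1 (a k l).
Proof. by have [[H _ _] _] := HA k l; exact: Ck_onW H. Qed.

(** The derivatives up to order one extend continuously to the closure of D, a compact set. *)
Lemma coef_bounded : exists2 B : R, 0 < B &
  forall k l x, D x -> `|a k l x| <= B /\ `|partial k (a k l) x| <= B.
Proof.
have cC : compact (closure D).
  have [M [_ HM]] := bD.
  pose r : R := `|M| + 1.
  have Mr : M < r by rewrite (le_lt_trans (ler_norm M))// ltrDl.
  have sub : closure D `<=` [set x : V | sqn (x - 0) <= n%:R * r ^+ 2].
    rewrite [X in _ `<=` X](closure_id _).1; last first.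
      exact: compact_closed (@norm_hausdorff _ _) (@compact_sqn_ball R n 0 _).
    apply: closureS => x Dx /=; rewrite subr0; apply: (le_trans (sqn_norm x)).
    apply: ler_wpM2l; first exact: ler0n.
    rewrite ler_sqr ?nnegrE//; first exact: HM.
    by rewrite addr_ge0.
  by apply: (subclosed_compact _ (@compact_sqn_ball R n 0 _) sub); exact: closed_closure.
have H (s : seq 'I_n) (k l : 'I_n) : (size s <= 2)%N ->
    exists2 M : R, 0 < M & forall x, D x -> `|partials s (a k l) x| <= M.
  move=> s2; have [[_ _ /(_ s s2) [g cg gE]] _] := HA k l.
  have [M M0 HM] := within_bounded cC cg.
  exists M => // x Dx; rewrite -[partials _ _ _]/(partials s (fun x => A x k l) x) -gE//.
  by apply: HM; exact: subset_closure.
have [B1 B10 H1] := family_bounded (I := ('I_n * 'I_n)%type) (F := fun c => a c.1 c.2)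
  (fun c => H [::] c.1 c.2 isT).
have [B2 B20 H2] := family_bounded (I := ('I_n * 'I_n)%type) (F := fun c => partial c.1 (a c.1 c.2))
  (fun c => H [:: c.1] c.1 c.2 isT).
exists (B1 + B2); first exact: addr_gt0.
move=> k l x Dx; split.
  by apply: (le_trans (H1 (k, l) x Dx)); rewrite lerDl ltW.
by apply: (le_trans (H2 (k, l) x Dx)); rewrite lerDr ltW.
Qed.

Lemma flux_wderiv (J : jet n -> V -> R) k : H2jet D J ->
  wderiv D k (fun x => \sum_l a k l x * J (Some (inl l)) x)
    (fun x => \sum_l (partial k (a k l) x * J (Some (inl l)) x + a k l x * J (Some (inr (l, k))) x)).
Proof.
move=> HJ phi Tphi.
have P l := weak_product oD Doo (Ha k l) (H2jet_L2 HJ _) (H2jet_supp HJ _) (H2jet_L2 HJ _)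
  (H2jet_supp HJ _) (H2jet_hess HJ l k) Tphi.
under eq_Rintegral do rewrite mulr_suml.
under [in RHS]eq_Rintegral do rewrite mulr_suml.
rewrite Rint_sum; last by move=> l; have [] := P l.
rewrite Rint_sum; last by move=> l; have [] := P l.
by rewrite -sumrN; apply: eq_bigr => l _; have [] := P l.
Qed.

(** With bounded coefficients the divergence of the flux is square-integrable, so that it is an
admissible representative in the definition of the weak derivative of the flux. *)
Lemma flux_L2 (J : jet n -> V -> R) k : H2jet D J ->
  L2 (fun x => \sum_l (partial k (a k l) x * J (Some (inl l)) x + a k l x * J (Some (inr (l, k))) x)).
Proof.
move=> HJ; have [B B0 HB] := coef_bounded.
apply: L2_sum => l; apply: L2D.
  apply: (L2_mul_bounded oD (B := B)); [|by move=> x /(HB k l)[]|exact: (H2jet_L2 HJ)|exact: (H2jet_supp HJ)].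
  by apply: continuous_on_measurable => // x Dx; exact: (Ck_on_cont (Ck_on_partial k (Ha k l))).
apply: (L2_mul_bounded oD (B := B)); [|by move=> x /(HB k l)[]|exact: (H2jet_L2 HJ)|exact: (H2jet_supp HJ)].
by apply: continuous_on_measurable => // x Dx; exact: (Ck_on_cont (Ha k l)).
Qed.

Lemma weak_partialP i w : (exists2 v, in_Lp D 2%:E v & is_weak_derivative D [:: i] w v) ->
  in_Lp D 2%:E (weak_partial D i w) /\ is_weak_derivative D [:: i] w (weak_partial D i w).
Proof.
move=> [v Lv Hv].
exact: (@xgetPex _ (fun=> 0) [set v | in_Lp D 2%:E v /\ is_weak_derivative D [:: i] w v]
  (ex_intro _ v (conj Lv Hv))).
Qed.

Definition sobolev_jet (Vd : 'I_n -> 'I_n -> V -> R[i]) j : V -> R[i] := match j with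
  | None => u
  | Some (inl l) => weak_partial D l u
  | Some (inr (l, k)) => Vd l k
  end.

(** The second derivatives Vd l k given by the definition of H^2 are tested against derivatives of
order two of test functions. Since the derivative along k of a test function is a test function,
Vd l k is also the weak derivative along k of the first derivative along l. The product rule
then gives a weak derivative of the flux, and the chosen one agrees with it almost everywhere. *)
Lemma sobolev_jetP : exists Vd : 'I_n -> 'I_n -> V -> R[i],
  [/\ H2jet D (fun j => rpart D (sobolev_jet Vd j)),
      H2jet D (fun j => ipart D (sobolev_jet Vd j)) &
   {ae mu, forall x, D x -> Delta_A D A u x = \sum_k \sum_l
     ((partial k (a k l) x)%:C%C * weak_partial D l u x + (A x k l)%:C%C * Vd l k x)}].
Proof.
have [Lu H2] := Hu.
have WP l := weak_partialP (H2 [:: l] isT).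
pose P2 l k := cid2 (H2 [:: l; k] isT).
pose Vd l k := sval (P2 l k).
have VL l k : in_Lp D 2%:E (Vd l k) by rewrite /Vd; case: (P2 l k).
have VW l k : is_weak_derivative D [:: l; k] u (Vd l k) by rewrite /Vd; case: (P2 l k).
have L2j j : in_Lp D 2%:E (sobolev_jet Vd j).
  by case: j => [[l|[l k]]|] //=; case: (WP l).
have Hr : H2jet D (fun j => rpart D (sobolev_jet Vd j)).
  split.
  - by move=> j; have [] := (in_Lp2P oD _).1 (L2j j).
  - by move=> j; exact: rpart_supp.
  - by move=> l; have [_ /weak_derivative1P[]] := WP l.
  - move=> l k phi Tphi /=; have [_ /weak_derivative1P[+ _]] := WP l.
    move=> /(_ _ (test_partial k Tphi)) E.
    have [<- _] := weak_derivative2P (VW l k) Tphi.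
    by rewrite E opprK.
have Hi : H2jet D (fun j => ipart D (sobolev_jet Vd j)).
  split.
  - by move=> j; have [] := (in_Lp2P oD _).1 (L2j j).
  - by move=> j; exact: ipart_supp.
  - by move=> l; have [_ /weak_derivative1P[]] := WP l.
  - move=> l k phi Tphi /=; have [_ /weak_derivative1P[_ +]] := WP l.
    move=> /(_ _ (test_partial k Tphi)) E.
    have [_ <-] := weak_derivative2P (VW l k) Tphi.
    by rewrite E opprK.
exists Vd; split => //.
pose g k y := \sum_l (A y k l)%:C%C * weak_partial D l u y.
pose h k y := \sum_l ((partial k (a k l) y)%:C%C * weak_partial D l u y + (A y k l)%:C%C * Vd l k y).
suff K k : {ae mu, forall x, D x -> weak_partial D k (g k) x = h k x}.
  have : {ae mu, forall x, forall k, D x -> weak_partial D k (g k) x = h k x} by exact: filter_forall.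
  apply: filterS => x Hx Dx.
  by rewrite /Delta_A; apply: eq_bigr => k _; exact: Hx.
have rg : rpart D (g k) = (fun x => \sum_l a k l x * rpart D (sobolev_jet Vd (Some (inl l))) x).
  apply/funext => x; have [Dx|Dx] := pselect (D x).
    by rewrite rpartE// Re_sum; apply: eq_bigr => l _; rewrite ReZ rpartE.
  by rewrite rpart_supp// big1// => l _; rewrite rpart_supp// mulr0.
have ig : ipart D (g k) = (fun x => \sum_l a k l x * ipart D (sobolev_jet Vd (Some (inl l))) x).
  apply/funext => x; have [Dx|Dx] := pselect (D x).
    by rewrite ipartE// Im_sum; apply: eq_bigr => l _; rewrite ImZ ipartE.
  by rewrite ipart_supp// big1// => l _; rewrite ipart_supp// mulr0.
have rh : rpart D (h k) = (fun x => \sum_l (partial k (a k l) x * rpart D (sobolev_jet Vd (Some (inl l))) x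
    + a k l x * rpart D (sobolev_jet Vd (Some (inr (l, k)))) x)).
  apply/funext => x; have [Dx|Dx] := pselect (D x).
    by rewrite rpartE// Re_sum; apply: eq_bigr => l _; rewrite ReD !ReZ !rpartE.
  by rewrite rpart_supp// big1// => l _; rewrite !rpart_supp// !mulr0 addr0.
have ih : ipart D (h k) = (fun x => \sum_l (partial k (a k l) x * ipart D (sobolev_jet Vd (Some (inl l))) x
    + a k l x * ipart D (sobolev_jet Vd (Some (inr (l, k)))) x)).
  apply/funext => x; have [Dx|Dx] := pselect (D x).
    by rewrite ipartE// Im_sum; apply: eq_bigr => l _; rewrite ImD !ImZ !ipartE.
  by rewrite ipart_supp// big1// => l _; rewrite !ipart_supp// !mulr0 addr0.
have Lrh : L2 (rpart D (h k)) by rewrite rh; exact: flux_L2 Hr.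
have Lih : L2 (ipart D (h k)) by rewrite ih; exact: flux_L2 Hi.
have Wr : wderiv D k (rpart D (g k)) (rpart D (h k)) by rewrite rg rh; exact: flux_wderiv Hr.
have Wi : wderiv D k (ipart D (g k)) (ipart D (h k)) by rewrite ig ih; exact: flux_wderiv Hi.
have [dL dW] : in_Lp D 2%:E (weak_partial D k (g k)) /\
    is_weak_derivative D [:: k] (g k) (weak_partial D k (g k)).
  apply: weak_partialP; exists (h k); first exact/(in_Lp2P oD).
  exact/weak_derivative1P.
have [dr di] := (in_Lp2P oD _).1 dL.
have [wr wi] := (weak_derivative1P _ _ _ _).1 dW.
have Er := wderiv_uniq oD Doo dr (@rpart_supp _ _ _ _) Lrh (@rpart_supp _ _ _ _) wr Wr.
have Ei := wderiv_uniq oD Doo di (@ipart_supp _ _ _ _) Lih (@ipart_supp _ _ _ _) wi Wi.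
apply: filterS2 Er Ei => x er ei Dx.
move: er ei; rewrite !rpartE// !ipartE// => er ei.
by apply/eqP; rewrite eq_complex er ei !eqxx.
Qed.

End identification.

(** * Propagation over a connected set *)
Section propagation.
Context {R : realType} {n : nat}.
Local Notation V := 'rV[R]_n.
Local Notation mu := (lebesgue_rV R n).
Local Notation normc := ComplexField.Normc.normc.
Implicit Types (x y : V).

Lemma normc_sum (I : Type) (s : seq I) (F : I -> R[i]) :
  normc (\sum_(c <- s) F c) <= \sum_(c <- s) normc (F c).
Proof.
elim: s => [|c s IH]; first by rewrite !big_nil /= expr0n/= addr0 sqrtr0.
by rewrite !big_cons; apply: le_trans (le_normcD _ _) _; rewrite lerD2l.
Qed.

Lemma lower_order_bound (z q u : R[i]) (p w : 'I_n -> R[i]) (m : R) : 0 <= m ->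
  (forall l, normc (p l) <= m) -> normc q <= m ->
  z + \sum_l p l * w l + q * u = 0 ->
  normc z ^+ 2 <= (n.+1%:R * m) ^+ 2 * (normc u ^+ 2 + \sum_l normc (w l) ^+ 2).
Proof.
move=> m0 pm qm E.
pose N := normc u ^+ 2 + \sum_l normc (w l) ^+ 2.
have S0 : 0 <= \sum_l normc (w l) ^+ 2 by apply: sumr_ge0 => l _; exact: sqr_ge0.
have N0 : 0 <= N by rewrite addr_ge0 ?sqr_ge0.
pose t := Num.sqrt N.
have t2 : t ^+ 2 = N by rewrite sqr_sqrtr.
have ut : normc u <= t.
  by rewrite -ler_sqr ?nnegrE ?normc_ge0 ?sqrtr_ge0// t2 lerDl.
have wt l : normc (w l) <= t.
  rewrite -ler_sqr ?nnegrE ?normc_ge0 ?sqrtr_ge0// t2 /N (bigD1 l)//= addrCA lerDl.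
  by rewrite addr_ge0 ?sqr_ge0// sumr_ge0// => i _; exact: sqr_ge0.
have -> : normc z = normc (\sum_l p l * w l + q * u).
  have -> : z = - (\sum_l p l * w l + q * u) by apply/eqP; rewrite -addr_eq0 addrA E.
  by case: (_ + _) => b c /=; rewrite !sqrrN.
have H : normc (\sum_l p l * w l + q * u) <= n.+1%:R * m * t.
  apply: le_trans (le_normcD _ _) _.
  have H1 : normc (\sum_l p l * w l) <= n%:R * (m * t).
    apply: le_trans (normc_sum _ _) _.
    apply: (@le_trans _ _ (\sum_(l < n) m * t)); last by rewrite sumr_const card_ord mulr_natl.
    apply: ler_sum => l _; rewrite ComplexField.Normc.normcM.
    by apply: ler_pM; rewrite ?normc_ge0.
  have H2 : normc (q * u) <= m * t.
    by rewrite ComplexField.Normc.normcM; apply: ler_pM; rewrite ?normc_ge0.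
  have -> : n.+1%:R * m * t = n%:R * (m * t) + m * t by rewrite -natr1; ring.
  exact: lerD.
rewrite -/N -t2 -exprMn ler_sqr ?nnegrE ?normc_ge0//.
by rewrite !mulr_ge0 ?ler0n ?sqrtr_ge0.
Qed.

Lemma sqnB_le (x y z : V) : sqn (x - z) <= 2 * sqn (x - y) + 2 * sqn (y - z).
Proof.
rewrite /sqn !mulr_sumr -big_split; apply: ler_sum => i _ /=; rewrite !mxE.
have := sqr_ge0 ((x 0 i - y 0 i) - (y 0 i - z 0 i)); rewrite !expr2; lra.
Qed.

Lemma sqnBC (x y : V) : sqn (x - y) = sqn (y - x).
Proof. by apply: eq_bigr => i _; rewrite !mxE; ring. Qed.

Lemma open_sqn_sub (D : set V) x : open D -> D x ->
  exists2 r : R, 0 < r & [set y | sqn (y - x) < r] `<=` D.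
Proof.
move=> oD Dx; have /nbhs_ballP[d /= d0 dU] := open_nbhs_nbhs (conj oD Dx).
exists (d ^+ 2); first exact: exprn_gt0.
move=> y /= yd; apply: dU; rewrite mx_norm_ball /ball_ /= distrC.
rewrite -ltr_sqr ?nnegrE//; last exact: ltW.
exact: le_lt_trans (norm_sqn _) yd.
Qed.

(** The set of points around which Z holds almost everywhere is open. The step makes it closed in D:
a limit point x of the set is close to a member z, and the ball around z provided by the step
contains a neighbourhood of x. *)
Lemma connected_propagation (D : set V) (Z : V -> Prop) : open D -> connected D ->
  (exists2 x, D x & exists2 r : R, 0 < r & {ae mu, forall y, sqn (y - x) < r -> Z y}) ->
  (forall x (s r b : R), 0 < s -> 0 < r -> r < b -> [set y | sqn (y - x) <= b] `<=` D ->
    {ae mu, forall y, sqn (y - x) < s -> Z y} -> {ae mu, forall y, sqn (y - x) < r -> Z y}) ->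
  {ae mu, forall x, D x -> Z x}.
Proof.
move=> oD conD [x1 Dx1 [r1 r10 H1]] step.
pose G : set V := [set x | exists2 r : R, 0 < r & {ae mu, forall y, sqn (y - x) < r -> Z y}].
have oG : open G.
  rewrite openE => x [r r0 Hr]; rewrite /interior.
  have r4 : 0 < r / 4 by rewrite divr_gt0.
  have : nbhs x [set y | sqn (y - x) < r / 4].
    apply: open_nbhs_nbhs; split; first exact: open_sqn_ball.
    by rewrite /= subrr /sqn big1// => i _; rewrite mxE mul0r.
  apply: filterS => x' /= xx'; exists (r / 4) => //.
  apply: filterS Hr => y Hy yx'; apply: Hy; apply: (le_lt_trans (sqnB_le y x' x)).
  lra.
have clG x : D x -> closure G x -> G x.
  move=> Dx cx; have [d d0 dD] := open_sqn_sub oD Dx.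
  (* |p + q|^2 <= 2 |p|^2 + 2 |q|^2, hence the ball of squared radius 8 r around z stays within
     squared distance 2 (8 r) + 2 r of x *)
  pose r := d / 20.
  have r0 : 0 < r by rewrite divr_gt0.
  have : nbhs x [set y | sqn (y - x) < r].
    apply: open_nbhs_nbhs; split; first exact: open_sqn_ball.
    by rewrite /= subrr /sqn big1// => i _; rewrite mxE mul0r.
  move=> /cx [z [[s s0 Hs] /= zx]].
  have h8 : [set y | sqn (y - z) <= 8 * r] `<=` D.
    move=> y /= yz; apply: dD => /=; apply: (le_lt_trans (sqnB_le y z x)).
    by rewrite /r in yz zx *; lra.
  have r4 : 0 < 4 * r by rewrite mulr_gt0.
  have r48 : 4 * r < 8 * r by lra.
  have H := step z s (4 * r) (8 * r) s0 r4 r48 h8 Hs.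
  exists r => //; apply: filterS H => y Hy yx; apply: Hy.
  apply: (le_lt_trans (sqnB_le y x z)); rewrite (sqnBC x z); lra.
have DG : D `<=` G.
  have <- : D `&` G = D.
    apply: conD.
    - by exists x1; split => //; exists r1.
    - by exists G.
    - exists (closure G); first exact: closed_closure.
      apply/seteqP; split => x [Dx Gx]; split => //; first exact: subset_closure.
      exact: clG.
  by move=> x [].
have [|B C BC|F [mF cF]] := @countable_ball_cover R n (fun B => {ae mu, forall y, B y -> Z y}).
- by apply: aeW => y.
- by apply: filterS => y Hy /BC.
have := ae_foralln (fun k => (mF k).2); apply: filterS => x Hx Dx.
have [r r0 Hr] := DG x Dx.
pose d := Num.min 1 (r / n.+1%:R).
have N0 : 0 < n.+1%:R :> R by rewrite ltr0n.
have d0 : 0 < d by rewrite lt_min ltr01 divr_gt0.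
have [] := cF x d d0; last by move=> k; exact: Hx.
apply: filterS Hr => y Hy xy; apply: Hy.
rewrite mx_norm_ball /ball_ /= distrC in xy.
apply: (le_lt_trans (sqn_norm _)).
have d1 : d <= 1 by rewrite ge_min lexx.
have dr : d <= r / n.+1%:R by rewrite ge_min lexx orbT.
have yd : `|y - x| ^+ 2 <= d.
  rewrite expr2 -[leRHS]mulr1; apply: ler_pM => //; first exact: ltW.
  by apply: le_trans d1; exact: ltW.
have h1 := ler_wpM2l (ler0n R n) yd.
apply: (le_lt_trans h1).
have h2 : n.+1%:R * d <= r by rewrite -ler_pdivlMl// mulrC.
by apply: lt_le_trans h2; rewrite ltr_pM2r// ltr_nat.
Qed.

End propagation.

Theorem theorem4p2 (R : realType) (n : nat) (hn : (2 <= n)%N)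
  (Omega : set 'rV[R]_n) (hOmega : bounded_lipschitz_domain Omega)
  (m kappa : R) (hm : 0 < m) (hkappa : 1 <= kappa)
  (A : 'rV[R]_n -> 'M[R]_n) (hA : elliptic_class Omega kappa m A)
  (p : 'I_n -> 'rV[R]_n -> R[i]) (q : 'rV[R]_n -> R[i])
  (hp : forall l, in_Lp Omega +oo%E (p l) /\ (Lp_norm Omega +oo%E (p l) <= m%:E)%E)
  (hq : in_Lp Omega +oo%E q /\ (Lp_norm Omega +oo%E q <= m%:E)%E)
  (u : 'rV[R]_n -> R[i]) (hu : sobolev_H2 Omega u)
  (hLu : ae_zero_on Omega (L_A_e Omega A p q u))
  (omega : set 'rV[R]_n) (homega_open : open omega)
  (homega_neq0 : omega !=set0) (homega_sub : omega `<=` Omega)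
  (hu0 : ae_zero_on omega u) :
  ae_zero_on Omega u.
Proof.
have [oO conO bO _] := hOmega.
have [symA C21A ellA _] := hA.
have Doo := bounded_finite_measure (open_measurable_rV oO) bO.
have [Vd [Hr Hi HD]] := sobolev_jetP oO bO C21A hu.
pose a k l x := A x k l.
have Ha k l : Ck_on Omega 1 (a k l) by have [[H _ _] _] := C21A k l; exact: Ck_onW H.
have symA' k l x : Omega x -> a k l x = a l k x.
  move=> Ox; have := symA x (subset_closure Ox) => /(congr1 (fun M : 'M[R]_n => M l k)).
  by rewrite mxE.
have k0 : 0 < kappa^-1 by rewrite invr_gt0; apply: lt_le_trans hkappa.
have ell x (xi : 'I_n -> R) : Omega x ->
    kappa^-1 * \sum_k xi k ^+ 2 <= \sum_k \sum_l a k l x * xi l * xi k.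
  move=> Ox; have /andP[H _] := ellA x (\col_k xi k) Ox.
  have E1 : enorm (\col_k xi k) ^+ 2 = \sum_k xi k ^+ 2.
    rewrite /enorm sqr_sqrtr; last by apply: sumr_ge0 => k _; apply: sumr_ge0 => l _; exact: sqr_ge0.
    by apply: eq_bigr => k _; rewrite big_ord1 mxE.
  rewrite E1 in H; apply: (le_trans H); rewrite le_eqVlt; apply/orP; left; apply/eqP.
  rewrite mxE exchange_big /=; apply: eq_bigr => l _.
  by rewrite !mxE mulr_suml; apply: eq_bigr => k _; rewrite !mxE /a; ring.
pose J j := rpart Omega (sobolev_jet Omega u Vd j).
pose J' j := ipart Omega (sobolev_jet Omega u Vd j).
pose M := (n.+1%:R * m) ^+ 2.
have M0 : 0 <= M by exact: sqr_ge0.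
have HL : {ae lebesgue_rV R n, forall x, Omega x ->
    div_form a (J ^~ x) x ^+ 2 + div_form a (J' ^~ x) x ^+ 2 <=
    M * ((J None x ^+ 2 + J' None x ^+ 2) + (jet_grad_sq (J ^~ x) + jet_grad_sq (J' ^~ x)))}.
  have Hp : {ae lebesgue_rV R n, forall x, forall l, Omega x -> ComplexField.Normc.normc (p l x) <= m}.
    by apply: filter_forall => l; exact: ae_Lpoo (hp l).2.
  have Hq := ae_Lpoo hq.2.
  apply: filterS2 (filterI HD Hp) (filterI Hq hLu) => x [HDx' Hpx'] [Hqx' HLx'] Ox.
  have HDx := HDx' Ox; have Hpx l := Hpx' l Ox; have Hqx := Hqx' Ox; have HLx := HLx' Ox.
  have := lower_order_bound (ltW hm) Hpx Hqx HLx.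
  rewrite -/M !normc_sq HDx.
  have -> : complex.Re (\sum_k \sum_l ((partial k (a k l) x)%:C%C * weak_partial Omega l u x +
      (A x k l)%:C%C * Vd l k x)) = div_form a (J ^~ x) x.
    rewrite Re_sum; apply: eq_bigr => k _; rewrite Re_sum; apply: eq_bigr => l _.
    by rewrite ReD !ReZ /J !rpartE.
  have -> : complex.Im (\sum_k \sum_l ((partial k (a k l) x)%:C%C * weak_partial Omega l u x +
      (A x k l)%:C%C * Vd l k x)) = div_form a (J' ^~ x) x.
    rewrite Im_sum; apply: eq_bigr => k _; rewrite Im_sum; apply: eq_bigr => l _.
    by rewrite ImD !ImZ /J' !ipartE.
  have -> : \sum_l ComplexField.Normc.normc (weak_partial Omega l u x) ^+ 2 =
      jet_grad_sq (J ^~ x) + jet_grad_sq (J' ^~ x).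
    by rewrite -big_split; apply: eq_bigr => l _; rewrite normc_sq /J /J' rpartE// ipartE.
  by rewrite /J /J' rpartE// ipartE.
have Z : {ae lebesgue_rV R n, forall x, Omega x -> J None x = 0 /\ J' None x = 0}.
  apply: connected_propagation => //.
    have [x0 ox0] := homega_neq0.
    exists x0; first exact: homega_sub.
    have [r r0 rO] := open_sqn_sub homega_open ox0.
    exists r => //; apply: filterS hu0 => y Hy yr.
    have oy := rO y yr; have Oy := homega_sub y oy.
    by rewrite /J /J' rpartE// ipartE//= Hy.
  move=> x s r b s0 r0 rb bD.
  exact: (local_uniqueness oO Doo Ha symA' k0 ell Hr Hi M0 HL s0 r0 rb bD).
apply: filterS Z => x Hx Ox; have [] := Hx Ox.
rewrite /J /J' rpartE// ipartE//= => hr hi.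
by apply/eqP; rewrite eq_complex hr hi !eqxx.
Qed.
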